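(* Let $3\le k\le\frac N2$ and $G=\mathrm{Gr}(k,\mathbb C^N)$. For $2\le l\le k-1$, the distance-$l$ secant orbit $\Sigma_{l,G}$ has dimension $$\dim\Sigma_{l,G}=\begin{cases}k(N-k)+l(N-l)-3&\text{for }l=2,\\ k(N-k)+l(N-l)+1&\text{for }l\ge3.\end{cases}$$ In particular, for any $3\le l\le k$ the closure $\overline{\Theta_{l,G}}$ is a codimension $1$ subvariety of $\overline{\Sigma_{l,G}}$.
   Context: $G=\mathrm{Gr}(k,\mathbb C^N)\subset\mathbb P(\bigwedge^k\mathbb C^N)$ is the Grassmannian in its Plücker embedding; $p=[v_1\wedge\dots\wedge v_k]$ corresponds to $H_p=\langle v_1,\dots,v_k\rangle$. The Hamming distance $d(p,q)$ of $p\ne q$ in $G$ is the minimum $r$ for which there exist $p=p_0,\dots,p_r=q$ in $G$ such that each line $\langle p_i,p_{i+1}\rangle$ is contained in $G$. For $1\le l\le k$: $\Sigma_{l,G}$ is the set of points $[u+v]\in\mathbb P(\bigwedge^k\mathbb C^N)$ with $u,v$ nonzero decomposable vectors and $d([u],[v])=l$. The affine tangent space to $G$ at $p$ is $\hat T_pG=\bigwedge^{k-1}H_p\wedge\mathbb C^N$, and $\hat T_pG/\langle p\rangle\simeq\mathrm{Hom}(H_p,\mathbb C^N/H_p)$; $\Theta_{l,G}$ is the set of points $[t]$ such that, for some $p\in G$, $t\in\hat T_pG$ and the image of $t$ in $\mathrm{Hom}(H_p,\mathbb C^N/H_p)$ has rank $l$. Dimensions are those of (locally closed) subvarieties of projective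 space; bars denote Zariski closure. *)

(* Defs.v *)
From HB Require Import structures.
From mathcomp Require Import all_boot all_order all_algebra.
From mathcomp Require Import complex.
From mathcomp Require Import mpoly.
From mathcomp Require Import boolp classical_sets.
From mathcomp Require Import reals topology_structure.

Set Implicit Arguments.
Unset Strict Implicit.
Unset Printing Implicit Defensive.

Import GRing.Theory.
Local Open Scope classical_set_scope.
Local Open Scope ring_scope.

Section KrullDimension.
Context {T : topologicalType}.
Implicit Types A Z : set T.

(* Irreducibility of [Z] for the topology induced on [Z]. *)
Definition irreducible_set Z : Prop :=
  Z !=set0 /\
  forall C1 C2 : set T, closed C1 -> closed C2 ->
    Z `<=` C1 `|` C2 -> Z `<=` C1 \/ Z `<=` C2.

(* The library's [subspace A] isolates the points outside [A]; closedness
   relative to [A] is therefore spelled out. *)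
Definition closed_in A Z : Prop := exists2 C : set T, closed C & Z = A `&` C.

Definition irreducible_chain A (n : nat) : Prop :=
  exists Z : nat -> set T,
    (forall i, (i <= n)%N -> irreducible_set (Z i) /\ closed_in A (Z i)) /\
    (forall i, (i < n)%N -> Z i `<` Z i.+1).

(* [has_dim A d]: the space [A], with the induced topology, has (Krull)
   dimension [d]. *)
Definition has_dim A (d : nat) : Prop :=
  irreducible_chain A d /\ forall n, irreducible_chain A n -> (n <= d)%N.

Definition variety Z : Prop := closed Z /\ irreducible_set Z.

Definition codim1_subvariety Z A : Prop :=
  [/\ variety Z, variety A, Z `<=` A &
      exists2 d, has_dim Z d & has_dim A d.+1].

End KrullDimension.

(* [projspace F n] is the set of lines of F^n, i.e. the projective space of
   dimension n - 1. *)
Definition projspace (F : fieldType) (n : nat) : Type :=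
  {L : {vspace 'rV[F]_n} | \dim L == 1%N}.

HB.instance Definition _ F n := Choice.on (projspace F n).

Definition pline F n (p : projspace F n) : {vspace 'rV[F]_n} := val p.

(* [p] is the point [v]; as [pline p] has dimension 1, this forces [v != 0]. *)
Definition is_point F n (p : projspace F n) (v : 'rV[F]_n) : Prop :=
  pline p = <[v]>%VS.

Section Zariski.
Variables (F : fieldType) (n : nat).
Implicit Types (f : {mpoly F[n]}) (p : projspace F n).

Definition homogeneous f : Prop := exists d, f \is d.-homog.

Definition vanishes_at f p : Prop :=
  forall v, v \in pline p -> f.@[fun i => v 0 i] = 0.

Definition zero_locus (I : set {mpoly F[n]}) : set (projspace F n) :=
  [set p | forall f, I f -> vanishes_at f p].

Definition zariski_open (U : set (projspace F n)) : Prop :=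
  exists2 I : set {mpoly F[n]},
    (forall f, I f -> homogeneous f) & U = ~` zero_locus I.

Lemma meval_homog d f (c : F) (v : 'rV[F]_n) : f \is d.-homog ->
  f.@[fun i => (c *: v) 0 i] = c ^+ d * f.@[fun i => v 0 i].
Proof.
move=> /dhomogP hf; rewrite !mevalE big_distrr /= [LHS]big_seq [RHS]big_seq.
apply: eq_bigr => m /hf <-; rewrite mulrCA; congr (_ * _).
under eq_bigr => i _ do rewrite mxE exprMn.
by rewrite big_split /= mdegE expr_sum.
Qed.

Lemma vanishes_atM f g p : homogeneous f -> homogeneous g ->
  vanishes_at (f * g) p -> vanishes_at f p \/ vanishes_at g p.
Proof.
move=> [d hd] [e he] fg.
have [v pv] : exists v, pline p = <[v]>%VS.
  case: p fg => L L1 _; exists (vpick L); rewrite /pline /=; apply/esym/eqP.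
  rewrite eqEdim -memvE memv_pick dim_vline vpick0 (eqP L1).
  by rewrite -dimv_eq0 (eqP L1).
have vp : v \in pline p by rewrite pv memv_line.
have := fg v vp; rewrite mevalM => /eqP; rewrite mulf_eq0.
case/orP=> /eqP h0; [left|right] => w; rewrite pv => /vlineP [c ->].
  by rewrite (meval_homog _ _ hd) h0 mulr0.
by rewrite (meval_homog _ _ he) h0 mulr0.
Qed.

Lemma zariski_openT : zariski_open setT.
Proof.
exists [set 1] => [f ->|]; first by exists 0%N; exact: dhomog1.
apply/seteqP; split=> // -[L L1] _ /(_ 1 erefl 0).
by rewrite mem0v meval1 => /(_ isT) /eqP; rewrite oner_eq0.
Qed.

Lemma zariski_openI : setI_closed zariski_open.
Proof.
move=> _ _ [I hI ->] [J hJ ->].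
exists [set h | exists f g, [/\ I f, J g & h = f * g]].
  move=> _ [f [g [/hI [d hd] /hJ [e he] ->]]].
  by exists (d + e)%N; exact: dhomogM.
rewrite -setCU; congr (~` _); apply/seteqP; split=> p /=.
  move=> [hI0|hJ0] h [f [g [fI gJ ->]]] v pv; rewrite mevalM.
    by rewrite (hI0 _ fI _ pv) mul0r.
  by rewrite (hJ0 _ gJ _ pv) mulr0.
move=> hp; apply: contrapT => /not_orP [].
move=> /existsNP [f /not_implyP [fI nf]] /existsNP [g /not_implyP [gJ ng]].
case: (@vanishes_atM f g p (hI _ fI) (hJ _ gJ)) => //.
by apply: hp; exists f, g.
Qed.

Lemma zariski_open_bigU (K : Type) (U : K -> set (projspace F n)) :
  (forall i, zariski_open (U i)) -> zariski_open (\bigcup_i U i).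
Proof.
move=> hU.
exists [set f | homogeneous f /\ exists i, ~` U i `<=` vanishes_at f].
  by move=> f [].
apply/seteqP; split=> p /=.
  move=> [i _]; have [I hI UE] := hU i; rewrite UE => pI hp; apply: pI => f fI.
  apply: hp; split; first exact: hI.
  by exists i => q; rewrite UE setCK => /(_ f fI).
move=> hp; apply: contrapT => np; apply: hp => f [_]; case=> i; apply=> Up.
by apply: np; exists i.
Qed.

End Zariski.

HB.instance Definition _ (F : fieldType) (n : nat) :=
  isOpenTopological.Build (projspace F n)
    (@zariski_openT F n) (@zariski_openI F n) (@zariski_open_bigU F n).

Section Grassmannian.
Variables (F : fieldType) (k N : nat).

(* The standard basis of the k-th exterior power of F^N is indexed by the
   strictly increasing maps 'I_k -> 'I_N. *)
Definition kindex : Type :=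
  {s : {ffun 'I_k -> 'I_N} |
    [forall i : 'I_k, forall j : 'I_k, (i < j)%N ==> (s i < s j)%N]}.

Local Notation extpow := 'rV[F]_#|{: kindex}|.

(* For v_1, ..., v_k the rows of [M], [wedge M] is v_1 /\ ... /\ v_k, whose
   coordinates in the standard basis are the maximal minors of [M]. *)
Definition wedge (M : 'M[F]_(k, N)) : extpow :=
  \row_j \det (colsub (val (enum_val j : kindex)) M).

Local Notation point := (projspace F #|{: kindex}|).

Definition Gr : set point := [set p | exists M, is_point p (wedge M)].

(* Below, when [is_point p (wedge M)], the subspace H_p is the row space of
   [M]. *)

Definition decomposable (u : extpow) : Prop := exists M, u = wedge M.

Definition line_through (p q : point) : set point :=
  [set x | (pline x <= pline p + pline q)%VS].

Definition Gr_path (p q : point) (r : nat) : Prop :=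
  exists c : nat -> point,
    [/\ c 0%N = p, c r = q,
        forall i, (i <= r)%N -> Gr (c i) &
        forall i, (i < r)%N ->
          c i <> c i.+1 /\ line_through (c i) (c i.+1) `<=` Gr].

Definition hamming_dist (p q : point) (r : nat) : Prop :=
  Gr_path p q r /\ forall r', Gr_path p q r' -> (r <= r')%N.

Definition Sigma (l : nat) : set point :=
  [set x | exists u v : extpow,
     [/\ decomposable u, decomposable v, is_point x (u + v) &
         exists p q : point,
           [/\ is_point p u, is_point q v & hamming_dist p q l]]].

(* The affine tangent space at [wedge M]: the span of the products of k vectors
   of which all but one (at any position) are in the row space of [M], i.e. the
   smallest subspace containing them. *)
Definition affine_tangent (M : 'M[F]_(k, N)) : set extpow :=
  [set t | forall U : {vspace extpow},
     (forall B : 'M[F]_(k, N),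
        (exists j, forall i, i != j -> (row i B <= M)%MS) -> wedge B \in U) ->
     t \in U].

(* Let v_1, ..., v_k be the rows of [M], H their span, and let [A] stand for the
   linear map H -> F^N / H sending v_i to the class of the i-th row of [A].
   [tangent_of_hom M A] is the sum over i of
   v_1 /\ ... /\ A_i /\ ... /\ v_k, with A_i in position i; modulo [wedge M]
   it depends only on that linear map, and this is the isomorphism from
   Hom(H, F^N / H) to the affine tangent space modulo the line of [wedge M]. *)
Definition tangent_of_hom (M A : 'M[F]_(k, N)) : extpow :=
  \sum_(i < k) wedge (\matrix_j (if j == i then row j A else row j M)).

(* [cokermx M] realises the projection F^N -> F^N / H, its row kernel being H;
   so the map H -> F^N / H given by [A] has rank [\rank (A *m cokermx M)]. *)
Definition Theta (l : nat) : set point :=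
  [set x | exists t : extpow, is_point x t /\
     exists (p : point) (M : 'M[F]_(k, N)),
       [/\ is_point p (wedge M), affine_tangent M t &
           exists A : 'M[F]_(k, N),
             t - tangent_of_hom M A \in <[wedge M]>%VS /\
             \rank (A *m cokermx M) = l]].

End Grassmannian.

Arguments Sigma F k N l : clear implicits.
Arguments Theta F k N l : clear implicits.

(* Main.v *)
Require Import Defs.
From mathcomp Require Import all_boot all_order all_algebra fingroup perm.
From mathcomp Require Import complex mpoly boolp classical_sets.
From mathcomp Require Import reals topology_structure.
From mathcomp Require Import ring zify.

Set Implicit Arguments.
Unset Strict Implicit.
Unset Printing Implicit Defensive.

Import GRing.Theory.
Local Open Scope classical_set_scope.
Local Open Scope ring_scope.

(* A pair of k-subspaces at distance l admits an adapted basis of F^N, so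
   Sigma_l is a single GL_N-orbit in projective space, and so is Theta_l; the
   latter lies in the closure of the former because tangent lines are limits of
   secant lines.  For an orbit G.[x] the dimension is the rank of the derivative
   T |-> x.T on the Lie algebra, minus one.  Two facts about polynomial maps in
   characteristic zero give this: polynomials in the coordinates that are
   algebraically independent on the image have generically independent
   differentials, which bounds chains of irreducible closed sets from above,
   since the number of algebraically independent functions grows at each step of
   a chain; and a flag of affine subspaces through a point where the derivative
   has maximal rank is mapped to a chain of maximal length.  The two ranks are
   computed by exhibiting, for each base vector, a set of matrix units on which
   the derivative is injective and whose images span. *)

(** * Algebraic independence and Jacobians in characteristic zero *)

(** All rank computations live on affine cones, where polynomials are functions; this is the source
    of the shift by one between rank and dimension. Relations obtained by elimination are not
    homogeneous, so the parametrized vectors must be dense in the whole cone and not only in the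
    projective set; this is why k-th roots of scalars are required, [z%:M] acting on the k-th
    exterior power by [z ^+ k]. The constants have a geometric meaning. A point p has k(N-k)
    parameters, a q at distance l from it has l(k-l) + l(N-k) = l(N-l) more, and a point of their
    line one more. For l >= 3 the pair can be recovered up to finitely many choices. For l = 2,
    apart from the common factor, the vector is a bivector of rank 4, whose splittings into two
    decomposable ones form a family of dimension dim Sp_4 - dim (SL_2 x SL_2) = 4, and 1 - 4 = -3.
    On the tangent side, rank l maps from H_p to its quotient have l(N-l) parameters and the
    multiple of p makes up for projectivization: one parameter fewer than for secants. *)

Section Mpoly.
Variables (F : fieldType).

Lemma mpoly_alg_ind n (P : {mpoly F[n]} -> Prop) :
  (forall c, P c%:MP) -> (forall i, P 'X_i) ->
  (forall p q, P p -> P q -> P (p + q)) ->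
  (forall p q, P p -> P q -> P (p * q)) -> forall p, P p.
Proof.
move=> PC PX PD PM p; rewrite (mpolyE p).
apply: (big_ind P) => [||m _]; [by rewrite -(mpolyC0 n)|exact: PD|].
rewrite -mul_mpolyC mpolyXE_id; apply: (PM) => //.
apply: (big_ind P) => [||i _]; [by rewrite -(mpolyC1 n)|exact: PM|].
by elim: (m i) => [|a IH]; rewrite ?expr0 -?(mpolyC1 n) ?exprS //; apply: PM.
Qed.

Definition mcomp m n (f : 'I_n -> {mpoly F[m]}) (p : {mpoly F[n]}) : {mpoly F[m]} :=
  p \mPo [tuple f i | i < n].

Lemma mcompC m n (f : 'I_n -> {mpoly F[m]}) c : mcomp f c%:MP = c%:MP.
Proof. exact: comp_mpolyC. Qed.

Lemma mcompX m n (f : 'I_n -> {mpoly F[m]}) i : mcomp f 'X_i = f i.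
Proof. by rewrite /mcomp comp_mpolyXU -tnth_nth tnth_mktuple. Qed.

Lemma mcompD m n (f : 'I_n -> {mpoly F[m]}) : {morph mcomp f : p q / p + q}.
Proof. exact: comp_mpolyD. Qed.

Lemma mcompM m n (f : 'I_n -> {mpoly F[m]}) : {morph mcomp f : p q / p * q}.
Proof. exact: rmorphM. Qed.

Lemma mcomp_eval m n (f : 'I_n -> {mpoly F[m]}) p v :
  (mcomp f p).@[v] = p.@[fun i => (f i).@[v]].
Proof.
rewrite /mcomp comp_mpoly_meval; apply: meval_eq => i.
by rewrite tnth_mktuple.
Qed.

Lemma mderivXX n (i : 'I_n) : ('X_i : {mpoly F[n]})^`M(i) = 1.
Proof.
rewrite mderivX mnm1E eqxx scale1r -mpolyX0; congr 'X_[_].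
by apply/mnmP=> j; rewrite mnmBE mnm0E subnn.
Qed.

Lemma mderivX_neq n (i j : 'I_n) : j != i -> ('X_j : {mpoly F[n]})^`M(i) = 0.
Proof. by move=> /negbTE ji; rewrite mderivX mnm1E ji scale0r. Qed.

Lemma mderiv_mcomp m n (f : 'I_n -> {mpoly F[m]}) p i :
  (mcomp f p)^`M(i) = \sum_j mcomp f (p^`M(j)) * (f j)^`M(i).
Proof.
elim/mpoly_alg_ind: p => [c|j|p q IHp IHq|p q IHp IHq].
- rewrite mcompC mderivC big1 // => j _.
  by rewrite mderivC -(mpolyC0 n) mcompC mpolyC0 mul0r.
- rewrite mcompX (bigD1 j) //= big1 => [|a ja].
    by rewrite addr0 mderivXX /mcomp comp_mpoly1 mul1r.
  by rewrite mderivX_neq 1?eq_sym // -(mpolyC0 n) mcompC mpolyC0 mul0r.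
- rewrite mcompD mderivD IHp IHq -big_split /=; apply: eq_bigr => j _.
  by rewrite mderivD mcompD mulrDl.
rewrite mcompM mderivM IHp IHq mulr_suml mulr_sumr -big_split /=.
apply: eq_bigr => j _; rewrite mderivM mcompD !mcompM mulrDl; congr (_ + _).
  by rewrite -!mulrA; congr (_ * _); rewrite mulrC.
by rewrite mulrA.
Qed.

Lemma meval_muni n (p : {mpoly F[n.+1]}) (h : 'I_n.+1 -> F) :
  p.@[h] = (map_poly (meval (fun i => h (widen_ord (leqnSn n) i))) (muni p)).[h ord_max].
Proof.
rewrite mevalE muniE rmorph_sum /= horner_sum; apply: eq_bigr => m _.
rewrite -!mul_polyC !rmorphM /= !map_polyC /= map_polyXn !hornerE.
rewrite mevalZ mevalX big_ord_recr /= mulrA; congr (_ * _ * _).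
by apply: eq_bigr => i _; rewrite mnmE.
Qed.

(** A monomial is determined by its last exponent together with the remaining ones, so every
    coefficient of p can be read off [muni p]. *)
Lemma muni_inj n : injective (@muni n F).
Proof.
suff H (p : {mpoly F[n.+1]}) : muni p = 0 -> p = 0.
  by move=> p q /eqP; rewrite -subr_eq0 -raddfB => /eqP /H /eqP; rewrite subr_eq0 => /eqP.
move=> p0; apply/mpolyP=> m; rewrite mcoeff0.
pose m' : 'X_{1..n} := [multinom m (widen_ord (leqnSn n) i) | i < n].
have := congr1 (fun q : {poly {mpoly F[n]}} => q`_(m ord_max)@_m') p0.
rewrite coef0 mcoeff0 muniE coef_sum raddf_sum /= => E.
rewrite -[RHS]E; symmetry.
have H (m1 : 'X_{1..n.+1}) :
  ((p@_m1 *: 'X_[[multinom m1 (widen_ord (leqnSn n) i) | i < n]]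
     *: 'X^(m1 ord_max) : {poly {mpoly F[n]}})`_(m ord_max))@_m' =
  p@_m1 * (m1 == m)%:R.
  rewrite coefZ coefXn.
  have [->|ne] := eqVneq m1 m.
    by rewrite !eqxx !mulr1 mcoeffZ mcoeffX -/m' eqxx mulr1.
  rewrite mulr0; have [e|_] := eqVneq (m ord_max) (m1 ord_max); last by rewrite mulr0 mcoeff0.
  rewrite mulr1 mcoeffZ mcoeffX.
  suff -> : ([multinom m1 (widen_ord (leqnSn n) i) | i < n] == m') = false by rewrite mulr0.
  apply/negbTE; apply: contra ne => /eqP /mnmP e'; apply/eqP/mnmP=> i.
  case: (unliftP ord_max i) => [j ->|-> //].
  have := e' j; rewrite !mnmE.
  by have -> : widen_ord (leqnSn n) j = lift ord_max j
     by apply: val_inj => /=; rewrite /bump leqNgt ltn_ord.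
under eq_bigr => m1 _ do rewrite H.
have [im|nm] := boolP (m \in msupp p).
  rewrite (bigD1_seq m) //= ?msupp_uniq // eqxx mulr1 big1 ?addr0 // => a /negbTE ->.
  by rewrite mulr0.
rewrite (memN_msupp_eq0 nm) big_seq big1 // => a ap.
have [e|_] := eqVneq a m; last by rewrite mulr0.
by rewrite -e ap in nm.
Qed.


Hypothesis charF0 : [pchar F] =i pred0.

Lemma natf_inj : injective (fun n : nat => n%:R : F).
Proof.
have H := (pcharf0P F).1 charF0.
suff L a b : (a <= b)%N -> a%:R = b%:R :> F -> a = b.
  move=> a b /= e; case/orP: (leq_total a b) => ab; first exact: L.
  by symmetry; apply: L.
move=> ab /eqP; rewrite eq_sym -subr_eq0 -natrB // H subn_eq0 => ba.
by apply/eqP; rewrite eqn_leq ab.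
Qed.

Lemma poly_nonroot (p : {poly F}) : p != 0 -> exists x, p.[x] != 0.
Proof.
(* In characteristic zero these are [size p] distinct points, one more than the degree. *)
move=> p0; pose s := [seq (i%:R : F) | i <- iota 0 (size p)].
have us : uniq s by rewrite map_inj_uniq ?iota_uniq //; exact: natf_inj.
have : ~~ all (root p) s.
  apply: contraTN (leqnn (size p)) => rs; rewrite -ltnNge.
  by have := max_poly_roots p0 rs us; rewrite size_map size_iota.
by case/allPn => x _ nr; exists x.
Qed.

Lemma poly_fun0 (p : {poly F}) : (forall x, p.[x] = 0) -> p = 0.
Proof.
move=> h; apply/eqP; apply: contraT => /poly_nonroot [x].
by rewrite h eqxx.
Qed.

(** Induction on the number of variables: a point where the leading coefficient in the last variable
    is nonzero leaves a nonzero univariate polynomial. *)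
Lemma mpoly_nonroot n (p : {mpoly F[n]}) : p != 0 -> exists v, p.@[v] != 0.
Proof.
elim: n p => [|n IH] p p0.
  exists (fun=> 0); apply: contraNneq p0 => e; apply/eqP/mpolyP=> m.
  rewrite mcoeff0 -[RHS]e mevalE.
  have E0 (m' : 'X_{1..0}) : m' = m by apply/mnmP; case.
  have [im|nm] := boolP (m \in msupp p).
    rewrite (bigD1_seq m) ?msupp_uniq //= big_ord0 mulr1 big1 ?addr0 // => a.
    by rewrite (E0 a) eqxx.
  rewrite (memN_msupp_eq0 nm) big_seq big1 // => a; rewrite (E0 a) => am.
  by rewrite am in nm.
have q0 : muni p != 0 by rewrite -(muni0 n F) (inj_eq (@muni_inj n)).
have /IH [w w0] : lead_coef (muni p) != 0 by rewrite lead_coef_eq0.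
have : map_poly (meval w) (muni p) != 0.
  apply: contraNneq w0 => /(congr1 (fun q : {poly F} => q`_(size (muni p)).-1)).
  by rewrite coef_map coef0 lead_coefE => ->.
case/poly_nonroot => x x0.
exists (fun i => if unlift ord_max i is Some j then w j else x).
rewrite meval_muni unlift_none.
have -> // : map_poly (meval (fun i => if unlift ord_max (widen_ord (leqnSn n) i)
     is Some j then w j else x)) (muni p) = map_poly (meval w) (muni p).
apply: eq_map_poly => q /=; apply: meval_eq => i.
have -> : widen_ord (leqnSn n) i = lift ord_max i.
  by apply: val_inj => /=; rewrite /bump leqNgt ltn_ord.
by rewrite liftK.
Qed.

Lemma mpoly_fun0 n (p : {mpoly F[n]}) : (forall v, p.@[v] = 0) -> p = 0.
Proof.
move=> h; apply/eqP; apply: contraT => /mpoly_nonroot [x].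
by rewrite h eqxx.
Qed.

(** Independence is relative to a set [S], so that the same functions can be tested on the
    successive members of a chain. *)
Definition alg_indep (T : Type) (S : T -> Prop) r (f : 'I_r -> T -> F) :=
  forall P : {mpoly F[r]}, (forall t, S t -> P.@[f^~ t] = 0) -> P = 0.

(** The new entry comes last because [muni] singles out the last variable. *)
Definition snoc (T : Type) r (f : 'I_r -> T) (g : T) (i : 'I_r.+1) : T :=
  if unlift ord_max i is Some j then f j else g.

Lemma snoc_widen T r (f : 'I_r -> T) g i : snoc f g (widen_ord (leqnSn r) i) = f i.
Proof.
have -> : widen_ord (leqnSn r) i = lift ord_max i.
  by apply: val_inj => /=; rewrite /bump leqNgt ltn_ord.
by rewrite /snoc liftK.
Qed.

Lemma snoc_max T r (f : 'I_r -> T) g : snoc f g ord_max = g.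
Proof. by rewrite /snoc unlift_none. Qed.

Lemma meval_snoc (T : Type) r (f : 'I_r -> T -> F) (g : T -> F) P t :
  P.@[(snoc f g)^~ t] = (map_poly (meval (f^~ t)) (muni P)).[g t].
Proof.
rewrite meval_muni snoc_max; congr (_.[_]); apply: eq_map_poly => q /=.
by apply: meval_eq => i; rewrite snoc_widen.
Qed.

(* If P(f, g) vanishes on S, then P(f, 0) vanishes on S', so P is divisible by
   its last variable, which can be cancelled because g is regular on S. *)
Lemma alg_indep_step (T : Type) (S S' : T -> Prop) r (f : 'I_r -> T -> F) (g : T -> F) :
  (forall t, S' t -> S t) -> (forall t, S' t -> g t = 0) ->
  (forall Q : {poly {mpoly F[r]}},
     (forall t, S t -> (map_poly (meval (f^~ t)) Q).[g t] * g t = 0) ->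
     forall t, S t -> (map_poly (meval (f^~ t)) Q).[g t] = 0) ->
  alg_indep S' f -> alg_indep S (snoc f g).
Proof.
move=> SS g0 reg fS P P0; apply: muni_inj; rewrite muni0.
have : forall t, S t -> (map_poly (meval (f^~ t)) (muni P)).[g t] = 0.
  by move=> t St; rewrite -meval_snoc P0.
move: (muni P) => {P P0} Q; elim/poly_ind: Q => [//|Q c IH Q0].
have E t : (map_poly (meval (f^~ t)) (Q * 'X + c%:P)).[g t] =
    (map_poly (meval (f^~ t)) Q).[g t] * g t + c.@[f^~ t].
  by rewrite rmorphD rmorphM /= map_polyX map_polyC !hornerE.
have c0 : c = 0.
  by apply: fS => t St; have := Q0 t (SS _ St); rewrite E (g0 _ St) mulr0 add0r.
rewrite c0 IH ?mul0r ?addr0 //; apply: reg => t St.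
by have := Q0 t St; rewrite E c0 meval0 addr0.
Qed.

Lemma msize_mderiv n (p : {mpoly F[n]}) i : p != 0 -> (msize p^`M(i) < msize p)%N.
Proof.
move=> p0; have [->|d0] := eqVneq (p^`M(i)) 0; first by rewrite msize0 lt0n msize_poly_eq0.
have e := mlead_supp d0; rewrite -(mlead_deg d0).
have : (mlead p^`M(i) + U_(i))%MM \in msupp p.
  move: e; rewrite !mcoeff_msupp mcoeff_mderiv; apply: contraNneq => ->.
  by rewrite mul0rn.
by move/msize_mdeg_lt; rewrite mdegD mdeg1 addn1.
Qed.

Lemma mderiv_const n (p : {mpoly F[n]}) : (forall i, p^`M(i) = 0) -> p = (p@_0%MM)%:MP.
Proof.
move=> d0; apply/mpolyP => m; rewrite mcoeffC.
have [->|] := eqVneq m 0%MM; first by rewrite mulr1.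
rewrite mulr0 => m0; have [i im] : exists i, (0 < m i)%N.
  apply/existsP; apply: contraR m0; rewrite negb_exists => /forallP h.
  by apply/eqP/mnmP => i; have := h i; rewrite lt0n negbK mnm0E => /eqP.
have := congr1 (mcoeff (m - U_(i))) (d0 i).
rewrite mcoeff_mderiv mcoeff0 submK; last by rewrite lep1mP -lt0n.
move/eqP; rewrite -mulr_natr mulf_eq0 => /orP [/eqP -> //|].
by rewrite ((pcharf0P F).1 charF0).
Qed.

(** Rows are indexed by the variables: a direction, as a row vector, is multiplied on the right by
    the Jacobian, and its row space is the image of the derivative. *)
Definition jac m n (f : 'I_n -> {mpoly F[m]}) (v : 'I_m -> F) : 'M[F]_(m, n) :=
  \matrix_(i, j) ((f j)^`M(i)).@[v].

Lemma jac_mcomp m n r (f : 'I_n -> {mpoly F[m]}) (q : 'I_r -> {mpoly F[n]}) v :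
  jac (fun j => mcomp f (q j)) v = jac f v *m jac q (fun i => (f i).@[v]).
Proof.
apply/matrixP => i j; rewrite !mxE mderiv_mcomp rmorph_sum /=.
by apply: eq_bigr => a _; rewrite !mxE mevalM mcomp_eval mulrC.
Qed.

(** Differentiating a relation P(f) = 0 gives a linear system for the P_j(f) with nonzero
    determinant; hence all partial derivatives of P are again relations, of smaller size, and vanish
    by induction. Then P is constant, hence zero. *)
Lemma alg_indep_jac r (f : 'I_r -> {mpoly F[r]}) v :
  jac f v \in unitmx -> forall P, mcomp f P = 0 -> P = 0.
Proof.
move=> ju P; have [k] := ubnP (msize P); elim: k P => // k IH P le P0.
apply/eqP; apply: contraT => nz.
have d0 j : P^`M(j) = 0.
  apply: IH; first exact: leq_trans (msize_mderiv j nz) _.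
  pose y := \row_j mcomp f (P^`M(j)).
  pose J := \matrix_(j, i) (f j)^`M(i) : 'M[{mpoly F[r]}]_r.
  have yJ : y *m J = 0.
    apply/matrixP => a i; rewrite !mxE.
    transitivity ((mcomp f P)^`M(i)); last by rewrite P0 mderiv0.
    by rewrite mderiv_mcomp; apply: eq_bigr => b _; rewrite !mxE.
  have /matrixP /(_ 0 j) : y *m (\det J)%:M = 0 by rewrite -mul_mx_adj mulmxA yJ mul0mx.
  rewrite mul_mx_scalar !mxE => /eqP; rewrite mulf_eq0 => /orP [/eqP dJ|/eqP //].
  have : (\det J).@[v] = 0 by rewrite dJ meval0.
  rewrite -det_map_mx => dJ0; move: ju; rewrite unitmxE unitfE -det_tr.
  suff -> : (jac f v)^T = map_mx (meval v) J by rewrite dJ0 eqxx.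
  by apply/matrixP => a b; rewrite !mxE.
have Pc := mderiv_const d0; move: P0; rewrite Pc mcompC => /eqP.
by rewrite mpolyC_eq0 => /eqP c0; rewrite Pc c0 mpolyC0 eqxx in nz.
Qed.

Lemma msize_mulS n (p q : {mpoly F[n]}) d e : (msize p <= d.+1)%N -> (msize q <= e.+1)%N ->
  (msize (p * q) <= (d + e).+1)%N.
Proof.
move=> pd qe; have [->|p0] := eqVneq p 0; first by rewrite mul0r msize0.
have [->|q0] := eqVneq q 0; first by rewrite mulr0 msize0.
rewrite msizeM //; have := leq_add pd qe; rewrite addSn addnS.
by case: (_ + _)%N => // a; rewrite ltnS.
Qed.

Lemma msize_prodX n r (p : 'I_r -> {mpoly F[n]}) (e : 'I_r -> nat) D :
  (forall i, msize (p i) <= D.+1)%N ->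
  (msize (\prod_i p i ^+ e i) <= (\sum_i e i * D).+1)%N.
Proof.
move=> pD; apply: (big_ind2 (fun q d => msize q <= d.+1)%N) => [|q d q' d'|i _].
- by rewrite msize1.
- exact: msize_mulS.
elim: (e i) => [|a IH]; first by rewrite expr0 msize1.
by rewrite exprS mulSn; exact: msize_mulS.
Qed.

(** Counting argument: the number of monomials of bounded degree grows like a power r on the side of
    the relations but only like a power m on the side of the values, so some linear combination is
    killed. *)
Lemma mpoly_dep r m (p : 'I_r -> {mpoly F[m]}) : (m < r)%N ->
  exists2 P : {mpoly F[r]}, P != 0 & mcomp p P = 0.
Proof.
move=> mr; pose D := \max_i msize (p i).
(* Exponents below M in the [p i] give values of degree below E = (rD + 1)M; the choice M > (rD +
   1)^m ensures E^m < M^(m+1) <= M^r. *)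
pose M := ((r * D).+1 ^ m).+1; pose E := ((r * D).+1 * M)%N.
pose row := {ffun 'I_r -> 'I_M}; pose col := {ffun 'I_m -> 'I_E}.
pose mr' (a : row) : 'X_{1..r} := [multinom (a i : nat) | i < r].
pose mc (a : col) : 'X_{1..m} := [multinom (a i : nat) | i < m].
pose q (a : row) := \prod_i p i ^+ a i.
pose A := \matrix_(i < #|row|, j < #|col|) (q (enum_val i))@_(mc (enum_val j)).
have card_lt : (#|col| < #|row|)%N.
  rewrite !card_ffun !card_ord; apply: (@leq_trans (M ^ m.+1)).
    by rewrite /E expnMn expnS ltn_pmul2r // expn_gt0.
  by rewrite leq_exp2l // /M ltnS expn_gt0.
have [u /sub_kermxP uA u0] : exists2 u : 'rV_#|row|, (u <= kermx A)%MS & u != 0.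
  apply/rowV0Pn; rewrite -mxrank_eq0 mxrank_ker subn_eq0 -ltnNge.
  exact: leq_ltn_trans (rank_leq_col _) card_lt.
have mr_inj : injective mr'.
  move=> a b /mnmP e; apply/ffunP => i; apply: val_inj.
  by have := e i; rewrite !mnmE.
exists (\sum_i u 0 i *: 'X_[mr' (enum_val i)]).
  apply: contraNneq u0 => P0; apply/eqP/rowP => i; rewrite mxE.
  have := congr1 (mcoeff (mr' (enum_val i))) P0; rewrite mcoeff0 => <-.
  rewrite raddf_sum /= (bigD1 i) //= mcoeffZ mcoeffX eqxx mulr1.
  rewrite big1 ?addr0 // => j ji; rewrite mcoeffZ mcoeffX (inj_eq mr_inj).
  by rewrite (inj_eq enum_val_inj) (negbTE ji) mulr0.
apply/mpolyP => m'; rewrite mcoeff0.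
have -> : mcomp p (\sum_i u 0 i *: 'X_[mr' (enum_val i)]) = \sum_i u 0 i *: q (enum_val i).
  rewrite /mcomp raddf_sum /=; apply: eq_bigr => i _.
  rewrite comp_mpolyZ comp_mpolyX; congr (_ *: _); apply: eq_bigr => j _.
  by rewrite tnth_mktuple mnmE.
have [lt|/existsNP [i /negP]] := pselect (forall i, (m' i < E)%N).
  pose c : col := [ffun i => Ordinal (lt i)].
  have /rowP /(_ (enum_rank c)) := uA; rewrite !mxE => <-.
  rewrite raddf_sum /=; apply: eq_bigr => i _.
  rewrite mcoeffZ !mxE enum_rankK; congr (_ * _@_ _).
  by apply/mnmP => j; rewrite mnmE ffunE.
rewrite -leqNgt => lei; rewrite raddf_sum /= big1 // => j _.
rewrite mcoeffZ; apply/eqP; rewrite mulf_eq0; apply/orP; right.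
rewrite mcoeff_eq0; apply: contraL lei => /msize_mdeg_lt lt.
rewrite -ltnNge; apply: (@leq_ltn_trans (mdeg m')).
  by rewrite mdegE (bigD1 i) //= leq_addr.
apply: leq_trans lt _; apply: leq_trans (msize_prodX (D := D) _ _) _.
  by move=> a; apply: leqW; rewrite /D (bigmax_sup a).
rewrite /E mulSn addSn ltnS.
apply: (@leq_trans (r * D * M)); last exact: leq_addl.
apply: (@leq_trans (\sum_(i0 < r) M * D)).
  by apply: leq_sum => a _; rewrite leq_mul2r ltnW ?orbT.
by rewrite sum_nat_const card_ord mulnC -mulnA [(D * _)%N]mulnC mulnC -mulnA.
Qed.

Lemma meval_horner_mcomp m r (f : 'I_r -> {mpoly F[m]}) (Q : {poly {mpoly F[r]}}) g v :
  (map_poly (mcomp f) Q).[g].@[v] = (map_poly (meval (fun i => (f i).@[v])) Q).[g.@[v]].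
Proof.
rewrite -horner_map -map_poly_comp_id0 /=; last by rewrite /mcomp raddf0.
by congr (_.[_]); apply: eq_map_poly => q /=; rewrite mcomp_eval.
Qed.

(** Chain rule for Q(f, g). Only the coefficient of dg matters, so the combination of the df_a is
    left existential. *)
Lemma mderiv_mcomp_poly m r (f : 'I_r -> {mpoly F[m]}) (Q : {poly {mpoly F[r]}}) g :
  exists c : 'I_r -> {mpoly F[m]}, forall i,
    ((map_poly (mcomp f) Q).[g])^`M(i) =
    \sum_a c a * (f a)^`M(i) + (map_poly (mcomp f) Q^`()).[g] * g^`M(i).
Proof.
have E (P : {poly {mpoly F[r]}}) c : (map_poly (mcomp f) (P * 'X + c%:P)).[g] =
    (map_poly (mcomp f) P).[g] * g + mcomp f c.
  by rewrite /mcomp rmorphD rmorphM /= map_polyX map_polyC !hornerE.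
elim/poly_ind: Q => [|Q b [c IH]].
  exists (fun=> 0) => i; rewrite deriv0 /mcomp rmorph0 !hornerE mderiv0 big1 ?addr0 ?mul0r // => a _.
  by rewrite mul0r.
exists (fun a => c a * g + mcomp f (b^`M(a))) => i.
rewrite E mderivD mderivM IH mderiv_mcomp derivD derivM derivX derivC addr0 mulr1.
rewrite /mcomp rmorphD rmorphM /= map_polyX !hornerE.
have -> : \sum_a (c a * g + (b^`M(a) \mPo [tuple f i | i < r])) * (f a)^`M(i)
  = (\sum_a c a * (f a)^`M(i)) * g + \sum_a (b^`M(a) \mPo [tuple f i | i < r]) * (f a)^`M(i).
  rewrite mulr_suml -big_split /=; apply: eq_bigr => a _.
  by rewrite mulrDl; congr (_ + _); rewrite -!mulrA; congr (_ * _); rewrite mulrC.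
ring.
Qed.

(* Variables are adjoined to f as long as independence is kept; once no variable
   can be added, each of them is algebraic over f, and differentiating the
   algebraic relations puts all dX_j in the span of the df_a. *)
Lemma jac_generic_rank m r (f : 'I_r -> {mpoly F[m]}) :
  (forall P, mcomp f P = 0 -> P = 0) ->
  exists2 d : {mpoly F[m]}, d != 0 & forall v, d.@[v] != 0 -> \rank (jac f v) = r.
Proof.
have [k] := ubnP (m - r); elim: k r f => // k IH r f le fI.
have rm : (r <= m)%N.
  rewrite leqNgt; apply/negP => /(mpoly_dep f) [P P0 /fI Pz].
  by rewrite Pz eqxx in P0.
have [[j jI]|nI] := pselect (exists j, forall P, mcomp (snoc f 'X_j) P = 0 -> P = 0).
  have rm' : (r < m)%N.
    rewrite ltnNge; apply/negP; rewrite -ltnS => /(mpoly_dep (snoc f 'X_j)) [P P0 /jI Pz].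
    by rewrite Pz eqxx in P0.
  have [|d d0 dr] := IH _ _ _ jI; first by rewrite subnS prednK ?subn_gt0.
  (* The Jacobian of the enlarged family is that of [f] padded by a zero column, plus a matrix of
     rank at most one; since it has rank r + 1, that of [f] has rank at least r. *)
  exists d => // v /dr rJ; apply/eqP; rewrite eqn_leq rank_leq_col /= -ltnS -{1}rJ.
  pose A := \matrix_(a < r, b < r.+1) (widen_ord (leqnSn r) a == b)%:R : 'M[F]__.
  pose B := \matrix_(a < 1, b < r.+1) (ord_max == b)%:R : 'M[F]_(_, _).
  pose C := \matrix_(i < m, a < 1) (('X_j)^`M(i)).@[v] : 'M[F]_(_, _).
  have -> : jac (snoc f 'X_j) v = jac f v *m A + C *m B.
    apply/matrixP => i b; rewrite !mxE big_ord1 !mxE.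
    case: (unliftP ord_max b) => [b' ->|->].
      have w : lift ord_max b' = widen_ord (leqnSn r) b'.
        by apply: val_inj => /=; rewrite /bump leqNgt ltn_ord.
      rewrite (negbTE (neq_lift _ _)) mulr0 addr0 w snoc_widen (bigD1 b') //= !mxE eqxx mulr1.
      rewrite big1 ?addr0 // => a ab; rewrite !mxE -val_eqE /= val_eqE.
      by rewrite (negbTE ab) mulr0.
    rewrite snoc_max eqxx mulr1 big1 ?add0r // => a _; rewrite !mxE -val_eqE /=.
    by rewrite (ltn_eqF (ltn_ord a)) mulr0.
  apply: leq_trans (mxrank_add _ _) _; rewrite -[X in (_ <= X)%N]addn1; apply: leq_add.
    exact: mxrankM_maxl.
  apply: leq_trans (mxrankM_maxl _ _) _; exact: rank_leq_col.
have /fin_all_exists [E HE] : forall j : 'I_m, exists Ej : {mpoly F[m]}, Ej != 0 /\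
    exists c : 'I_r -> {mpoly F[m]}, forall i,
      \sum_a c a * (f a)^`M(i) + Ej * ('X_j)^`M(i) = 0.
  move=> j; have [P [P0 fP]] : exists P, P != 0 /\ mcomp (snoc f 'X_j) P = 0.
    apply: contrapT => nP; apply: nI; exists j => P fP; apply/eqP.
    by apply: contraT => P0; case: nP; exists P.
  have : exists2 Q, Q != 0 & (map_poly (mcomp f) Q).['X_j] = 0.
    exists (muni P); first by rewrite -(muni0 r F) (inj_eq (@muni_inj r)).
    apply: mpoly_fun0 => v; rewrite meval_horner_mcomp.
    rewrite -(meval_snoc (fun i v => (f i).@[v]) (fun v => ('X_j).@[v]) _ v).
    rewrite -[RHS](meval0 v) -fP mcomp_eval; apply: meval_eq => i.
    by rewrite /snoc; case: (unlift _ _).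
  (* Descent to a relation whose derivative does not vanish at ['X_j]: otherwise the derivative is
     itself a smaller relation, and it is zero only if Q is constant, which the independence of [f]
     excludes. *)
  case=> Q; have [s] := ubnP (size Q); elim: s Q => // s IHs Q leQ Q0 fQ.
  have [E0|E0] := eqVneq ((map_poly (mcomp f) Q^`()).['X_j]) 0; last first.
    exists ((map_poly (mcomp f) Q^`()).['X_j]); split=> //.
    have [c Hc] := mderiv_mcomp_poly f Q 'X_j; exists c => i.
    by rewrite -Hc fQ mderiv0.
  have [Q'0|Q'0] := eqVneq (Q^`()) 0; last first.
    by apply: (IHs _ _ Q'0 E0); apply: leq_trans (lt_size_deriv Q0) _.
  have sQ : (size Q <= 1)%N.
    case es : (size Q) => [|[|a]] //.
    have := congr1 (fun P : {poly {mpoly F[r]}} => P`_a) Q'0.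
    rewrite coef0 coef_deriv -mulr_natr => /eqP; rewrite mulf_eq0 => /orP [/eqP c0|].
      by have := lead_coefE Q; rewrite es /= c0 => /eqP; rewrite lead_coef_eq0 (negbTE Q0).
    by rewrite -mpolyC_nat mpolyC_eq0 ((pcharf0P F).1 charF0).
  move: fQ Q0; rewrite (size1_polyC sQ) /mcomp map_polyC hornerC polyC_eq0 => /fI ->.
  by rewrite eqxx.
have E0 j : E j != 0 by case: (HE j).
have {HE} /fin_all_exists [c Hc] j := (HE j).2.
(* Where no [E j] vanishes, the column space of the Jacobian contains all m coordinate
   differentials, so that m <= rank <= r <= m. *)
exists (\prod_j E j) => [|v]; first by apply/prodf_neq0 => j _.
rewrite rmorph_prod /= => /prodf_neq0 Ev.
have mr : (m <= \rank (jac f v))%N.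
  pose C := \matrix_(a < r, j < m) (c j a).@[v].
  have e : jac f v *m C = diag_mx (\row_j (- (E j).@[v])).
    apply/matrixP => i j; rewrite !mxE; have := congr1 (meval v) (Hc j i).
    rewrite meval0 mevalD mevalM rmorph_sum /= => /eqP; rewrite addr_eq0 => /eqP H.
    transitivity (- ((E j).@[v] * (('X_j)^`M(i)).@[v])).
      by rewrite -H; apply: eq_bigr => a _; rewrite !mxE mevalM mulrC.
    have [->|ij] := eqVneq i j; first by rewrite mderivXX meval1 mulr1 mulr1n.
    by rewrite mderivX_neq 1?eq_sym // meval0 mulr0 mulr0n oppr0.
  suff rE : \rank (jac f v *m C) = m by rewrite -[X in (X <= _)%N]rE mxrankM_maxl.
  rewrite e; apply/mxrank_unit; rewrite unitmxE det_diag unitfE; apply/prodf_neq0 => j _.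
  by rewrite mxE oppr_eq0 Ev.
apply/eqP; rewrite eqn_leq rank_leq_col; exact: leq_trans rm mr.
Qed.

End Mpoly.

(** * Dimension of parametrized subsets of projective space *)

Section Projective.
Variables (F : fieldType) (n : nat).
Hypothesis charF0 : [pchar F] =i pred0.
Implicit Types (f g q : {mpoly F[n]}) (p : projspace F n) (A Z C : set (projspace F n)).
Implicit Types (v w : 'rV[F]_n).

Definition evalv q v : F := q.@[fun i => v 0 i].

Lemma closed_zero_locus (I : set {mpoly F[n]}) :
  (forall f, I f -> homogeneous f) -> closed (zero_locus I).
Proof.
move=> hI; rewrite -[zero_locus I]setCK; apply: open_closedC.
by exists I.
Qed.

Lemma closedP C : closed C ->
  exists2 I : set {mpoly F[n]}, (forall f, I f -> homogeneous f) & C = zero_locus I.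
Proof.
move=> /closed_openC [I hI e]; exists I => //.
by rewrite -[C]setCK e setCK.
Qed.

Lemma exists_vec p : exists2 v, v != 0 & is_point p v.
Proof.
case: p => L L1; exists (vpick L).
  by rewrite vpick0 -dimv_eq0 (eqP L1).
apply/esym/eqP; rewrite eqEdim -memvE memv_pick dim_vline vpick0 /pline /= (eqP L1).
by rewrite -dimv_eq0 (eqP L1).
Qed.

Lemma exists_point v : v != 0 -> exists p, is_point p v.
Proof.
move=> v0; have d1 : \dim <[v]>%VS == 1%N by rewrite dim_vline v0.
by exists (exist (fun L : {vspace _} => \dim L == 1%N) _ d1).
Qed.

Lemma is_point_neq0 p v : is_point p v -> v != 0.
Proof.
case: p => L L1; rewrite /is_point /pline /= => e.
by move: L1; rewrite e dim_vline eqb1.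
Qed.

Lemma is_point_inj p p' v : is_point p v -> is_point p' v -> p = p'.
Proof. by rewrite /is_point /pline => e e'; apply: val_inj; rewrite e e'. Qed.

Lemma is_point_mem p v : is_point p v -> v \in pline p.
Proof. by move->; exact: memv_line. Qed.

Lemma is_pointZ p v c : c != 0 -> is_point p v -> is_point p (c *: v).
Proof.
rewrite /is_point => c0 ->; apply/vspaceP => w; apply/vlineP/vlineP => -[d ->].
  by exists (d / c); rewrite scalerA mulfVK.
by exists (d * c); rewrite scalerA.
Qed.

Lemma mem_point p v w : is_point p v -> w \in pline p -> exists c, w = c *: v.
Proof. by move=> -> /vlineP. Qed.

Lemma evalv_homog d f c v : f \is d.-homog -> evalv f (c *: v) = c ^+ d * evalv f v.
Proof. exact: meval_homog. Qed.

Lemma vanishes_homog p f v : is_point p v -> homogeneous f -> evalv f v = 0 -> vanishes_at f p.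
Proof.
move=> pv [d fd] f0 w /(mem_point pv) [c ->].
by rewrite -[LHS]/(evalv _ _) (evalv_homog _ _ fd) f0 mulr0.
Qed.

Definition hcomp d q := pihomog mdeg d q.

Lemma hcomp_homog d q : hcomp d q \is d.-homog. Proof. exact: pihomogP. Qed.

Lemma evalv_hcomp q v c : evalv q (c *: v) = \sum_(d < msize q) c ^+ d * evalv (hcomp d q) v.
Proof.
rewrite {1}(@pihomog_partitionE n F mdeg (msize q) q) // /evalv rmorph_sum /=.
by apply: eq_bigr => d _; exact: evalv_homog (hcomp_homog d q).
Qed.

Lemma hcomp_vanish q v : (forall c, c != 0 -> evalv q (c *: v) = 0) ->
  forall d, evalv (hcomp d q) v = 0.
Proof.
move=> H d; pose P := \poly_(i < msize q) evalv (hcomp i q) v.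
(* Vanishing is only known for nonzero c; the factor ['X] takes care of c = 0. *)
have P0 : P * 'X = 0.
  apply: (poly_fun0 charF0) => c; rewrite !hornerE; have [->|c0] := eqVneq c 0; first by rewrite mulr0.
  suff -> : P.[c] = evalv q (c *: v) by rewrite H ?mul0r.
  rewrite horner_poly evalv_hcomp.
  by apply: eq_bigr => i _; rewrite mulrC.
have {}P0 : P = 0 by move/eqP: P0; rewrite mulf_eq0 polyX_eq0 orbF => /eqP.
have [ltd|led] := ltnP d (msize q); last first.
  rewrite /hcomp /pihomog big_seq_cond big1 ?/evalv ?meval0 // => m /andP[/msize_mdeg_lt lt /eqP e].
  by move: lt; rewrite e ltnNge led.
by have := congr1 (fun P : {poly F} => P`_d) P0; rewrite coef_poly ltd coef0.
Qed.

Lemma hcomp_vanishes q p : vanishes_at q p -> forall d, vanishes_at (hcomp d q) p.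
Proof.
move=> qp d; have [v v0 pv] := exists_vec p.
apply: (vanishes_homog pv); first by exists d; exact: hcomp_homog.
apply: hcomp_vanish => c c0; apply: qp; apply: memvZ; exact: is_point_mem.
Qed.

Lemma vanishes_hcomp q p : (forall d, vanishes_at (hcomp d q) p) -> vanishes_at q p.
Proof.
move=> qp v pv; rewrite -[LHS]/(evalv q v) -[v]scale1r evalv_hcomp big1 // => d _.
by rewrite [evalv _ _]qp ?mulr0.
Qed.

(** Vanishing on a whole line amounts to vanishing of all homogeneous components. Non-homogeneous
    relations thereby also pass to closures. *)
Lemma vanishes_closed q : closed [set p | vanishes_at q p].
Proof.
have -> : [set p | vanishes_at q p] = zero_locus [set f | exists d, f = hcomp d q].
  apply/seteqP; split=> p /=.
    by move=> qp f [d ->]; exact: hcomp_vanishes.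
  by move=> h; apply: vanishes_hcomp => d; apply: h; exists d.
by apply: closed_zero_locus => f [d ->]; exists d; exact: hcomp_homog.
Qed.

Lemma closure_vanishes A q p :
  (forall a, A a -> vanishes_at q a) -> closure A p -> vanishes_at q p.
Proof.
move=> Aq; rewrite closureEbigcap => /(_ [set p | vanishes_at q p]); apply.
by split; [exact: vanishes_closed|].
Qed.

Lemma in_closure A p :
  (forall f, homogeneous f -> (forall a, A a -> vanishes_at f a) -> vanishes_at f p) ->
  closure A p.
Proof.
move=> h; rewrite closureEbigcap => C /= [/closedP [I hI ->] AI] f fI.
by apply: h; [exact: hI|move=> a /AI /(_ f fI)].
Qed.

(** The ideal of an irreducible set is prime, in the asymmetric form needed later: g is a
    homogeneous equation of a smaller closed set, while q is an arbitrary polynomial, treated one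
    component at a time. *)
Lemma irreducible_prime Z g q : irreducible_set Z -> homogeneous g ->
  (exists2 p, Z p & ~ vanishes_at g p) ->
  (forall p, Z p -> vanishes_at (q * g) p) -> forall p, Z p -> vanishes_at q p.
Proof.
move=> [_ Zirr] hg [p0 Zp0 ng] qg p Zp; apply: vanishes_hcomp => d.
have [||||h] := Zirr [set p | vanishes_at (hcomp d q) p] [set p | vanishes_at g p].
- exact: vanishes_closed.
- exact: vanishes_closed.
- move=> a Za /=; have [v v0 av] := exists_vec a.
  have [g0|g0] := eqVneq (evalv g v) 0.
    by right; exact: vanishes_homog av hg g0.
  left; apply: (vanishes_homog av); first by exists d; exact: hcomp_homog.
  apply: hcomp_vanish => c c0; have [e ge] := hg.
  have := qg _ Za (c *: v) (memvZ _ (is_point_mem av)).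
  rewrite mevalM => /eqP; rewrite mulf_eq0 => /orP [/eqP //|].
  by rewrite -[X in X == _]/(evalv _ _) (evalv_homog _ _ ge) mulf_eq0 expf_eq0 (negbTE c0) andbF (negbTE g0).
- by move=> h; exact: h.
by case: ng; exact: h.
Qed.

Definition cone A v := exists2 p, A p & v \in pline p.

Lemma cone_vanishes A q :
  (forall v, cone A v -> evalv q v = 0) <-> (forall p, A p -> vanishes_at q p).
Proof.
split=> [h p Ap v pv|h v [p Ap pv]]; first by apply: h; exists p.
exact: h pv.
Qed.

Definition polyfam r (q : 'I_r -> {mpoly F[n]}) (i : 'I_r) v := evalv (q i) v.

Lemma evalv_poly r (q : 'I_r -> {mpoly F[n]}) (Q : {poly {mpoly F[r]}}) g v :
  (map_poly (meval (fun i => polyfam q i v)) Q).[evalv g v] =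
  evalv (map_poly (mcomp q) Q).[g] v.
Proof. by rewrite /evalv meval_horner_mcomp. Qed.

Lemma alg_indep_snoc_cone Z (S' : 'rV[F]_n -> Prop) r (q : 'I_r -> {mpoly F[n]}) g :
  irreducible_set Z -> homogeneous g -> (exists2 p, Z p & ~ vanishes_at g p) ->
  (forall v, S' v -> cone Z v) -> (forall v, S' v -> evalv g v = 0) ->
  alg_indep S' (polyfam q) -> alg_indep (cone Z) (polyfam (snoc q g)).
Proof.
move=> Zi hg ng SZ g0 qi P P0.
apply: (alg_indep_step (g := evalv g) SZ g0 _ qi) => [Q Q0 v Zv|v Zv].
  rewrite evalv_poly; move: v Zv; apply/cone_vanishes/(irreducible_prime Zi hg ng)/cone_vanishes.
  by move=> v Zv; rewrite /evalv mevalM -/(evalv _ _) -evalv_poly; exact: Q0.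
rewrite -(P0 v Zv); apply: meval_eq => i.
by rewrite /polyfam /snoc; case: (unlift _ _).
Qed.

(** Each strict inclusion contributes an equation vanishing on the smaller cone but not on the
    larger irreducible one. The passage from the origin to the cone over [Z 0] contributes one more,
    whence m + 1 functions for a chain of length m. *)
Lemma chain_alg_indep A m : irreducible_chain A m ->
  exists q : 'I_m.+1 -> {mpoly F[n]}, alg_indep (cone A) (polyfam q).
Proof.
case=> Z [ZI ZS].
suff H i : (i <= m)%N -> exists q : 'I_i.+1 -> {mpoly F[n]}, alg_indep (cone (Z i)) (polyfam q).
  have [q qi] := H _ (leqnn m); exists q => P P0; apply: qi => v [p Zp pv].
  apply: P0; exists p => //; have [_ [C _ e]] := ZI _ (leqnn m).
  by move: Zp; rewrite e => -[].
elim: i => [_|i IH lt].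
  have [[[p Zp] Z0] _] := ZI _ (leq0n m).
  have [v v0 pv] := exists_vec p.
  have [j vj] : exists j, v 0 j != 0.
    by apply/existsP; apply: contraR v0; rewrite negb_exists => /forallP h; apply/eqP/rowP => j;
       have := h j; rewrite mxE negbK => /eqP.
  (* The family before ['X_j] is empty; it is trivially independent on the origin alone. *)
  exists (snoc (fun=> 0) 'X_j).
  apply: (@alg_indep_snoc_cone _ (fun v => v = 0)).
  - by split=> //; exists p.
  - exists 1%N; rewrite dhomogX; apply/eqP; exact: mdeg1.
  - exists p => // /(_ v (is_point_mem pv)); rewrite mevalXU => e.
    by rewrite e eqxx in vj.
  - by move=> w ->; exists p => //; rewrite mem0v.
  - by move=> w ->; rewrite /evalv mevalXU mxE.
  move=> P /(_ 0 erefl) e; apply: (mpoly_fun0 charF0) => u; rewrite -[RHS]e.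
  by apply: meval_eq; case.
have [q qi] := IH (ltnW lt).
have [Zi _] := ZI _ lt; have [_ [C /closedP [I hI ->] eC]] := ZI _ (ltnW lt).
have [Zsub nZ] := ZS _ lt.
have [p Zp np] : exists2 p, Z i.+1 p & ~ Z i p.
  by apply: contrapT => h; apply: nZ => p Zp; apply: contrapT => np; apply: h; exists p.
have Ap : A p by have [_ [C' _ e]] := ZI _ lt; move: Zp; rewrite e => -[].
have [g Ig ng] : exists2 g, I g & ~ vanishes_at g p.
  apply: contrapT => h; apply: np; rewrite eC; split=> // g Ig.
  by apply: contrapT => ng; apply: h; exists g.
exists (snoc q g); apply: (@alg_indep_snoc_cone _ (cone (Z i))) => //.
- exact: hI.
- by exists p.
- by move=> v [a Za av]; exists a => //; exact: Zsub.
by move=> v [a]; rewrite eC => -[_ /(_ _ Ig)]; apply.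
Qed.

End Projective.

(** * Dimension of the closure of the image of a polynomial map *)

Section Param.
Variables (F : fieldType) (n : nat).
Hypothesis charF0 : [pchar F] =i pred0.
Implicit Types (A B Z : set (projspace F n)).

Definition pvec m (phi : 'I_n -> {mpoly F[m]}) (t : 'I_m -> F) : 'rV[F]_n :=
  \row_j (phi j).@[t].

Lemma evalv_pvec m (phi : 'I_n -> {mpoly F[m]}) q t :
  evalv q (pvec phi t) = (mcomp phi q).@[t].
Proof. by rewrite mcomp_eval; apply: meval_eq => i; rewrite mxE. Qed.

Definition param_into A m (phi : 'I_n -> {mpoly F[m]}) (h : {mpoly F[m]}) :=
  forall t, h.@[t] != 0 -> exists2 p, A p & is_point p (pvec phi t).

(** As q may be non-homogeneous and [vanishes_at] concerns the whole line, this is density in the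
    affine cone over [A]. *)
Definition param_dense A m (phi : 'I_n -> {mpoly F[m]}) (h : {mpoly F[m]}) :=
  forall q, (forall t, h.@[t] != 0 -> evalv q (pvec phi t) = 0) ->
  forall p, A p -> vanishes_at q p.

(** If equations f1 of C1 and f2 of C2 both pulled back to nonzero polynomials, their product with h
    would be nonzero somewhere, giving a point of A outside C1 and C2. *)
Lemma irreducible_param A m (phi : 'I_n -> {mpoly F[m]}) h : h != 0 ->
  param_into A phi h ->
  (forall q, homogeneous q -> (forall t, h.@[t] != 0 -> evalv q (pvec phi t) = 0) ->
     forall p, A p -> vanishes_at q p) -> irreducible_set A.
Proof.
move=> h0 inA dA; split.
  have [t /inA [p Ap _]] := mpoly_nonroot charF0 h0; by exists p.
move=> C1 C2 /closedP [I1 H1 ->] /closedP [I2 H2 ->] sub.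
apply: contrapT => /not_orP [n1 n2].
have N I : (forall f, I f -> homogeneous f) -> ~ A `<=` zero_locus I ->
    exists2 f, I f & mcomp phi f != 0.
  move=> hI nI; apply: contrapT => H; apply: nI => p Ap f fI.
  apply: (dA f) => //; first exact: hI.
  move=> t ht; rewrite evalv_pvec; have [->|f0] := eqVneq (mcomp phi f) 0; first by rewrite meval0.
  by case: H; exists f.
have [f1 I1f f10] := N _ H1 n1; have [f2 I2f f20] := N _ H2 n2.
have : mcomp phi f1 * mcomp phi f2 * h != 0 by rewrite !mulf_neq0.
case/(mpoly_nonroot charF0) => t; rewrite !mevalM !mulf_eq0 !negb_or -!evalv_pvec.
move=> /andP[/andP[e1 e2] /inA [p Ap pt]].
have [/(_ _ I1f)|/(_ _ I2f)] := sub _ Ap; move/(_ _ (is_point_mem pt)) => /eqP; apply/negP; [exact: e1|exact: e2].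
Qed.

Lemma irreducible_between A B : irreducible_set A -> A `<=` B -> B `<=` closure A ->
  irreducible_set B.
Proof.
move=> [[p Ap] Ai] AB BA; split; first by exists p; exact: AB.
move=> C1 C2 c1 c2 BC; have [h|h] := Ai _ _ c1 c2 (subset_trans AB BC); [left|right];
 by apply: subset_trans BA _; rewrite closureEbigcap => x; apply; split.
Qed.

(** By density the k + 1 independent functions on the cone over B stay independent after pullback
    along [phi]. Their Jacobian has generic rank k + 1 and factors through that of [phi]. *)
Lemma chain_le A B m (phi : 'I_n -> {mpoly F[m]}) h D k :
  h != 0 -> param_dense A phi h ->
  (forall t, h.@[t] != 0 -> (\rank (jac phi t) <= D)%N) ->
  A `<=` B -> B `<=` closure A -> irreducible_chain B k -> (k < D)%N.
Proof.
move=> h0 dA rD AB BA /(chain_alg_indep charF0) [q qi].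
pose f i := mcomp phi (q i).
have fi P : mcomp f P = 0 -> P = 0.
  move=> P0; apply: qi.
  suff H : forall v, cone B v -> evalv (mcomp q P) v = 0.
    by move=> v /H; rewrite /evalv mcomp_eval.
  apply/cone_vanishes => p /BA; apply: (closure_vanishes charF0); apply: dA => t _.
  rewrite evalv_pvec -(meval0 t) -P0 !mcomp_eval.
  by apply: meval_eq => i; rewrite /f mcomp_eval.
have [d d0 dr] := jac_generic_rank charF0 fi.
have [t] := mpoly_nonroot charF0 (mulf_neq0 h0 d0).
rewrite mevalM mulf_eq0 negb_or => /andP[/rD Jr /dr Jf].
rewrite -[X in (X <= _)%N]Jf (jac_mcomp phi q).
exact: leq_trans (mxrankM_maxl _ _) Jr.
Qed.

Section Flag.
Variables (m e : nat) (phi : 'I_n -> {mpoly F[m]}) (h : {mpoly F[m]}) (t0 : 'I_m -> F).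
Variable V : nat -> 'I_m -> F.
Hypothesis h0 : h.@[t0] != 0.

(** Parameters are sequences on [nat], so that one type serves all members of the flag. *)
Definition flag_pt i (s : nat -> F) (j : 'I_m) : F := t0 j + \sum_(a < i) s a * V a j.

Definition flag_set i : set (projspace F n) :=
  [set p | exists2 s, h.@[flag_pt i s] != 0 & is_point p (pvec phi (flag_pt i s))].

Definition flag_poly i (j : 'I_m) : {mpoly F[i.+1]} :=
  (t0 j)%:MP + \sum_(a < i) V a j *: 'X_(lift ord0 a).

(** The additional variable ['X_ord0] is a scaling factor: i + 1 parameters describe the cone over
    [flag_set i]. *)
Definition flag_par i (j : 'I_n) : {mpoly F[i.+1]} := 'X_ord0 * mcomp (flag_poly i) (phi j).

Definition flag_args i c (s : nat -> F) (a : 'I_i.+1) : F :=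
  if unlift ord0 a is Some b then s b else c.

Lemma flag_poly_eval i c s j : (flag_poly i j).@[flag_args c s] = flag_pt i s j.
Proof.
rewrite mevalD mevalC rmorph_sum /=; congr (_ + _); apply: eq_bigr => a _.
by rewrite mevalZ mevalXU /flag_args liftK mulrC.
Qed.

Lemma flag_comp_eval i c s (q : {mpoly F[m]}) :
  (mcomp (flag_poly i) q).@[flag_args c s] = q.@[flag_pt i s].
Proof. by rewrite mcomp_eval; apply: meval_eq => j; rewrite flag_poly_eval. Qed.

Lemma flag_par_eval i c s :
  pvec (flag_par i) (flag_args c s) = c *: pvec phi (flag_pt i s).
Proof.
apply/rowP => j; rewrite !mxE mevalM mevalXU flag_comp_eval.
by rewrite /flag_args unlift_none.
Qed.

Lemma flag_args_surj i (u : 'I_i.+1 -> F) : exists c s, u =1 flag_args c s.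
Proof.
exists (u ord0), (fun a => if insub a is Some b then u (lift ord0 (b : 'I_i)) else 0) => a.
rewrite /flag_args; case: unliftP => [b ->|->] //.
by rewrite valK.
Qed.

Lemma flag_pt0 i : flag_pt i (fun=> 0) =1 t0.
Proof. by move=> j; rewrite /flag_pt big1 ?addr0 // => a _; rewrite mul0r. Qed.

Lemma flag_h0 i : mcomp (flag_poly i) h != 0.
Proof.
apply/eqP => /(congr1 (meval (flag_args 1 (fun=> 0)))).
rewrite flag_comp_eval meval0 (meval_eq _ (flag_pt0 i)) => /eqP.
by rewrite (negbTE h0).
Qed.

Hypothesis phi0 : forall t, h.@[t] != 0 -> pvec phi t != 0.

Lemma flag_irreducible i : irreducible_set (flag_set i).
Proof.
apply: (@irreducible_param _ _ (flag_par i) ('X_ord0 * mcomp (flag_poly i) h)).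
- rewrite mulf_neq0 ?flag_h0 //; apply/eqP => /(congr1 (meval (fun=> 1))).
  by rewrite mevalXU meval0 => /eqP; rewrite oner_eq0.
- move=> u; have [c [s us]] := flag_args_surj u.
  have -> : pvec (flag_par i) u = c *: pvec phi (flag_pt i s).
    by rewrite -flag_par_eval; apply/rowP => j; rewrite !mxE (meval_eq _ us).
  rewrite (meval_eq _ us) mevalM mevalXU flag_comp_eval mulf_eq0 negb_or.
  rewrite /flag_args unlift_none => /andP[c0 hs].
  have [p pp] := exists_point (phi0 hs).
  by exists p; [exists s|exact: is_pointZ].
move=> q hq q0 p [s hs ps]; apply: (vanishes_homog ps) => //.
have := q0 (flag_args 1 s); rewrite flag_par_eval scale1r; apply.
by rewrite mevalM mevalXU flag_comp_eval /flag_args unlift_none mul1r.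
Qed.

Lemma flag_subset i : flag_set i `<=` flag_set i.+1.
Proof.
move=> p [s hs ps].
have E : flag_pt i.+1 (fun a => if (a < i)%N then s a else 0) = flag_pt i s.
  apply: funext => j; rewrite /flag_pt big_ord_recr /= ltnn mul0r addr0; congr (_ + _).
  by apply: eq_bigr => a _; rewrite ltn_ord.
by exists (fun a => if (a < i)%N then s a else 0); rewrite E.
Qed.

Variable Q : 'M[F]_(n, e.+1).
Hypothesis Q0 : forall b, (pvec phi t0 *m Q) 0 b = (b == ord0)%:R.
Hypothesis QV : forall (a : 'I_e) b,
  ((\row_j V a j) *m jac phi t0 *m Q) 0 b = (b == lift ord0 a)%:R.

(** The first i + 2 linear forms given by [Q] satisfy an algebraic relation on the cone over
    [flag_set i], which has only i + 1 parameters. An inclusion would extend it to the next cone.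
    There, at scale 1 and parameter 0, the derivatives are the base vector and the images of the
    directions [V a], to which the forms are dual: their Jacobian is the identity and no relation
    exists. *)
Lemma flag_strict i : (i < e)%N -> ~ flag_set i.+1 `<=` closure (flag_set i).
Proof.
move=> lie sub.
have le : (i.+2 <= e.+1)%N by [].
pose w (b : 'I_i.+2) : 'I_e.+1 := widen_ord le b.
pose q (b : 'I_i.+2) : {mpoly F[n]} := \sum_j Q j (w b) *: 'X_j.
have [P P0 PE] := mpoly_dep (fun b => mcomp (flag_par i) (q b)) (ltnSn i.+1).
move/eqP: P0; apply.
pose R := mcomp q P.
have RE k u : (mcomp (flag_par k) R).@[u] = (mcomp (fun b => mcomp (flag_par k) (q b)) P).@[u].
  by rewrite !mcomp_eval; apply: meval_eq => b; rewrite mcomp_eval.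
have R1 p : flag_set i.+1 p -> vanishes_at R p.
  move=> /sub; apply: (closure_vanishes charF0) => {}p [s hs ps] v /(mem_point ps) [c ->].
  by rewrite -flag_par_eval -[LHS]/(evalv _ _) evalv_pvec RE PE meval0.
apply: (alg_indep_jac charF0 (f := fun b => mcomp (flag_par i.+1) (q b)) (v := flag_args 1 (fun=> 0))).
  rewrite (_ : jac _ _ = 1%:M) ?unitmx1 // (jac_mcomp (flag_par i.+1) q).
  have jq u : jac q u = \matrix_(j, b) Q j (w b).
    apply/matrixP => j b; rewrite !mxE /q (raddf_sum (mderiv j)) raddf_sum /= (bigD1 j) //= big1 ?addr0.
      by rewrite mderivZ mderivXX mevalZ meval1 mulr1.
    by move=> a aj; rewrite mderivZ mderivX_neq // scaler0 meval0.
  have jp (a : 'I_i.+2) j : jac (flag_par i.+1) (flag_args 1 (fun=> 0)) a j =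
      (if unlift ord0 a is Some b then ((\row_j V b j) *m jac phi t0) 0 j else pvec phi t0 0 j).
    rewrite /flag_par mxE mderivM mevalD !mevalM mevalXU flag_comp_eval (meval_eq _ (flag_pt0 _)).
    rewrite {2}/flag_args unlift_none mul1r mderiv_mcomp [X in _ * _ + X]rmorph_sum /=.
    have E x : (flag_poly i.+1 x)^`M(a) = (if unlift ord0 a is Some b then V b x else 0)%:MP.
      rewrite /flag_poly mderivD mderivC add0r raddf_sum /=.
      under eq_bigr => b _ do rewrite mderivZ.
      case: unliftP => [b ->|->].
        rewrite (bigD1 b) //= mderivXX big1 ?addr0 -?mul_mpolyC ?mulr1 //.
        by move=> c cb; rewrite mderivX_neq ?scaler0 // (inj_eq lift_inj).
      by rewrite big1 ?mpolyC0 // => b _; rewrite mderivX_neq ?scaler0 // eq_sym neq_lift.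
    under eq_bigr => x _ do rewrite mevalM E mevalC flag_comp_eval (meval_eq _ (flag_pt0 _)).
    case: unliftP => [b ->|->].
      rewrite mderivX_neq ?neq_lift // meval0 !mul0r add0r mxE; apply: eq_bigr => x _.
      by rewrite !mxE mulrC.
    rewrite mderivXX meval1 big1 ?addr0 ?mul1r ?mxE // => x _.
    by rewrite mulr0.
  rewrite jq; apply/matrixP => a b; rewrite mxE.
  under eq_bigr => j _ do rewrite jp [X in _ * X]mxE.
  rewrite mxE; case: unliftP => [c ->|->]; last first.
    by have := Q0 (w b); rewrite mxE eq_sym => ->; rewrite -!val_eqE.
  have lc : (c < e)%N by exact: leq_trans (ltn_ord c) lie.
  have := QV (Ordinal lc) (w b); rewrite mxE => ->.
  by rewrite -!val_eqE /= eq_sym.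
apply: (mpoly_fun0 charF0) => u; rewrite -RE; apply/eqP.
(* Only parameters with h nonzero give points of the flag; multiplying by h covers the others, and h
   is then cancelled. *)
have : (mcomp (flag_par i.+1) R) * mcomp (flag_poly i.+1) h = 0.
  apply: (mpoly_fun0 charF0) => u'; have [c [s us]] := flag_args_surj u'.
  rewrite (meval_eq _ us) mevalM flag_comp_eval.
  have [->|hs] := eqVneq (h.@[flag_pt i.+1 s]) 0; first by rewrite mulr0.
  have [p pp] := exists_point (phi0 hs).
  rewrite -evalv_pvec flag_par_eval [evalv _ _](R1 p) ?mul0r //; first by exists s.
  exact/memvZ/is_point_mem.
move/eqP; rewrite mulf_eq0 (negbTE (flag_h0 _)) orbF => /eqP ->.
by rewrite meval0.
Qed.

End Flag.

(** D is the dimension of the cone. The inclusion of [pvec phi t] in the row space says that the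
    radial direction is tangent to the image; removing it leaves D - 1 directions for a flag. *)
Lemma param_dim A B m (phi : 'I_n -> {mpoly F[m]}) h D :
  h != 0 -> param_into A phi h -> param_dense A phi h ->
  (forall t, h.@[t] != 0 -> \rank (jac phi t) = D) ->
  (forall t, h.@[t] != 0 -> (pvec phi t <= jac phi t)%MS) ->
  A `<=` B -> B `<=` closure A -> has_dim B D.-1.
Proof.
move=> h0 inA dA rD euler AB BA.
have phi0 t : h.@[t] != 0 -> pvec phi t != 0.
  by move=> /inA [p _ /is_point_neq0].
split=> [|k Bk]; last first.
  have := chain_le (D := D) h0 dA _ AB BA Bk; case: D rD => [|D'] rD; last first.
    by rewrite ltnS; apply=> t /rD ->.
  by move=> H; have := H (fun t ht => eq_leq (rD t ht)).
have [t0 ht0] := mpoly_nonroot charF0 h0.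
have y0 := phi0 _ ht0; have rJ := rD _ ht0; have yJ := euler _ ht0.
move: y0 rJ yJ; set y := pvec phi t0; set J := jac phi t0 => y0 rJ yJ.
(* A complement of the radial line in the image of the derivative; preimages of its basis are the
   directions of the flag, and [Q] below is a right inverse giving the dual forms. *)
pose W := (J :\: y)%MS.
have ry : \rank y = 1%N by apply/eqP; rewrite rank_rV y0.
have [e De] : exists e, D = e.+1.
  by exists D.-1; rewrite prednK // -rJ -ry mxrankS.
have rW : \rank W = e.
  have := mxrank_cap_compl J y; rewrite -/W rJ De.
  by rewrite (capmx_idPr yJ) ry add1n => -[].
have [V Vfree] : exists V : 'M[F]_(e, m), row_free (col_mx y (V *m J)).
  suff : exists V : 'M[F]_(\rank W, m), row_free (col_mx y (V *m J)) by case: _ / rW.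
  exists (row_base W *m pinvmx J); rewrite mulmxKpV; last first.
    by rewrite eq_row_base diffmxSl.
  rewrite /row_free -addsmxE mxrank_disjoint_sum ?ry ?eq_row_base //.
  apply/eqP; rewrite -submx0 -(capmx_diff J y) capmxC.
  by apply: capmxS => //; rewrite eq_row_base.
have /row_freeP [Q QE] := Vfree.
have Q0 b : (y *m Q) 0 b = (b == ord0)%:R.
  have := congr1 (fun M : 'M_(1 + e) => M ord0 b) QE.
  rewrite mul_col_mx !mxE split1 unlift_none /= => E.
  by rewrite eq_sym -E mxE.
have QV (a : 'I_e) b : ((\row_j V a j) *m J *m Q) 0 b = (b == lift ord0 a)%:R.
  have := congr1 (fun M : 'M_(1 + e) => M (lift ord0 a) b) QE.
  rewrite mul_col_mx !mxE split1 liftK /= eq_sym => <-.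
  by rewrite !mxE; apply: eq_bigr => j _; rewrite !mxE; congr (_ * _); apply: eq_bigr => x _; rewrite !mxE.
rewrite De /=.
pose Vn (a : nat) (j : 'I_m) : F := if insub a is Some b then V (b : 'I_e) j else 0.
have QVn (a : 'I_e) b : ((\row_j Vn a j) *m J *m Q) 0 b = (b == lift ord0 a)%:R.
  rewrite -QV; congr ((_ *m _ *m _) _ _); apply/rowP => j.
  by rewrite !mxE /Vn valK.
have fA i : flag_set phi h t0 Vn i `<=` A.
  move=> p [s /inA [p' Ap' p's] ps]; by rewrite (is_point_inj ps p's).
(* As B need not be closed, closures are cut down to B; each such set still contains the irreducible
   [flag_set] and lies in its closure. *)
exists (fun i => B `&` closure (flag_set phi h t0 Vn i)); split=> i lti; last first.
  have lti' := flag_strict ht0 phi0 Q0 QVn lti.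
  split=> [p [Bp cp]|sub]; first by split=> //; apply: closure_subset cp; exact: flag_subset.
  apply: lti' => p fp; have [] // := sub p.
  by split; [apply: AB; exact: fA fp|exact: subset_closure].
split; last by exists (closure (flag_set phi h t0 Vn i)) => //; exact: closed_closure.
apply: (irreducible_between (flag_irreducible Vn ht0 phi0 i)).
  by move=> p fp; split; [apply: AB; exact: fA fp|exact: subset_closure].
by move=> p [].
Qed.

Lemma param_variety A m (phi : 'I_n -> {mpoly F[m]}) h :
  h != 0 -> param_into A phi h -> param_dense A phi h -> variety (closure A).
Proof.
move=> h0 inA dA; split; first exact: closed_closure.
apply: (irreducible_between _ (@subset_closure _ A)) => //.
by apply: (irreducible_param h0 inA) => q _; exact: dA.
Qed.

End Param.

(** * Pluecker coordinates and the action of GL_N *)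

Section Compound.
Variables (R : comNzRingType) (k N : nat).
Local Notation K := #|{: kindex k N}|.
Implicit Types (f : 'I_k -> 'I_N).

Definition sidx (j : 'I_K) : {ffun 'I_k -> 'I_N} := val (enum_val j : kindex k N).

Lemma sidx_lt j (a b : 'I_k) : (a < b)%N -> (sidx j a < sidx j b)%N.
Proof.
by rewrite /sidx; case: (enum_val j) => s /= /forallP /(_ a) /forallP /(_ b) /implyP.
Qed.

Lemma sidx_mono j (a b : 'I_k) : (sidx j a < sidx j b)%N = (a < b)%N.
Proof.
case: (ltngtP a b) => [/sidx_lt -> //|/(@sidx_lt j) h|/val_inj ->]; last by rewrite ltnn.
by rewrite ltnNge ltnW.
Qed.

Lemma sidx_inj j : injective (sidx j).
Proof.
move=> a b e; have [lt|lt|/val_inj //] := ltngtP a b.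
  by have := sidx_lt j lt; rewrite e ltnn.
by have := sidx_lt j lt; rewrite e ltnn.
Qed.

Lemma incr_perm1 (s : 'S_k) : (forall a b : 'I_k, (a < b)%N -> (s a < s b)%N) -> s = 1%g.
Proof.
have ge (t : 'S_k) : (forall a b : 'I_k, (a < b)%N -> (t a < t b)%N) -> forall a : 'I_k, (a <= t a)%N.
  move=> ht [a lt]; elim: a lt => [|a IH] lt //=.
  have lt' := ltnW lt; apply: leq_ltn_trans (IH lt') _.
  exact: ht.
move=> hs; apply/permP => a; rewrite perm1; apply: val_inj; apply/eqP.
rewrite eqn_leq ge // andbT.
have hV : forall b c : 'I_k, (b < c)%N -> ((s^-1)%g b < (s^-1)%g c)%N.
  move=> b c bc; rewrite ltnNge; apply: contraL bc => le; rewrite -leqNgt.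
  rewrite -[c](permKV s) -[b](permKV s); move: le; rewrite leq_eqVlt => /orP [/eqP /val_inj -> //|].
  by move/hs/ltnW.
by have := ge _ hV (s a); rewrite permK.
Qed.

Lemma sidx_perm_inj j j' (s s' : 'S_k) :
  sidx j \o s =1 sidx j' \o s' -> j = j' /\ s = s'.
Proof.
move=> e; have e' a : sidx j a = sidx j' ((s^-1 * s')%g a).
  by have := e ((s^-1)%g a); rewrite /= permKV permM.
have t1 : (s^-1 * s')%g = 1%g.
  by apply: incr_perm1 => a b; rewrite -(sidx_mono j a b) -(sidx_mono j' _ ((s^-1 * s')%g b)) !e'.
have ss : s = s' by rewrite -[LHS]mulg1 -t1 mulKVg.
split=> //; apply: enum_val_inj; apply: val_inj; apply/ffunP => a.
by have := e' a; rewrite t1 perm1.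
Qed.

Lemma sidx_sort f : injective f -> exists j (s : 'S_k), f =1 sidx j \o s.
Proof.
move=> fi; pose A := (f @: 'I_k)%SET.
have cA : #|A| = k by rewrite card_imset // card_ord.
have sortA : sorted (fun a b : 'I_N => (a < b)%N) (enum A).
  rewrite /enum_mem -enumT; apply: sorted_filter; first by move=> a b c; exact: ltn_trans.
  have := iota_ltn_sorted 0 N; rewrite -val_enum_ord sorted_map.
  by congr (sorted _ _).
pose s := [ffun i => enum_val (cast_ord (esym cA) i)] : {ffun 'I_k -> 'I_N}.
have sP : [forall i : 'I_k, forall j : 'I_k, (i < j)%N ==> (s i < s j)%N].
  apply/forallP => a; apply/forallP => b; apply/implyP => ab; rewrite !ffunE.
  rewrite !(enum_val_nth (f a)) /=.
  apply: (sorted_ltn_nth _ (f a) sortA) => //; last 2 first.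
  - by rewrite inE -cardE cA.
  - by rewrite inE -cardE cA.
  by move=> x y z; exact: ltn_trans.
have fA i : f i \in A by apply: imset_f.
pose g i := cast_ord cA (enum_rank_in (fA i) (f i)).
have gi : injective g.
  move=> a b /cast_ord_inj e; apply: fi.
  by rewrite -(enum_rankK_in (fA a) (fA a)) e enum_rankK_in.
exists (enum_rank (exist (fun s : {ffun 'I_k -> 'I_N} =>
   [forall i : 'I_k, forall j : 'I_k, (i < j)%N ==> (s i < s j)%N]) s sP : kindex k N)), (perm gi) => i.
by rewrite /sidx /= enum_rankK permE /= ffunE /g cast_ordK enum_rankK_in.
Qed.

(** [wedge] over any commutative ring: entries in polynomial rings provide perturbations and generic
    matrices. *)
Definition wedgeR (M : 'M[R]_(k, N)) : 'rV[R]_K := \row_j \det (colsub (sidx j) M).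

(** Coordinates for arbitrary index maps, as linear forms: at most one j and one s contribute,
    namely the sorted form of f and its sorting permutation, and none does when f repeats a
    value. *)
Definition plc f : 'cV[R]_K :=
  \col_j \sum_(s : 'S_k | [forall i, f i == sidx j (s i)]) (-1) ^+ s.

Definition plucker f (x : 'rV[R]_K) : R := (x *m plc f) 0 0.

Lemma det_colsub_noninj f (M : 'M[R]_(k, N)) a b : a != b -> f a = f b -> \det (colsub f M) = 0.
Proof.
move=> ab e; rewrite -det_tr; apply: (determinant_alternate ab) => i.
by rewrite !mxE e.
Qed.

Lemma det_colsub_perm f (s : 'S_k) (M : 'M[R]_(k, N)) :
  \det (colsub (f \o s) M) = (-1) ^+ s * \det (colsub f M).
Proof.
have -> : colsub (f \o s) M = col_perm s (colsub f M) by apply/matrixP => a b; rewrite !mxE.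
by rewrite col_permE det_mulmx det_perm odd_permV mulrC.
Qed.

Lemma plucker_wedge f M : plucker f (wedgeR M) = \det (colsub f M).
Proof.
rewrite /plucker mxE; under eq_bigr => j _ do rewrite !mxE.
have [/injectiveP fi|] := boolP (injectiveb f); last first.
  case/injectivePn => a [b ab e]; rewrite (det_colsub_noninj _ ab e) big1 // => j _.
  rewrite big_pred0 ?mulr0 // => s; apply/negbTE/negP => /forallP H.
  by case/eqP: ab; apply: (@perm_inj _ s); apply: (@sidx_inj j); rewrite -(eqP (H a)) -(eqP (H b)).
have [j [s e]] := sidx_sort fi.
have U j' (s' : 'S_k) : [forall i, f i == sidx j' (s' i)] = (j' == j) && (s' == s).
  apply/forallP/andP => [H|[/eqP -> /eqP ->] i]; last by rewrite e.
  have [|-> ->] := @sidx_perm_inj j' j s' s; last by rewrite !eqxx.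
  by move=> i /=; rewrite -(eqP (H i)) e.
rewrite (bigD1 j) //= [X in _ + X]big1 ?addr0; last first.
  move=> j' jj; rewrite big_pred0 ?mulr0 // => s'.
  by rewrite U (negbTE jj).
rewrite (big_pred1 s); last by move=> s'; rewrite U eqxx.
rewrite mulrC -det_colsub_perm; congr (\det _); apply/matrixP => a b.
by rewrite !mxE e.
Qed.

(** The k-th compound matrix, that is, the action of G on the k-th exterior power. *)
Definition Lam (G : 'M[R]_N) : 'M[R]_K := \matrix_(i, j) \det (mxsub (sidx i) (sidx j) G).

(** The Cauchy-Binet formula. The determinant is expanded over all index maps, and [plucker_wedge]
    regroups them by their sorted form. *)
Lemma wedge_mulr M G : wedgeR (M *m G) = wedgeR M *m Lam G.
Proof.
apply/rowP => j; rewrite !mxE.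
transitivity (\sum_(f : {ffun 'I_k -> 'I_N}) (\prod_b G (f b) (sidx j b)) * \det (colsub f M)).
  rewrite /determinant.
  under eq_bigr => s _ do under eq_bigr => i _ do rewrite !mxE.
  under eq_bigr => s _ do rewrite bigA_distr_bigA big_distrr /=.
  under [RHS]eq_bigr => f _ do rewrite big_distrr /=.
  rewrite [RHS]exchange_big /=; apply: eq_bigr => s _.
  have Pi : injective (fun f : {ffun 'I_k -> 'I_N} => [ffun i => f (s i)] : {ffun 'I_k -> 'I_N}).
    move=> f g /ffunP e; apply/ffunP => i; have := e ((s^-1)%g i).
    by rewrite !ffunE permKV.
  rewrite (reindex_inj Pi) /=; apply: eq_bigr => f _.
  rewrite mulrCA; congr (_ * _); rewrite big_split /= mulrC; congr (_ * _).
    rewrite [RHS](reindex_inj (@perm_inj _ s)) /=.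
    by apply: eq_bigr => i _; rewrite ffunE.
  by apply: eq_bigr => i _; rewrite ffunE !mxE.
under eq_bigr => f _ do rewrite -plucker_wedge /plucker mxE big_distrr /=.
rewrite exchange_big /=; apply: eq_bigr => i _; rewrite mxE.
under eq_bigr => f _ do rewrite mulrCA mxE big_distrr /=.
rewrite -big_distrr /= mxE; congr (_ * _).
rewrite -[RHS]det_tr /determinant [LHS]big_mkcond.
under eq_bigr => f _ do rewrite big_mkcond.
rewrite exchange_big /=; apply: eq_bigr => s _.
rewrite (bigD1 [ffun a => sidx i (s a)]) //= [X in _ + X]big1 ?addr0.
  case: ifP => [_|/negbT/forallPn [a]]; last by rewrite ffunE eqxx.
  rewrite mulrC; congr (_ * _); apply: eq_bigr => a _.
  by rewrite ffunE !mxE.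
move=> f ne; case: ifP => // /forallP H; case/eqP: ne; apply/ffunP => a.
by rewrite ffunE; apply/eqP.
Qed.

Lemma wedge_mull (Z : 'M[R]_k) M : wedgeR (Z *m M) = \det Z *: wedgeR M.
Proof.
by apply/rowP => j; rewrite !mxE -det_mulmx; congr (\det _); apply/matrixP => a b; rewrite !mxE; apply: eq_bigr => c _; rewrite !mxE.
Qed.

Lemma row_Lam i G : row i (Lam G) = wedgeR (rowsub (sidx i) G).
Proof.
apply/rowP => j; rewrite !mxE; congr (\det _); by apply/matrixP => a b; rewrite !mxE.
Qed.

Lemma LamM G H : Lam (G *m H) = Lam G *m Lam H.
Proof.
apply/row_matrixP => i; rewrite row_mul !row_Lam -wedge_mulr; congr wedgeR.
by apply/matrixP => a b; rewrite !mxE; apply: eq_bigr => c _; rewrite !mxE.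
Qed.

Lemma Lam_scalar c : Lam c%:M = (c ^+ k)%:M.
Proof.
apply/matrixP => i j; rewrite !mxE.
have [->|ij] := eqVneq i j.
  rewrite mulr1n -det_scalar; congr (\det _); apply/matrixP => a b.
  by rewrite !mxE (inj_eq (@sidx_inj j)).
rewrite mulr0n /determinant big1 // => s _.
have [/forallP H|/forallPn [a na]] := boolP [forall a, sidx i a == sidx j (s a)].
  have [|e _] := @sidx_perm_inj i j 1%g s; last by rewrite e eqxx in ij.
  by move=> a /=; rewrite perm1; apply/eqP.
by rewrite (bigD1 a) //= !mxE (negbTE na) mulr0n mul0r mulr0.
Qed.

Lemma Lam1 : Lam 1%:M = 1%:M.
Proof. by rewrite Lam_scalar expr1n. Qed.

End Compound.

(** * The orbit map of GL_N and its derivative *)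

Section Epsilon.
Variables (F : fieldType) (k N : nat).
Local Notation K := #|{: kindex k N}|.
Implicit Types (x : 'rV[F]_K) (g T : 'M[F]_N).

Lemma coef1_prod (I : eqType) (r : seq I) (q : I -> {poly F}) : uniq r ->
  (\prod_(i <- r) q i)`_1 = \sum_(i <- r) (q i)`_1 * \prod_(j <- r | j != i) (q j)`_0.
Proof.
have c0 (s : seq I) : (\prod_(i <- s) q i)`_0 = \prod_(i <- s) (q i)`_0.
  by rewrite -!horner_coef0 horner_prod; apply: eq_bigr => i _; rewrite horner_coef0.
elim: r => [|a r IH] /=; first by rewrite !big_nil coef1.
case/andP=> ar ur; rewrite !big_cons coefM big_ord_recr big_ord1 /= subnn c0 IH // eqxx /=.
rewrite addrC; congr (_ + _).
  congr (_ * _); rewrite [RHS]big_seq_cond [LHS]big_seq; apply: eq_bigl => i.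
  by case: (boolP (i \in r)) => //= ir; apply/esym; apply: contraNneq ar => <-.
rewrite mulr_sumr [LHS]big_seq [RHS]big_seq; apply: eq_bigr => i ir.
rewrite big_cons; have -> : a != i by apply: contraNneq ar => ->.
by rewrite mulrCA.
Qed.

(** A line through P with direction B; coefficients of degree 1 of expressions in it are directional
    derivatives. *)
Definition eps m n (P B : 'M[F]_(m, n)) : 'M[{poly F}]_(m, n) :=
  map_mx polyC P + 'X *: map_mx polyC B.

Lemma epsE m n (P B : 'M[F]_(m, n)) i j : eps P B i j = (P i j)%:P + 'X * (B i j)%:P.
Proof. by rewrite !mxE. Qed.

Lemma eps_coef0 m n (P B : 'M[F]_(m, n)) i j : (eps P B i j)`_0 = P i j.
Proof. by rewrite epsE coefD coefC coefXM addr0. Qed.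

Lemma eps_coef1 m n (P B : 'M[F]_(m, n)) i j : (eps P B i j)`_1 = B i j.
Proof. by rewrite epsE coefD coefC coefXM /= coefC add0r. Qed.

Lemma det_eps_coef1 n (P B : 'M[F]_n) :
  (\det (eps P B))`_1 = \sum_i \det (\matrix_j (if j == i then row j B else row j P)).
Proof.
rewrite /determinant coef_sum exchange_big /=; apply: eq_bigr => s _.
rewrite -big_distrr /= -signr_odd -[X in X * _]/((-1) ^+ _) -polyC1 -polyCN -polyC_exp coefCM.
rewrite signr_odd; congr (_ * _); rewrite coef1_prod ?index_enum_uniq //.
apply: eq_bigr => i _; rewrite [in RHS](bigD1 i) //= eps_coef1 !mxE eqxx mxE; congr (_ * _).
by apply: eq_bigr => j ji; rewrite eps_coef0 !mxE (negbTE ji) mxE.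
Qed.

Lemma wedge_eps_coef1 (M A : 'M[F]_(k, N)) j :
  (wedgeR (eps M A) 0 j)`_1 = tangent_of_hom M A 0 j.
Proof.
rewrite mxE (_ : colsub _ _ = eps (colsub (sidx j) M) (colsub (sidx j) A)); last first.
  by apply/matrixP => a b; rewrite !mxE.
rewrite det_eps_coef1 /tangent_of_hom summxE; apply: eq_bigr => i _; rewrite mxE.
by congr (\det _); apply/matrixP => a b; rewrite !mxE; case: eqP => _; rewrite !mxE.
Qed.

Lemma horner_eps m n (P B : 'M[F]_(m, n)) c : map_mx (horner_eval c) (eps P B) = P + c *: B.
Proof. by apply/matrixP => i j; rewrite mxE epsE !mxE /horner_eval !hornerE. Qed.

Lemma Lam_map (R S : comNzRingType) (f : {rmorphism R -> S}) (G : 'M[R]_N) :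
  Lam k (map_mx f G) = map_mx f (Lam k G).
Proof.
apply/matrixP => i j; rewrite !mxE -det_map_mx; congr (\det _).
by apply/matrixP => a b; rewrite !mxE.
Qed.

Lemma wedge_map (R S : comNzRingType) (f : {rmorphism R -> S}) (M : 'M[R]_(k, N)) :
  wedgeR (map_mx f M) = map_mx f (wedgeR M).
Proof.
apply/matrixP => i j; rewrite !mxE -det_map_mx; congr (\det _).
by apply/matrixP => a b; rewrite !mxE.
Qed.

(* The derivative at [g], in the direction [T], of [g |-> x *m Lam g]. *)
Definition dLam x g T : 'rV[F]_K := \row_j \sum_i x 0 i * (Lam k (eps g T) i j)`_1.

Lemma dLam_wedge M T : dLam (wedge M) 1%:M T = tangent_of_hom M (M *m T).
Proof.
apply/rowP => j; rewrite -wedge_eps_coef1 mxE.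
have -> : eps M (M *m T) = map_mx polyC M *m eps 1%:M T.
  rewrite /eps mulmxDr map_mx1 mulmx1 map_mxM /=; congr (_ + _).
  by rewrite -scalemxAr.
rewrite wedge_mulr mxE coef_sum; apply: eq_bigr => i _.
by rewrite wedge_map -coefCM; congr (nth _ (polyseq (_ * _)) _); rewrite [RHS]mxE.
Qed.

Lemma dLamD x y g T : dLam (x + y) g T = dLam x g T + dLam y g T.
Proof.
by apply/rowP => j; rewrite !mxE -big_split /=; apply: eq_bigr => i _; rewrite mxE mulrDl.
Qed.

Lemma dLam_sum (I : finType) (P : pred I) (x : I -> 'rV_K) g T :
  dLam (\sum_(i | P i) x i) g T = \sum_(i | P i) dLam (x i) g T.
Proof.
apply: (big_morph (fun x => dLam x g T)) => [y z|]; first exact: dLamD.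
by apply/rowP => j; rewrite !mxE big1 // => i _; rewrite mxE mul0r.
Qed.

Lemma dLam_unit x g T : g \in unitmx ->
  dLam x g T = dLam x 1%:M (T *m invmx g) *m Lam k g.
Proof.
move=> gu; apply/rowP => j; rewrite mxE [RHS]mxE.
have -> : eps g T = eps 1%:M (T *m invmx g) *m map_mx polyC g.
  by rewrite /eps mulmxDl map_mx1 mul1mx -scalemxAl -map_mxM mulmxKV.
under eq_bigr => i _ do rewrite LamM Lam_map mxE coef_sum mulr_sumr.
rewrite exchange_big /=; apply: eq_bigr => a _.
rewrite [in RHS]mxE mulr_suml; apply: eq_bigr => i _.
by rewrite [map_mx _ _ _ _]mxE coefMC mulrA.
Qed.

Lemma dLam_euler x g : dLam x g g = k%:R *: (x *m Lam k g).
Proof.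
apply/rowP => j; rewrite mxE [RHS]mxE [X in _ * X]mxE mulr_sumr; apply: eq_bigr => i _.
have -> : eps g g = (1 + 'X)%:M *m map_mx polyC g.
  by rewrite /eps mul_scalar_mx scalerDl scale1r.
rewrite LamM Lam_scalar mul_scalar_mx Lam_map 2!mxE coefMC mulrCA; congr (_ * _).
elim: (k) => [|n IH]; first by rewrite expr0 coef1.
rewrite exprS mulrDl mul1r coefD coefXM /= IH -horner_coef0 horner_exp !hornerE expr1n.
by rewrite -natr1.
Qed.

Definition Gen : 'M[{mpoly F[N * N]}]_N := \matrix_(a, b) 'X_(mxvec_index a b).

Definition orbit_par x (j : 'I_K) : {mpoly F[N * N]} := \sum_i x 0 i *: Lam k Gen i j.

Definition args g (i : 'I_(N * N)) : F := mxvec g 0 i.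

Lemma args_surj (t : 'I_(N * N) -> F) : t = args (vec_mx (\row_i t i)).
Proof. by apply: funext => i; rewrite /args vec_mxK mxE. Qed.

Lemma Gen_eval g : map_mx (meval (args g)) Gen = g.
Proof. by apply/matrixP => a b; rewrite !mxE mevalXU /args mxvecE. Qed.

Lemma orbit_par_eval x g : pvec (orbit_par x) (args g) = x *m Lam k g.
Proof.
apply/rowP => j; rewrite !mxE raddf_sum /=; apply: eq_bigr => i _.
by rewrite mevalZ -{2}(Gen_eval g) (Lam_map (meval (args g))) [in RHS]mxE.
Qed.

Lemma meval_dir m (q : {mpoly F[m]}) (t v : 'I_m -> F) :
  let L := mmap (@polyC F) (fun i => (t i)%:P + 'X * (v i)%:P) q in
  L`_0 = q.@[t] /\ L`_1 = \sum_i v i * q^`M(i).@[t].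
Proof.
elim/mpoly_alg_ind: q => [c|i|p q [p0 p1] [q0 q1]|p q [p0 p1] [q0 q1]] /=.
- rewrite mmapC mevalC !coefC; split=> //.
  by rewrite big1 // => i _; rewrite mderivC meval0 mulr0.
- rewrite mmapX mmap1U mevalXU !coefD !coefC !coefXM /= addr0 coefC add0r; split=> //.
  rewrite (bigD1 i) //= big1 ?addr0 => [|j ji].
    by rewrite mderivXX meval1 mulr1.
  by rewrite mderivX_neq 1?eq_sym // meval0 mulr0.
- rewrite mmapD !coefD p0 q0 p1 q1 mevalD; split=> //.
  by rewrite -big_split /=; apply: eq_bigr => i _; rewrite mderivD mevalD mulrDr.
rewrite rmorphM /= !coefM big_ord1 big_ord_recr big_ord1 /= subnn subn0 p0 q0 p1 q1 mevalM.
split=> //; rewrite mulr_sumr mulr_suml -big_split /=; apply: eq_bigr => i _.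
by rewrite mderivM mevalD !mevalM; ring.
Qed.

Lemma jac_orbit x g T : mxvec T *m jac (orbit_par x) (args g) = dLam x g T.
Proof.
apply/rowP => j; rewrite [LHS]mxE.
transitivity ((mmap (@polyC F) (fun i => (args g i)%:P + 'X * (args T i)%:P) (orbit_par x j))`_1).
  by rewrite (meval_dir _ _ _).2; apply: eq_bigr => i _; rewrite !mxE.
set h := (fun i => _); rewrite mxE raddf_sum coef_sum /=; apply: eq_bigr => i _.
rewrite mmapZ /= coefCM; congr (_ * _).
have -> : eps g T = map_mx (mmap (@polyC F) h) Gen.
  by apply/matrixP => a b; rewrite epsE !mxE mmapX mmap1U /h /args !mxvecE.
by rewrite (Lam_map (mmap (@polyC F) h)) [in RHS]mxE.
Qed.

Lemma unitmx_Lam g : g \in unitmx -> Lam k g \in unitmx.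
Proof.
move=> gu; have : Lam k g *m Lam k (invmx g) = 1%:M by rewrite -LamM mulmxV // Lam1.
by case/mulmx1_unit.
Qed.

(** By equivariance the derivatives at g and at 1 differ by invertible maps on source and target. *)
Lemma jac_orbit_rank x g : g \in unitmx ->
  \rank (jac (orbit_par x) (args g)) = \rank (jac (orbit_par x) (args 1%:M)).
Proof.
move=> gu; have Lu : Lam k g \in unitmx by exact: unitmx_Lam.
set Jg := jac _ _; set J1 := jac _ _.
have E T : mxvec T *m Jg = mxvec (T *m invmx g) *m J1 *m Lam k g.
  by rewrite !jac_orbit dLam_unit.
have s1 : (Jg <= J1 *m Lam k g)%MS.
  apply/row_subP => i; rewrite rowE -[delta_mx 0 i]vec_mxK E -mulmxA.
  exact: submxMl.
have s2 : (J1 *m Lam k g <= Jg)%MS.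
  apply/row_subP => i; rewrite rowE mulmxA -[delta_mx 0 i]vec_mxK.
  by rewrite -[vec_mx _](mulmxK gu) -E submxMl.
rewrite -(mxrankMfree J1 (B := Lam k g)) ?row_free_unit //.
by apply/eqP; rewrite eqn_leq !mxrankS.
Qed.

Definition supported (I : pred ('I_N * 'I_N)) T := forall i j, ~~ I (i, j) -> T i j = 0.

(** The first hypothesis makes the images of the matrix units in [I] independent, the second makes
    them span the image. *)
Lemma jac_orbit_rank1 x (I : pred ('I_N * 'I_N)) :
  (forall T, supported I T -> dLam x 1%:M T = 0 -> T = 0) ->
  (forall i j, ~~ I (i, j) -> exists2 T, supported I T &
      dLam x 1%:M (delta_mx i j) = dLam x 1%:M T) ->
  \rank (jac (orbit_par x) (args 1%:M)) = #|I|.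
Proof.
move=> inj span; set J := jac _ _.
have JE T : mxvec T *m J = dLam x 1%:M T by rewrite jac_orbit.
pose S := \matrix_(a < #|I|) mxvec (delta_mx (enum_val a).1 (enum_val a).2 : 'M[F]_N).
have SE (u : 'rV_#|I|) : vec_mx (u *m S) = \sum_a u 0 a *: delta_mx (enum_val a).1 (enum_val a).2.
  rewrite mulmx_sum_row raddf_sum /=; apply: eq_bigr => a _.
  by rewrite linearZ /= rowK mxvecK.
have Ssupp u : supported I (vec_mx (u *m S)).
  move=> i j nI; rewrite SE summxE big1 // => a _; rewrite !mxE.
  case: (boolP ((i == _) && _)) => [/andP[/eqP e1 /eqP e2]|]; last by rewrite mulr0.
  by move: nI; rewrite e1 e2 -surjective_pairing; have := enum_valP a; rewrite unfold_in => ->.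
have suppS T : supported I T -> exists u, T = vec_mx (u *m S).
  move=> sT; exists (\row_a T (enum_val a).1 (enum_val a).2); rewrite SE.
  apply/matrixP => i j; rewrite summxE.
  have [Iij|nI] := boolP (I (i, j)); last first.
    rewrite sT // big1 // => a _; rewrite !mxE.
    case: (boolP ((i == _) && _)) => [/andP[/eqP e1 /eqP e2]|]; last by rewrite mulr0.
    by move: nI; rewrite e1 e2 -surjective_pairing; have := enum_valP a; rewrite unfold_in => ->.
  rewrite (bigD1 (enum_rank_in Iij (i, j))) //= !mxE enum_rankK_in // !eqxx mulr1 big1 ?addr0 //.
  move=> a na; rewrite !mxE; case: (boolP ((i == _) && _)) => [/andP[/eqP e1 /eqP e2]|]; last by rewrite mulr0.
  have e : enum_val a = (i, j) by rewrite [LHS]surjective_pairing -e1 -e2.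
  by case/eqP: na; apply: enum_val_inj; rewrite enum_rankK_in.
have rS : \rank (S *m J) = #|I|.
  apply/eqP; rewrite -[X in _ == X](mxrank1 F) eqn_leq.
  rewrite mxrank1 rank_leq_row /= -subn_eq0 -mxrank_ker mxrank_eq0; apply/rowV0P => u /sub_kermxP.
  rewrite mulmxA -[u *m S]vec_mxK JE => /(inj _ (Ssupp u)) u0.
  apply/rowP => a; rewrite mxE; have := congr1 (fun M : 'M_N => M (enum_val a).1 (enum_val a).2) u0.
  rewrite SE summxE (bigD1 a) //= !mxE !eqxx mulr1 big1 ?addr0 // => b ba.
  rewrite !mxE; case: (boolP ((_ == _) && _)) => [/andP[/eqP e1 /eqP e2]|]; last by rewrite mulr0.
  case/eqP: ba; apply: enum_val_inj; by rewrite [LHS]surjective_pairing -e1 -e2 -surjective_pairing.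
apply/eqP; rewrite -rS eqn_leq mxrankM_maxr andbT; apply: mxrankS.
apply/row_subP => r; case/mxvec_indexP: r => i j.
rewrite rowE -mxvec_delta JE; have [Iij|/span [T /suppS [u ->] ->]] := boolP (I (i, j)); last first.
  by rewrite -JE vec_mxK -mulmxA submxMl.
have /suppS [u ->] : supported I (delta_mx i j).
  move=> a b nI; rewrite mxE; case: (boolP (_ && _)) => // /andP[/eqP e1 /eqP e2].
  by rewrite e1 e2 Iij in nI.
by rewrite -JE vec_mxK -mulmxA submxMl.
Qed.

Hypothesis charF0 : [pchar F] =i pred0.
Hypothesis k0 : (0 < k)%N.
Hypothesis rootk : forall c : F, exists z, z ^+ k = c.

Definition GLorbit x : set (projspace F K) :=
  [set p | exists2 g, g \in unitmx & is_point p (x *m Lam k g)].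

Lemma det_Gen g : (\det Gen).@[args g] = \det g.
Proof. by rewrite -[RHS](congr1 _ (Gen_eval g)) det_map_mx. Qed.

Lemma det_Gen_neq0 : \det Gen != 0.
Proof.
apply/eqP => /(congr1 (meval (args 1%:M))); rewrite det_Gen det1 meval0 => /eqP.
by rewrite oner_eq0.
Qed.

Lemma orbit_into x : x != 0 -> param_into (GLorbit x) (orbit_par x) (\det Gen).
Proof.
move=> x0 t; rewrite (args_surj t); set g := vec_mx _; rewrite det_Gen -unitfE -unitmxE => gu.
have [|p pp] := @exists_point F K (x *m Lam k g).
  apply: contraNneq x0 => e; rewrite -[x](mulmxK (unitmx_Lam gu)) e.
  by rewrite mul0mx.
by exists p; [exists g|rewrite orbit_par_eval].
Qed.

(** A scalar c on the exterior power is the action of [z%:M] with z a k-th root of c, so the image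
    of the orbit map is stable under nonzero scalars. *)
Lemma orbit_dense x : param_dense (GLorbit x) (orbit_par x) (\det Gen).
Proof.
move=> q q0 p [g gu pg]; apply: vanishes_hcomp => d.
apply: (vanishes_homog pg); first by exists d; exact: hcomp_homog.
apply: (hcomp_vanish charF0) => c c0; have [z zc] := rootk c.
have z0 : z != 0 by apply: contraNneq c0 => z0; apply/eqP; rewrite -zc z0 expr0n gtn_eqF.
have <- : pvec (orbit_par x) (args (z%:M *m g)) = c *: (x *m Lam k g).
  by rewrite orbit_par_eval LamM Lam_scalar zc mul_scalar_mx -scalemxAr.
apply: q0; rewrite det_Gen -unitfE -unitmxE unitmx_mul gu andbT.
by rewrite unitmxE det_scalar unitfE expf_neq0.
Qed.

Lemma orbit_dim x (I : pred ('I_N * 'I_N)) (B : set (projspace F K)) : x != 0 ->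
  (forall T, supported I T -> dLam x 1%:M T = 0 -> T = 0) ->
  (forall i j, ~~ I (i, j) -> exists2 T, supported I T &
      dLam x 1%:M (delta_mx i j) = dLam x 1%:M T) ->
  GLorbit x `<=` B -> B `<=` closure (GLorbit x) -> has_dim B #|I|.-1.
Proof.
move=> x0 inj span; apply: (param_dim charF0 det_Gen_neq0 (orbit_into x0) (@orbit_dense x)).
  move=> t; rewrite (args_surj t) det_Gen -unitfE -unitmxE => gu.
  by rewrite jac_orbit_rank // (jac_orbit_rank1 inj span).
move=> t _; rewrite (args_surj t); set g := vec_mx _.
have -> : pvec (orbit_par x) (args g) = k%:R^-1 *: (mxvec g *m jac (orbit_par x) (args g)).
  rewrite jac_orbit dLam_euler scalerA mulVf ?scale1r ?orbit_par_eval //.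
  by rewrite ((pcharf0P F).1 charF0) -lt0n.
by apply: scalemx_sub; exact: submxMl.
Qed.

Lemma orbit_variety x : x != 0 -> variety (closure (GLorbit x)).
Proof.
move=> x0.
exact: (param_variety charF0 det_Gen_neq0 (orbit_into x0) (@orbit_dense x)).
Qed.

End Epsilon.

(** * Hamming distance, secant and tangent orbits *)

Section Pairs.
Variables (F : fieldType) (k N : nat).
Local Notation K := #|{: kindex k N}|.
Implicit Types (M : 'M[F]_(k, N)) (r f : 'I_k -> 'I_N) (g : 'M[F]_N).

Definition stdmx r : 'M[F]_(k, N) := rowsub r 1%:M.
Definition stde r : 'rV[F]_K := wedge (stdmx r).

Lemma stdmxE r a j : stdmx r a j = (r a == j)%:R.
Proof. by rewrite !mxE. Qed.

Lemma stdmx_mul r g : stdmx r *m g = rowsub r g.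
Proof. by rewrite /stdmx mul_rowsub_mx mul1mx. Qed.

Lemma stde_Lam r g : stde r *m Lam k g = wedge (rowsub r g).
Proof. by rewrite -stdmx_mul; symmetry; exact: wedge_mulr. Qed.

Lemma pluckerD f (x y : 'rV[F]_K) : plucker f (x + y) = plucker f x + plucker f y.
Proof. by rewrite /plucker mulmxDl mxE. Qed.

Lemma pluckerZ f c (x : 'rV[F]_K) : plucker f (c *: x) = c * plucker f x.
Proof. by rewrite /plucker -scalemxAl mxE. Qed.

Lemma plucker0 f : plucker f (0 : 'rV[F]_K) = 0.
Proof. by rewrite /plucker mul0mx mxE. Qed.

Lemma plucker_sum f (I : finType) (P : pred I) (x : I -> 'rV[F]_K) :
  plucker f (\sum_(i | P i) x i) = \sum_(i | P i) plucker f (x i).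
Proof. exact: (big_morph _ (pluckerD f) (plucker0 f)). Qed.

Lemma det_row0 n (A : 'M[F]_n) i : (forall j, A i j = 0) -> \det A = 0.
Proof.
move=> h; rewrite (expand_det_row _ i) big1 // => j _; by rewrite h mul0r.
Qed.

Lemma plucker_std0 f r a : (forall b, f b != r a) -> plucker f (stde r) = 0.
Proof.
move=> h; rewrite [LHS]plucker_wedge; apply: (det_row0 (i := a)) => b.
by rewrite mxE stdmxE eq_sym (negbTE (h b)).
Qed.

Lemma plucker_std1 r : injective r -> plucker r (stde r) = 1.
Proof.
move=> ri; rewrite [LHS]plucker_wedge -[RHS](det1 F k); congr (\det _).
by apply/matrixP => a b; rewrite mxE stdmxE mxE (inj_eq ri).
Qed.

Lemma wedge_neq0_free M : wedge M != 0 -> row_free M.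
Proof.
apply: contraNT => nf; apply/eqP/rowP => j; rewrite !mxE.
apply/eqP; apply: contraNT nf; rewrite -unitfE -unitmxE => cu.
rewrite /row_free eqn_leq rank_leq_row /=.
have rc : \rank (colsub (val (enum_val j : kindex k N)) M) = k by apply: mxrank_unit.
rewrite -[X in (X <= _)%N]rc.
by rewrite -[M in colsub _ M]mulmx1 -mulmx_colsub mxrankM_maxl.
Qed.

(** Cramer's rule: up to the factor [\det (colsub r M)], the entries of M in the basis given by r
    are Pluecker coordinates with one index exchanged. *)
Lemma cramer r M : \adj (colsub r M) *m M =
  \matrix_(i, j) \det (colsub (fun b => if b == i then j else r b) M).
Proof.
apply/matrixP => i j; rewrite mxE [RHS]mxE (expand_det_col _ i).
apply: eq_bigr => a _; rewrite !mxE eqxx mulrC; congr (_ * _).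
rewrite /cofactor; congr (_ * \det _); apply/matrixP => b c; rewrite !mxE.
by rewrite eq_sym (negbTE (neq_lift _ _)).
Qed.

Lemma complete_rows m (X : 'M[F]_N) : (m <= N)%N ->
  (forall i : 'I_N, (m <= i)%N -> row i X = 0) -> \rank X = m ->
  exists2 g, g \in unitmx & forall i : 'I_N, (i < m)%N -> row i g = row i X.
Proof.
move=> mN X0 rX.
have Prow (i : 'I_N) : (i < m)%N -> row i (pid_mx m : 'M[F]_N) = delta_mx 0 i.
  by move=> lt; apply/rowP => j; rewrite !mxE lt andbT eq_sym.
have PX : (pid_mx m : 'M_N) *m X = X.
  apply/row_matrixP => i; rewrite row_mul; have [lt|ge] := ltnP i m.
    by rewrite Prow // -rowE.
  have -> : row i (pid_mx m : 'M[F]_N) = 0.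
    by apply/rowP => j; rewrite !mxE ltnNge ge andbF.
  by rewrite mul0mx X0.
have [|g gu gX] := @complete_unitmx F N N (pid_mx m) X; first by rewrite PX rX rank_pid_mx.
exists g => // i lt.
by rewrite -PX gX row_mul Prow // -rowE.
Qed.

Section Normal.
Variable l : nat.
Hypothesis klN : (k + l <= N)%N.

Lemma ww_lt i (b : 'I_k) : ((if (b < k - i) then b : nat else b + l) < N)%N.
Proof. by have := ltn_ord b; case: ifP; lia. Qed.

(* The standard basis vectors of the i-th point on a geodesic of length l: [ww 0]
   and [ww l] are its endpoints, sharing their first k - l vectors. *)
Definition ww i b : 'I_N := Ordinal (ww_lt i b).

Lemma ww_inj i : injective (ww i).
Proof.
move=> a b /(congr1 val) /= e; apply: val_inj => /=.
by move: e; have := ltn_ord a; have := ltn_ord b; do 2! case: ifP; lia.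
Qed.

Hypothesis lk : (l <= k)%N.

Definition rw m (A : 'M[F]_(m, N)) i : 'rV[F]_N :=
  if insub i is Some a then row (a : 'I_m) A else 0.

Lemma rw_sub m (A : 'M[F]_(m, N)) i : (rw A i <= A)%MS.
Proof. by rewrite /rw; case: insubP => [a _ _|_]; [exact: row_sub|exact: sub0mx]. Qed.

Lemma rw_ord m (A : 'M[F]_(m, N)) (a : 'I_m) : rw A a = row a A.
Proof. by rewrite /rw valK. Qed.

Lemma normal_form M1 M2 : row_free M1 -> row_free M2 -> \rank (col_mx M1 M2) = (k + l)%N ->
  exists2 g : 'M[F]_N, g \in unitmx &
    (M1 :=: rowsub (ww 0) g)%MS /\ (M2 :=: rowsub (ww l) g)%MS.
Proof.
move=> /eqP f1 /eqP f2; rewrite -addsmxE => r12.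
have rC : \rank (M1 :&: M2)%MS = (k - l)%N.
  by have := mxrank_sum_cap M1 M2; rewrite f1 f2 r12; lia.
have rA : \rank (M1 :\: M2)%MS = l by have := mxrank_cap_compl M1 M2; rewrite f1 rC; lia.
have rB : \rank (M2 :\: M1)%MS = l by have := mxrank_cap_compl M2 M1; rewrite f2 capmxC rC; lia.
move: rC rA rB; set C := (M1 :&: M2)%MS; set A := (M1 :\: M2)%MS; set B := (M2 :\: M1)%MS.
move=> rC rA rB.
(* Adapted basis: the intersection in the first k - l rows, then complements of it in [M1] and in
   [M2], of l rows each. *)
pose X := \matrix_(i < N) (if (i < k - l)%N then rw (row_base C) i
   else if (i < k)%N then rw (row_base A) (i - (k - l))
   else if (i < k + l)%N then rw (row_base B) (i - k) else 0).
have CX (a : 'I_(\rank C)) : exists2 i : 'I_N, (i < k - l)%N & row a (row_base C) = row i X.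
  have la := ltn_ord a; have lt : (a < N)%N by lia.
  by exists (Ordinal lt); rewrite ?rowK /= -?rC ?la ?rw_ord.
have AX (a : 'I_(\rank A)) : exists2 i : 'I_N, (k - l <= i < k)%N & row a (row_base A) = row i X.
  have la := ltn_ord a; have lt : (k - l + a < N)%N by lia.
  exists (Ordinal lt) => /=; first by lia.
  rewrite rowK /= ifN ?ifT; try lia.
  by rewrite addKn rw_ord.
have BX (a : 'I_(\rank B)) : exists2 i : 'I_N, (k <= i < k + l)%N & row a (row_base B) = row i X.
  have la := ltn_ord a; have lt : (k + a < N)%N by lia.
  exists (Ordinal lt) => /=; first by lia.
  have -> : row (Ordinal lt) X = rw (row_base B) (k + a - k).
    rewrite rowK /=; have -> : (k + a < k - l)%N = false by lia.
    have -> : (k + a < k)%N = false by lia.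
    by have -> : (k + a < k + l)%N by lia.
  by rewrite addKn rw_ord.
have M1e : (M1 :=: A + C)%MS by apply: eqmx_sym; exact: addsmx_diff_cap_eq.
have M2e : (M2 :=: B + C)%MS by apply: eqmx_sym; rewrite /C capmxC; exact: addsmx_diff_cap_eq.
have rX : \rank X = (k + l)%N.
  rewrite -r12; apply/eqP; rewrite eqn_leq; apply/andP; split; apply: mxrankS.
    apply/row_subP => i; rewrite rowK.
    case: ifP => _; first by apply: submx_trans (rw_sub _ _) _; rewrite eq_row_base (submx_trans (capmxSl _ _)) ?addsmxSl.
    case: ifP => _; first by apply: submx_trans (rw_sub _ _) _; rewrite eq_row_base (submx_trans (diffmxSl _ _)) ?addsmxSl.
    case: ifP => _; last exact: sub0mx.
    by apply: submx_trans (rw_sub _ _) _; rewrite eq_row_base (submx_trans (diffmxSl _ _)) ?addsmxSr.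
  have sC : (C <= X)%MS.
    by rewrite -(eq_row_base C); apply/row_subP => a; have [i _ ->] := CX a; exact: row_sub.
  have sA : (A <= X)%MS.
    by rewrite -(eq_row_base A); apply/row_subP => a; have [i _ ->] := AX a; exact: row_sub.
  have sB : (B <= X)%MS.
    by rewrite -(eq_row_base B); apply/row_subP => a; have [i _ ->] := BX a; exact: row_sub.
  by rewrite addsmx_sub M1e M2e !addsmx_sub sA sB sC.
have [|i ge|g gu rowg] := @complete_rows (k + l)%N X _ _ rX; first by lia.
  by rewrite rowK !ifN //; lia.
exists g => //.
have inG i0 (i : 'I_N) : (exists b, ww i0 b = i) -> (row i g <= rowsub (ww i0) g)%MS.
  by case=> b <-; rewrite -row_rowsub row_sub.
have fin i0 M' : \rank M' = k -> (M' <= rowsub (ww i0) g)%MS -> (M' :=: rowsub (ww i0) g)%MS.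
  move=> rM s; apply/eqmxP; rewrite s /= -mxrank_leqif_sup //.
  by rewrite eqn_leq mxrankS //= rM rank_leq_row.
split; apply: fin => //.
  rewrite M1e addsmx_sub -(eq_row_base A) -(eq_row_base C); apply/andP; split; apply/row_subP => a.
    have [i li ->] := AX a; rewrite -rowg; last by lia.
    apply: inG; have lt : (i < k)%N by lia.
    by exists (Ordinal lt); apply: val_inj => /=; rewrite ifT //; lia.
  have [i li ->] := CX a; rewrite -rowg; last by lia.
  apply: inG; have lt : (i < k)%N by lia.
  by exists (Ordinal lt); apply: val_inj => /=; rewrite ifT //; lia.
rewrite M2e addsmx_sub -(eq_row_base B) -(eq_row_base C); apply/andP; split; apply/row_subP => a.
  have [i li ->] := BX a; rewrite -rowg; last by lia.
  apply: inG; have lt : (i - l < k)%N by lia.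
  by exists (Ordinal lt); apply: val_inj => /=; rewrite ifN; lia.
have [i li ->] := CX a; rewrite -rowg; last by lia.
apply: inG; have lt : (i < k)%N by lia.
by exists (Ordinal lt); apply: val_inj => /=; rewrite ifT //; lia.
Qed.

End Normal.
End Pairs.

(** * Hamming distance as a rank, and the secant orbit *)

Section Hamming.
Variables (F : fieldType) (k N : nat).
Local Notation K := #|{: kindex k N}|.
Local Notation point := (projspace F K).
Implicit Types (M : 'M[F]_(k, N)) (r f : 'I_k -> 'I_N) (g : 'M[F]_N) (p q : point).

Lemma Lam_inj g (x : 'rV[F]_K) : g \in unitmx -> x *m Lam k g = 0 -> x = 0.
Proof. by move=> gu e; rewrite -[x](mulmxK (unitmx_Lam k gu)) e mul0mx. Qed.

Lemma stde_neq0 r : injective r -> stde F r != 0.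
Proof.
move=> ri; apply/eqP => e; have := plucker_std1 F ri.
by rewrite e plucker0 => /eqP; rewrite eq_sym oner_eq0.
Qed.

Lemma eqmx_wedge M1 M2 : row_free M1 -> (M1 :=: M2)%MS ->
  exists2 c, c != 0 & wedge M1 = c *: wedge M2.
Proof.
move=> f1 e; have /submxP [Z ZE] : (M1 <= M2)%MS by rewrite e.
exists (\det Z); last by rewrite ZE; exact: wedge_mull.
rewrite -unitfE -unitmxE -row_free_unit /row_free eqn_leq rank_leq_row /=.
by move/eqP: f1 => f1; rewrite -[X in (X <= _)%N]f1 ZE mxrankM_maxl.
Qed.

Lemma rank_pair M1 M2 : row_free M1 -> row_free M2 ->
  exists l, [/\ (l <= k)%N, (k + l <= N)%N & \rank (col_mx M1 M2) = (k + l)%N].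
Proof.
move=> /eqP f1 /eqP f2; have := rank_leq_col (col_mx M1 M2); rewrite -addsmxE => h.
have h1 := mxrankS (addsmxSl M1 M2); have h2 := mxrank_sum_cap M1 M2.
by exists (\rank (M1 + M2)%MS - k)%N; split; lia.
Qed.

Lemma normal_wedge l (klN : (k + l <= N)%N) M1 M2 : (l <= k)%N ->
  row_free M1 -> row_free M2 -> \rank (col_mx M1 M2) = (k + l)%N ->
  exists g a b, [/\ g \in unitmx, a != 0, b != 0,
    wedge M1 = a *: (stde F (ww klN 0) *m Lam k g) &
    wedge M2 = b *: (stde F (ww klN l) *m Lam k g)].
Proof.
move=> lk f1 f2 r12; have [g gu [e1 e2]] := normal_form klN lk f1 f2 r12.
have [a a0 ae] := eqmx_wedge f1 e1; have [b b0 be] := eqmx_wedge f2 e2.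
by exists g, a, b; split=> //; rewrite stde_Lam.
Qed.

Lemma free_wedge_neq0 M : row_free M -> wedge M != 0.
Proof.
move=> f; have rM : \rank (col_mx M M) = (k + 0)%N.
  by rewrite -addsmxE (addsmx_idPl (submx_refl M)) addn0; apply/eqP.
have klN : (k + 0 <= N)%N by rewrite -rM rank_leq_col.
have [g [a [b [gu a0 _ -> _]]]] := normal_wedge klN (leq0n k) f f rM.
rewrite scaler_eq0 (negbTE a0) /=; apply: contraTneq isT => /(Lam_inj gu) e.
by have := stde_neq0 (@ww_inj k N 0 klN 0); rewrite e eqxx.
Qed.

Lemma ww0E l (klN : (k + l <= N)%N) (c : 'I_k) : ww klN 0 c = c :> nat.
Proof. by rewrite /= subn0 ltn_ord. Qed.

Lemma ww_neq l (klN : (k + l <= N)%N) (b c : 'I_k) : (k - l <= b)%N -> (l <= k)%N ->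
  ww klN l b != ww klN 0 c.
Proof.
by move=> lb lk; rewrite -val_eqE /=; have := ltn_ord c; do 2! case: ifP; lia.
Qed.

Lemma plucker_ww l (klN : (k + l <= N)%N) i j : (i <= l)%N -> (j <= l)%N -> (l <= k)%N -> i != j ->
  plucker (ww klN i) (stde F (ww klN j)) = 0.
Proof.
move=> il jl lk ij.
have [lt|ge] := ltnP j i.
  have ltk : (k - i < k)%N by lia.
  apply: (plucker_std0 F (a := Ordinal ltk)) => b; rewrite -val_eqE /=.
  by have := ltn_ord b; do 2! case: ifP; lia.
have ltk : (k - j < k)%N by lia.
apply: (plucker_std0 F (a := Ordinal ltk)) => b; rewrite -val_eqE /=.
by have := ltn_ord b; do 2! case: ifP; lia.
Qed.

(** Injectivity of the Pluecker embedding: in normal form with l > 0 the two wedges are distinct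
    basis vectors. *)
Lemma same_point_rank M1 M2 c : row_free M1 -> row_free M2 -> wedge M1 = c *: wedge M2 ->
  \rank (col_mx M1 M2) = k.
Proof.
move=> f1 f2 e; have [l [lk klN r12]] := rank_pair f1 f2.
have [l0|l0] := eqVneq l 0%N; first by rewrite r12 l0 addn0.
have [g [a [b [gu a0 b0 e1 e2]]]] := normal_wedge klN lk f1 f2 r12.
have : a *: stde F (ww klN 0) - (c * b) *: stde F (ww klN l) = 0.
  apply: (Lam_inj gu); rewrite mulmxBl -!scalemxAl -e1 -scalerA -e2 e subrr //.
move/(congr1 (plucker (ww klN 0))); rewrite pluckerD -scaleNr !pluckerZ plucker0.
rewrite plucker_std1 ?plucker_ww ?mulr0 ?mulr1 ?addr0 //; last exact: ww_inj.
  by move/eqP; rewrite (negbTE a0).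
by rewrite eq_sym.
Qed.

(** At distance l >= 2, a decomposable sum would in adapted coordinates have only the two nonzero
    coordinates [ww 0] and [ww l]. No single exchange of an index leads from one towards the other,
    so Cramer's rule forces a zero column inside [ww l], contradicting the second coordinate. *)
Lemma secant_decomposable_rank M1 M2 M c : row_free M1 -> row_free M2 -> c != 0 ->
  wedge M = c *: (wedge M1 + wedge M2) -> (\rank (col_mx M1 M2) <= k.+1)%N.
Proof.
move=> f1 f2 c0 e; have [l [lk klN r12]] := rank_pair f1 f2.
rewrite r12 -addn1 leq_add2l leqNgt; apply/negP => l2.
have [g [a [b [gu a0 b0 e1 e2]]]] := normal_wedge klN lk f1 f2 r12.
pose M' := M *m invmx g.
have eM : wedge M' = (c * a) *: stde F (ww klN 0) + (c * b) *: stde F (ww klN l).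
  have -> : wedge M' = wedge M *m Lam k (invmx g) by exact: wedge_mulr.
  rewrite e e1 e2 -!scalemxAl mulmxDl -!scalemxAl -!mulmxA -LamM mulmxV // Lam1 !mulmx1.
  by rewrite scalerDr !scalerA.
have pl f : plucker f (wedge M') = c * a * plucker f (stde F (ww klN 0)) + c * b * plucker f (stde F (ww klN l)).
  by rewrite eM pluckerD !pluckerZ.
have l0 : l != 0%N by lia.
have d0 : \det (colsub (ww klN 0) M') != 0.
  rewrite -plucker_wedge -[wedgeR M']/(wedge M') pl plucker_std1 ?plucker_ww //; last exact: ww_inj.
    by rewrite mulr0 addr0 mulr1 mulf_neq0.
  by rewrite eq_sym.
have ltk : (k.-1 < k)%N by lia.
pose z : 'I_k := Ordinal ltk.
have ltk2 : (k.-2 < k)%N by lia.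
pose z2 : 'I_k := Ordinal ltk2.
(* Exchanging an index i of [ww 0] for [ww l z] loses [ww 0 i] and still misses [ww l z2], so both
   summands have coordinate zero there. *)
have col0 a' : M' a' (ww klN l z) = 0.
  have /matrixP /(_ a' (ww klN l z)) : colsub (ww klN 0) M' *m (\adj (colsub (ww klN 0) M') *m M') =
      \det (colsub (ww klN 0) M') *: M' by rewrite mulmxA mul_mx_adj mul_scalar_mx.
  rewrite cramer mxE big1 => [|i _].
    by move/esym/eqP; rewrite mxE mulf_eq0 (negbTE d0) => /eqP.
  rewrite [X in _ * X]mxE -plucker_wedge -[wedgeR M']/(wedge M') pl.
  rewrite (plucker_std0 F (a := i)) ?mulr0 ?add0r; last first.
    move=> b'; have [_|ne] := eqVneq b' i; last by rewrite (inj_eq (@ww_inj _ _ _ _ _)).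
    by apply: ww_neq => //=; lia.
  rewrite (plucker_std0 F (a := z2)) ?mulr0 // => b'.
  have [_|_] := eqVneq b' i; last by rewrite eq_sym; apply: ww_neq => //=; lia.
  by rewrite (inj_eq (@ww_inj _ _ _ _ _)) -val_eqE /=; apply/eqP; lia.
have : plucker (ww klN l) (wedge M') = 0.
  rewrite [LHS]plucker_wedge -det_tr; apply: (det_row0 (i := z)) => j.
  by rewrite mxE mxE col0.
rewrite pl plucker_ww // plucker_std1; last exact: ww_inj.
by rewrite mulr0 add0r mulr1 => /eqP; rewrite mulf_eq0 (negbTE c0) (negbTE b0).
Qed.

Lemma line_sum p q (u v : 'rV[F]_K) x : is_point p u -> is_point q v -> is_point x (u + v) ->
  line_through p q x.
Proof.
rewrite /is_point /line_through /= => -> -> ->.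
by rewrite -memvE; apply: memv_add; exact: memv_line.
Qed.

Lemma points_rank p M1 M2 : is_point p (wedge M1) -> is_point p (wedge M2) ->
  \rank (col_mx M1 M2) = k.
Proof.
move=> p1 p2; have f1 := wedge_neq0_free (is_point_neq0 p1).
have f2 := wedge_neq0_free (is_point_neq0 p2).
have [c e] := mem_point p2 (is_point_mem p1); exact: same_point_rank e.
Qed.

Lemma line_rank p q M1 M2 : is_point p (wedge M1) -> is_point q (wedge M2) ->
  line_through p q `<=` @Gr F k N -> (\rank (col_mx M1 M2) <= k.+1)%N.
Proof.
move=> pp qq sub; have f1 := wedge_neq0_free (is_point_neq0 pp).
have f2 := wedge_neq0_free (is_point_neq0 qq).
have [e|s0] := eqVneq (wedge M1 + wedge M2) 0.
  rewrite (@same_point_rank M1 M2 (-1)) // scaleN1r; apply/eqP.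
  by rewrite -addr_eq0 e.
have [x xs] := exists_point s0; have [M xM] := sub _ (line_sum pp qq xs).
have [c e] := mem_point xs (is_point_mem xM).
apply: (secant_decomposable_rank f1 f2 _ e).
by apply: contraTneq (is_point_neq0 xM) => c0; rewrite e c0 scale0r eqxx.
Qed.

(** Each step raises the dimension of the sum with [M1] by at most one: the spaces [M1 + Mi] and
    [Mi + M] meet at least in [Mi], of rank k. *)
Lemma path_rank p q (r : nat) M1 M2 : is_point p (wedge M1) -> is_point q (wedge M2) ->
  Gr_path p q r -> (\rank (col_mx M1 M2) <= k + r)%N.
Proof.
move=> pp qq [c [c0 cr cG cl]].
suff H i M : (i <= r)%N -> is_point (c i) (wedge M) -> (\rank (col_mx M1 M) <= k + i)%N.
  by apply: H; rewrite // cr.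
elim: i M => [|i IH] M lt cM.
  by rewrite (@points_rank p) ?addn0 // -c0.
have [Mi ciM] := cG i (ltnW lt).
have h1 := IH _ (ltnW lt) ciM; have [_ li] := cl _ lt.
have h2 := line_rank ciM cM li.
have /eqP fi := wedge_neq0_free (is_point_neq0 ciM).
move: h1 h2; rewrite -!addsmxE => h1 h2.
have h3 := mxrank_sum_cap (M1 + Mi)%MS (Mi + M)%MS.
have h4 : (\rank Mi <= \rank ((M1 + Mi) :&: (Mi + M))%MS)%N.
  by apply: mxrankS; rewrite sub_capmx addsmxSr addsmxSl.
have h5 : (\rank (M1 + M)%MS <= \rank ((M1 + Mi) + (Mi + M))%MS)%N.
  by apply: mxrankS; apply: addsmxS; [exact: addsmxSl|exact: addsmxSr].
lia.
Qed.

Lemma wedge_row_lin M1 M2 M a b (i : 'I_k) :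
  (forall j, j != i -> row j M1 = row j M /\ row j M2 = row j M) ->
  row i M = a *: row i M1 + b *: row i M2 -> wedge M = a *: wedge M1 + b *: wedge M2.
Proof.
move=> h hi; apply/rowP => j; rewrite !mxE; apply: (@determinant_multilinear _ _ _ _ _ i).
- apply/rowP => x; move/rowP: hi => /(_ (val (enum_val j : kindex k N) x)).
  by rewrite !mxE.
- apply/matrixP => x y; rewrite !mxE.
  have ne : lift i x != i by rewrite eq_sym neq_lift.
  by have [/rowP /(_ (val (enum_val j : kindex k N) y)) + _] := h _ ne; rewrite !mxE.
apply/matrixP => x y; rewrite !mxE.
have ne : lift i x != i by rewrite eq_sym neq_lift.
by have [_ /rowP /(_ (val (enum_val j : kindex k N) y))] := h _ ne; rewrite !mxE.
Qed.

Lemma line_in_Gr p q r1 r2 g i : (forall j, j != i -> r1 j = r2 j) ->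
  is_point p (stde F r1 *m Lam k g) -> is_point q (stde F r2 *m Lam k g) ->
  line_through p q `<=` @Gr F k N.
Proof.
move=> e pp qq x; rewrite /line_through /= pp qq => h.
have [y y0 xy] := exists_vec x.
have /memv_addP [y1 /vlineP [a ->] [y2 /vlineP [b ->] ey]] : y \in (<[stde F r1 *m Lam k g]> + <[stde F r2 *m Lam k g]>)%VS.
  by apply: (subvP h); exact: is_point_mem.
exists (\matrix_j (if j == i then a *: row (r1 i) g + b *: row (r2 i) g else row (r1 j) g)).
set M := \matrix_j _; suff -> : wedge M = y by [].
rewrite ey !stde_Lam; apply: (@wedge_row_lin _ _ _ _ _ i).
  move=> j ji; rewrite rowK (negbTE ji) !row_rowsub; by rewrite e.
by rewrite rowK eqxx !row_rowsub.
Qed.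

Lemma path_exists l p q M1 M2 : is_point p (wedge M1) -> is_point q (wedge M2) ->
  (l <= k)%N -> \rank (col_mx M1 M2) = (k + l)%N -> Gr_path p q l.
Proof.
move=> pp qq lk r12; have klN : (k + l <= N)%N by rewrite -r12 rank_leq_col.
have f1 := wedge_neq0_free (is_point_neq0 pp); have f2 := wedge_neq0_free (is_point_neq0 qq).
have [g [a [b [gu a0 b0 e1 e2]]]] := normal_wedge klN lk f1 f2 r12.
have H i : exists c : point, is_point c (stde F (ww klN i) *m Lam k g).
  apply: exists_point; apply: contraTneq isT => /(Lam_inj gu) e.
  by have := stde_neq0 (@ww_inj k N l klN i); rewrite e eqxx.
have [c cP] := choice H; exists c; split.
- apply: is_point_inj (cP 0%N) _; rewrite -[stde _ _ *m _](scalerK a0) -e1.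
  by apply: is_pointZ => //; rewrite invr_eq0.
- apply: is_point_inj (cP l) _; rewrite -[stde _ _ *m _](scalerK b0) -e2.
  by apply: is_pointZ => //; rewrite invr_eq0.
- by move=> i _; exists (rowsub (ww klN i) g); rewrite -stde_Lam.
move=> i lt; split.
  move=> e; have := cP i.+1; rewrite -e => ci; have [d] := mem_point ci (is_point_mem (cP i)).
  move/eqP; rewrite -subr_eq0 scalemxAl -mulmxBl => /eqP /(Lam_inj gu).
  move/(congr1 (plucker (ww klN i))); rewrite pluckerD -scaleNr pluckerZ plucker0.
  rewrite plucker_std1 ?plucker_ww ?mulr0 ?addr0 //; try lia; last exact: ww_inj.
  by move/eqP; rewrite oner_eq0.
(* The only slot at which [ww i] and [ww i.+1] differ. *)
have ltk : (k - i.+1 < k)%N by lia.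
apply: (@line_in_Gr _ _ _ _ g (Ordinal ltk) _ (cP i) (cP i.+1)) => j; rewrite -val_eqE /= => ne.
by apply: val_inj => /=; do 2! case: ifP; lia.
Qed.

Lemma hamming_distP p q (r : nat) M1 M2 : is_point p (wedge M1) -> is_point q (wedge M2) ->
  hamming_dist p q r <-> \rank (col_mx M1 M2) = (k + r)%N.
Proof.
move=> pp qq; have f1 := wedge_neq0_free (is_point_neq0 pp).
have f2 := wedge_neq0_free (is_point_neq0 qq).
have [l [lk klN r12]] := rank_pair f1 f2.
have Pl := path_exists pp qq lk r12.
have ge (r' : nat) : Gr_path p q r' -> (l <= r')%N.
  by move/(path_rank pp qq); rewrite r12 leq_add2l.
split=> [[Pr min]|e].
  by rewrite r12; congr (_ + _)%N; apply/eqP; rewrite eqn_leq ge // min.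
have <- : l = r by apply/eqP; rewrite -(eqn_add2l k) -r12 e.
by split.
Qed.

Lemma SigmaP l x : (0 < l)%N -> Sigma F k N l x <->
  exists M1 M2, [/\ row_free M1, row_free M2, \rank (col_mx M1 M2) = (k + l)%N &
    is_point x (wedge M1 + wedge M2)].
Proof.
move=> l0; split=> [[u [v [[M1 ->] [M2 ->] xs [p [q [pp qq d]]]]]]|[M1 [M2 [f1 f2 r12 xs]]]].
  exists M1, M2; split=> //; first exact: wedge_neq0_free (is_point_neq0 pp).
    exact: wedge_neq0_free (is_point_neq0 qq).
  exact/(hamming_distP _ pp qq).
have [p pp] := exists_point (free_wedge_neq0 f1).
have [q qq] := exists_point (free_wedge_neq0 f2).
exists (wedge M1), (wedge M2); split=> //; [by exists M1|by exists M2|].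
by exists p, q; split=> //; apply/(hamming_distP _ pp qq).
Qed.

Lemma rank_rowsub_unit m (w : 'I_m -> 'I_N) g : injective w -> g \in unitmx ->
  \rank (rowsub w g) = m.
Proof.
move=> wi gu; rewrite -[g]mul1mx -mul_rowsub_mx mxrankMfree ?row_free_unit //.
apply/eqP/row_freeP; exists (colsub w 1%:M).
apply/matrixP => i j; rewrite !mxE (bigD1 (w i)) //= !mxE eqxx mul1r (inj_eq wi) big1 ?addr0 //.
by move=> a ai; rewrite !mxE eq_sym (negbTE ai) mul0r.
Qed.

Section SigmaOrbit.
Variable l : nat.
Hypothesis klN : (k + l <= N)%N.
Hypothesis l0 : (0 < l)%N.
Hypothesis lk : (l <= k)%N.

Definition sigma_pt : 'rV[F]_K := stde F (ww klN 0) + stde F (ww klN l).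

Lemma sigma_pt_neq0 : sigma_pt != 0.
Proof.
apply/eqP => /(congr1 (plucker (ww klN 0))); rewrite pluckerD plucker0.
rewrite plucker_std1 ?plucker_ww ?addr0 //; try lia; last exact: ww_inj.
by move/eqP; rewrite oner_eq0.
Qed.

Lemma wedge_scale_row r g (d : 'I_N -> F) :
  wedge (rowsub r (diag_mx (\row_i d i) *m g)) = (\prod_b d (r b)) *: wedge (rowsub r g).
Proof.
have -> : rowsub r (diag_mx (\row_i d i) *m g) = diag_mx (\row_b d (r b)) *m rowsub r g.
  by rewrite !mul_diag_mx; apply/matrixP => i j; rewrite !mxE.
rewrite -[LHS]/(wedgeR _) wedge_mull det_diag; congr (_ *: _).
by apply: eq_bigr => b _; rewrite mxE.
Qed.

Lemma Sigma_orbit : Sigma F k N l = GLorbit sigma_pt.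
Proof.
apply/seteqP; split=> x.
  case/(SigmaP x l0) => M1 [M2 [f1 f2 r12 xs]].
  have [g [a [b [gu a0 b0 e1 e2]]]] := normal_wedge klN lk f1 f2 r12.
  (* The two scalars are absorbed by rescaling one basis vector that occurs only in the first point
     and one that occurs only in the second. *)
  pose d (i : 'I_N) : F := if i == k.-1 :> nat then a else if i == (k + l).-1 :> nat then b else 1.
  have ltk : (k.-1 < k)%N by lia.
  have P1 : \prod_b0 d (ww klN 0 b0) = a.
    rewrite (bigD1 (Ordinal ltk)) //= big1 ?mulr1 => [|c]; first by rewrite /d ww0E eqxx.
    by rewrite -val_eqE /d ww0E /= => /negbTE ->; have := ltn_ord c; case: eqP => //; lia.
  have P2 : \prod_b0 d (ww klN l b0) = b.
    rewrite (bigD1 (Ordinal ltk)) //= big1 ?mulr1 => [|c]; rewrite /d /=.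
      rewrite (_ : (k.-1 < k - l)%N = false); last by lia.
      rewrite (_ : (k.-1 + l == k.-1)%N = false); last by lia.
      by rewrite (_ : (k.-1 + l == (k + l).-1)%N); last by lia.
    rewrite -val_eqE /= => ne; have := ltn_ord c => ck; case: (ltnP c (k - l)) => cl.
      by rewrite (negbTE ne); case: eqP => //; lia.
    by case: eqP; first lia; case: eqP => //; lia.
  exists (diag_mx (\row_i d i) *m g).
    rewrite unitmx_mul gu andbT unitmxE det_diag unitfE; apply/prodf_neq0 => i _.
    by rewrite mxE /d; do 2! case: ifP => _ //; exact: oner_neq0.
  by rewrite mulmxDl !stde_Lam !wedge_scale_row P1 P2 -!stde_Lam -e1 -e2.
case=> g gu; rewrite mulmxDl !stde_Lam => xs; apply/(SigmaP x l0).
exists (rowsub (ww klN 0) g), (rowsub (ww klN l) g).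
have fr i : row_free (rowsub (ww klN i) g).
  by rewrite /row_free rank_rowsub_unit //; exact: ww_inj.
split=> //.
have wi : injective (widen_ord klN) by move=> i j /(congr1 val) /= e; exact: val_inj.
rewrite -(rank_rowsub_unit wi gu) -addsmxE; apply: eqmx_rank.
rewrite !addsmx_sub -andbA; apply/and3P; split; apply/row_subP => i.
- have lt : (ww klN 0 i < k + l)%N by have := ltn_ord i; rewrite /=; case: ifP; lia.
  rewrite row_rowsub (_ : ww klN 0 i = widen_ord klN (Ordinal lt)) ?[X in (X <= _)%MS]row_rowsub; last exact: val_inj.
  by rewrite -row_rowsub row_sub.
- have lt : (ww klN l i < k + l)%N by have := ltn_ord i; rewrite /=; case: ifP; lia.
  rewrite row_rowsub (_ : ww klN l i = widen_ord klN (Ordinal lt)); last exact: val_inj.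
  by rewrite -row_rowsub row_sub.
rewrite row_rowsub; have [lt|ge] := ltnP i k.
  rewrite (_ : widen_ord klN i = ww klN 0 (Ordinal lt)); last by apply: val_inj; rewrite /= ifT; lia.
  by rewrite -row_rowsub (submx_trans (row_sub _ _)) ?addsmxSl.
have lt : (i - l < k)%N by have := ltn_ord i; lia.
rewrite (_ : widen_ord klN i = ww klN l (Ordinal lt)); last by apply: val_inj; rewrite /= ifN; lia.
by rewrite -row_rowsub (submx_trans (row_sub _ _)) ?addsmxSr.
Qed.

End SigmaOrbit.
End Hamming.

(** * The tangent orbit and its position in the closure of the secant orbit *)

Section Tangent.
Variables (F : fieldType) (k N : nat).
Local Notation K := #|{: kindex k N}|.
Local Notation point := (projspace F K).
Implicit Types (M A : 'M[F]_(k, N)) (r f : 'I_k -> 'I_N) (g : 'M[F]_N).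

Lemma map_mx_polyC_eps m n p (P : 'M[F]_(m, n)) (Q B : 'M[F]_(n, p)) :
  map_mx polyC P *m eps Q B = eps (P *m Q) (P *m B).
Proof. by rewrite /eps mulmxDr -scalemxAr !map_mxM. Qed.

Lemma tangent_mull (Z : 'M[F]_k) M A :
  tangent_of_hom (Z *m M) (Z *m A) = \det Z *: tangent_of_hom M A.
Proof.
apply/rowP => j; rewrite -wedge_eps_coef1 -map_mx_polyC_eps wedge_mull [RHS]mxE -wedge_eps_coef1.
by rewrite mxE det_map_mx coefCM.
Qed.

Lemma tangentD M A B : tangent_of_hom M (A + B) = tangent_of_hom M A + tangent_of_hom M B.
Proof.
rewrite /tangent_of_hom -big_split /=; apply: eq_bigr => i _.
rewrite -[X in _ = X + _]scale1r -[X in _ = _ + X]scale1r; apply: (@wedge_row_lin _ _ _ _ _ _ _ _ i).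
  by move=> j ji; rewrite !rowK (negbTE ji).
by rewrite !rowK eqxx !scale1r linearD.
Qed.

Lemma tangentZ M c A : tangent_of_hom M (c *: A) = c *: tangent_of_hom M A.
Proof.
rewrite /tangent_of_hom scaler_sumr /=; apply: eq_bigr => i _.
rewrite -[RHS]addr0 -(scale0r (wedge M)); apply: (@wedge_row_lin _ _ _ _ _ _ _ _ i).
  by move=> j ji; rewrite !rowK (negbTE ji).
by rewrite !rowK eqxx scale0r addr0 linearZ.
Qed.

Lemma det_unit_rows n (B : 'M[F]_n) i : (forall a b, a != i -> B a b = (a == b)%:R) -> \det B = B i i.
Proof.
move=> h; rewrite /determinant (bigD1 1%g) //= [X in _ + X]big1 ?addr0 => [|s s1].
  rewrite odd_perm1 expr0 mul1r (bigD1 i) //= perm1 big1 ?mulr1 // => a ai.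
  by rewrite perm1 h // eqxx.
have [a ai sa] : exists2 a, a != i & s a != a.
  apply/exists_inP; apply: contraR s1; rewrite negb_exists => /forallP H.
  have H' a : a != i -> s a = a by move=> ai; have := H a; rewrite ai negbK => /eqP.
  apply/eqP/permP => a; rewrite perm1; have [->|/H' //] := eqVneq a i.
  by apply/eqP; apply: contraT => si; move: (H' _ si) => /perm_inj e; rewrite e eqxx in si.
by rewrite (bigD1 a) //= h // eq_sym (negbTE sa) mul0r mulr0.
Qed.

(** The derivative of det at the identity is the trace. Representatives of a map to the quotient by
    H can thus be changed at the cost of a known multiple of [wedge M]. *)
Lemma tangent_self (Z : 'M[F]_k) M : tangent_of_hom M (Z *m M) = \tr Z *: wedge M.
Proof.
apply/rowP => j; rewrite -wedge_eps_coef1.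
have -> : eps M (Z *m M) = eps 1%:M Z *m map_mx polyC M.
  by rewrite /eps mulmxDl map_mx1 mul1mx -scalemxAl map_mxM.
rewrite wedge_mull wedge_map mxE [map_mx _ _ _ _]mxE coefMC [RHS]mxE; congr (_ * _).
rewrite det_eps_coef1; apply: eq_bigr => i _.
rewrite (@det_unit_rows _ _ i) => [|a b ai]; first by rewrite !mxE eqxx mxE.
by rewrite !mxE (negbTE ai) !mxE.
Qed.

Lemma rank_coker M A : (\rank (A *m cokermx M) + \rank M)%N = \rank (col_mx M A).
Proof.
have := mxrank_mul_ker (col_mx M A) (cokermx M).
rewrite mul_col_mx mulmx_coker rank_col_0mx => <-; congr (_ + _)%N.
apply: eqmx_rank; rewrite sub_capmx -addsmxE addsmxSl /=.
have kM : (kermx (cokermx M) <= M)%MS by rewrite submxE mulmx_ker.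
rewrite (submx_trans (capmxSr _ _) kM) andbT.
by apply/sub_kermxP; rewrite mulmx_coker.
Qed.

Section ThetaOrbit.
Variable l : nat.
Hypothesis klN : (k + l <= N)%N.
Hypothesis l0 : (0 < l)%N.
Hypothesis lk : (l <= k)%N.

Definition repl (i b : 'I_k) : 'I_N := if b == i then ww klN l b else ww klN 0 b.

(** The tangent vector of the map sending the last l basis vectors of H to l new ones and the others
    to 0. *)
Definition theta_pt : 'rV[F]_K := \sum_(i < k | (k - l <= i)%N) stde F (repl i).

Definition homA g : 'M[F]_(k, N) :=
  \matrix_(i < k) (if (k - l <= i)%N then row (ww klN l i) g else 0).

Lemma wedge_row0 M i : row i M = 0 -> wedge M = 0.
Proof.
by move=> e; rewrite (@wedge_row_lin _ _ _ M M M 0 0 i) ?scale0r ?addr0.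
Qed.

Lemma theta_tangent M A g :
  (forall i : 'I_k, row i M = row (ww klN 0 i) g) ->
  (forall i : 'I_k, (k - l <= i)%N -> row i A = row (ww klN l i) g) ->
  (forall i : 'I_k, (i < k - l)%N -> row i A = 0) ->
  tangent_of_hom M A = theta_pt *m Lam k g.
Proof.
move=> hM hA hA0; rewrite /tangent_of_hom (bigID (fun i : 'I_k => (k - l <= i)%N)) /=.
rewrite [X in _ + X]big1 ?addr0 => [|i]; last first.
  rewrite -ltnNge => lt; apply: (@wedge_row0 _ i).
  by rewrite rowK eqxx hA0.
rewrite mulmx_suml; apply: eq_bigr => i li; rewrite stde_Lam; congr wedge.
apply/row_matrixP => j; rewrite rowK row_rowsub /repl.
by case: eqP => [->|_]; rewrite ?hA // hM.
Qed.

Lemma theta_homA g : tangent_of_hom (rowsub (ww klN 0) g) (homA g) = theta_pt *m Lam k g.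
Proof.
apply: theta_tangent => i; rewrite ?row_rowsub // rowK; first by move=> ->.
by rewrite ltnNge => /negbTE ->.
Qed.

Lemma repl_inj (i : 'I_k) : (k - l <= i)%N -> injective (repl i).
Proof.
move=> li a b; rewrite /repl; have [->|ai] := eqVneq a i; have [->|bi] := eqVneq b i => //.
- by move/eqP; rewrite (negbTE (ww_neq _ _ li lk)).
- by move/eqP; rewrite eq_sym (negbTE (ww_neq _ _ li lk)).
exact: ww_inj.
Qed.

Lemma rank_homA g : g \in unitmx -> \rank (col_mx (rowsub (ww klN 0) g) (homA g)) = (k + l)%N.
Proof.
move=> gu; have wi : injective (widen_ord klN) by move=> i j /(congr1 val) /= e; exact: val_inj.
rewrite -(rank_rowsub_unit wi gu) -addsmxE; apply: eqmx_rank.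
rewrite !addsmx_sub -andbA; apply/and3P; split; apply/row_subP => i.
- have lt : (ww klN 0 i < k + l)%N by rewrite ww0E; have := ltn_ord i; lia.
  rewrite row_rowsub (_ : ww klN 0 i = widen_ord klN (Ordinal lt)); last exact: val_inj.
  by rewrite -row_rowsub row_sub.
- rewrite rowK; case: ifP => li; last exact: sub0mx.
  have lt : (ww klN l i < k + l)%N by have := ltn_ord i; rewrite /=; case: ifP; lia.
  rewrite (_ : ww klN l i = widen_ord klN (Ordinal lt)); last exact: val_inj.
  by rewrite -row_rowsub row_sub.
rewrite row_rowsub; have [lt|ge] := ltnP i k.
  rewrite (_ : widen_ord klN i = ww klN 0 (Ordinal lt)); last by apply: val_inj => /=; rewrite subn0 lt.
  by rewrite -row_rowsub (submx_trans (row_sub _ _)) ?addsmxSl.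
have lt : (i - l < k)%N by have := ltn_ord i; lia.
have li : (k - l <= Ordinal lt)%N by rewrite /=; lia.
rewrite (_ : widen_ord klN i = ww klN l (Ordinal lt)); last by apply: val_inj; rewrite /= ifN; lia.
have -> : row (ww klN l (Ordinal lt)) g = row (Ordinal lt) (homA g) by rewrite rowK li.
by rewrite (submx_trans (row_sub _ _)) ?addsmxSr.
Qed.

Lemma Theta_orbit : Theta F k N l = GLorbit theta_pt.
Proof.
apply/seteqP; split=> x; last first.
  case=> g gu; rewrite -theta_homA => xt.
  set M := rowsub (ww klN 0) g in xt.
  have fM : row_free M by rewrite /row_free rank_rowsub_unit //; exact: ww_inj.
  have [p pp] := exists_point (free_wedge_neq0 fM).
  exists (tangent_of_hom M (homA g)); split=> //; exists p, M; split=> //.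
    move=> U HU; apply: memv_suml => i _; apply: HU; exists i => j ji.
    by rewrite rowK (negbTE ji) row_sub.
  exists (homA g); rewrite subrr mem0v; split=> //.
  apply/eqP; rewrite -(eqn_add2r (\rank M)) rank_coker rank_homA //.
  by move/eqP: fM => ->; rewrite addnC.
case=> t [xt [p [M [pp _ [A [/vlineP [c /eqP]]]]]]].
rewrite subr_eq => /eqP tE rA.
have fM := wedge_neq0_free (is_point_neq0 pp); have /eqP rM := fM.
pose B := A *m cokermx M.
(* Row reduction leaves the rank in the first l rows; the reversal moves it to the last l slots,
   where [theta_pt] has it. *)
pose h : 'M[F]_k := perm_mx (perm (@rev_ord_inj k)) *m invmx (col_ebase B).
have hu : h \in unitmx by rewrite unitmx_mul unitmx_perm unitmx_inv col_ebase_unit.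
have hB (i : 'I_k) : (i < k - l)%N -> row i (h *m B) = 0.
  move=> li; have -> : h *m B = row_perm (perm (@rev_ord_inj k)) (pid_mx (\rank B) *m row_ebase B).
    by rewrite /h -[X in _ *m X = _](mulmx_ebase B) -!mulmxA mulKmx ?col_ebase_unit // row_permE.
  apply/rowP => j; rewrite !mxE permE big1 // => a _; rewrite mxE rA /=.
  rewrite (_ : (k - i.+1 < l)%N = false) ?andbF ?mul0r //.
  by have := ltn_ord i; lia.
pose M1 := h *m M; pose A1 := h *m A.
have fM1 : row_free M1.
  by rewrite /row_free /M1 eqmxMfull ?rM // row_full_unit.
pose Z0 : 'M[F]_k := \matrix_(i < k) (if (i < k - l)%N then row i A1 *m pinvmx M1 else 0).
have M1M : (M1 :=: M)%MS by rewrite /M1; apply: eqmxMfull; rewrite row_full_unit.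
have Z0E (i : 'I_k) : (i < k - l)%N -> row i (Z0 *m M1) = row i A1.
  move=> li; rewrite row_mul rowK li mulmxKpV // M1M submxE.
  by rewrite /A1 -row_mul -mulmxA hB.
have ltk : (k.-1 < k)%N by lia.
(* Subtracting [Z0 *m M1] clears the first k - l rows and changes the tangent vector by minus the
   trace times [wedge M1]. The entry d restores this and adds the multiple c of [wedge M]; it sits
   in the last slot, so the cleared rows stay zero. *)
pose z : 'I_k := Ordinal ltk; pose d := c + \tr Z0.
pose A3 := A1 - Z0 *m M1 + (d *: delta_mx z z) *m M1.
have A3t : tangent_of_hom M1 A3 = \det h *: t.
  rewrite /A3 !tangentD -mulNmx !tangent_self tE scalerDr -tangent_mull.
  have -> : \det h *: (c *: wedge M) = c *: wedge M1.
    by rewrite scalerA mulrC -scalerA; congr (_ *: _); symmetry; exact: wedge_mull.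
  have tz : \tr (d *: delta_mx z z : 'M[F]_k) = d.
    rewrite mxtraceZ /mxtrace (bigD1 z) //= mxE !eqxx big1 ?addr0 ?mulr1 // => a az.
    by rewrite mxE (negbTE az).
  rewrite tz linearN /= -addrA -scalerDl /d [c + _]addrC addrA [- _ + _]addrC subrr add0r.
  by rewrite addrC.
have dh : \det h != 0 by rewrite -unitfE -unitmxE.
pose A4 := (\det h)^-1 *: A3.
have A4t : t = tangent_of_hom M1 A4 by rewrite tangentZ A3t scalerA mulVf ?scale1r.
have A40 (i : 'I_k) : (i < k - l)%N -> row i A4 = 0.
  move=> li; rewrite linearZ /= (_ : row i A3 = 0) ?scaler0 //.
  rewrite /A3 (raddfD (row i)) (raddfB (row i)) /= Z0E // subrr add0r.
  rewrite row_mul (_ : row i _ = 0) ?mul0mx //.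
  apply/rowP => j; rewrite !mxE -val_eqE /= (_ : (i == k.-1 :> nat) = false) ?mulr0 //.
  by apply/eqP; lia.
have rA4 : \rank (col_mx M1 A4) = (k + l)%N.
  have rMA : \rank (col_mx M A) = (k + l)%N by rewrite -rank_coker rA rM addnC.
  rewrite -rMA -!addsmxE; apply: eqmx_rank.
  have A1A : (A1 :=: A)%MS by rewrite /A1; apply: eqmxMfull; rewrite row_full_unit.
  have sM : (M <= M1 + A4)%MS by rewrite -M1M addsmxSl.
  have sM' : (M1 <= M + A)%MS by rewrite M1M addsmxSl.
  have sA' : (A1 <= M + A)%MS by rewrite A1A addsmxSr.
  rewrite !addsmx_sub sM sM' /=; apply/andP; split.
    apply: scalemx_sub; rewrite addmx_sub ?(submx_trans (submxMl _ _) sM') //.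
    by rewrite addmx_sub // -mulNmx (submx_trans (submxMl _ _) sM').
  rewrite -A1A; have -> : A1 = \det h *: A4 + (Z0 - d *: delta_mx z z) *m M1.
    by rewrite scalerA mulfV // scale1r /A3 mulmxBl addrACA subrr addr0 subrK.
  rewrite addmx_sub //; first by rewrite scalemx_sub // addsmxSr.
  by rewrite (submx_trans (submxMl _ _)) ?addsmxSl.
pose X := \matrix_(i < N) (if (i < k)%N then rw M1 i
   else if (i < k + l)%N then rw A4 (i - l) else 0).
have rX : \rank X = (k + l)%N.
  rewrite -rA4 -addsmxE; apply: eqmx_rank; apply/andP; split.
    apply/row_subP => i; rewrite rowK.
    case: ifP => _; first by rewrite (submx_trans (rw_sub _ _)) ?addsmxSl.
    case: ifP => _; last exact: sub0mx.
    by rewrite (submx_trans (rw_sub _ _)) ?addsmxSr.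
  rewrite addsmx_sub; apply/andP; split; apply/row_subP => i.
    have lt : (i < N)%N by have := ltn_ord i; lia.
    have -> : row i M1 = row (Ordinal lt) X by rewrite rowK /= ltn_ord rw_ord.
    exact: row_sub.
  have [li|li] := ltnP i (k - l); first by rewrite A40 // sub0mx.
  have lt : (i + l < N)%N by have := ltn_ord i; lia.
  have -> : row i A4 = row (Ordinal lt) X; last exact: row_sub.
  rewrite rowK /= ifN; last by lia.
  by rewrite ltn_add2r ltn_ord addnK rw_ord.
have [i ge|g gu gX] := complete_rows klN _ rX.
  rewrite rowK !ifN //; lia.
exists g => //; rewrite -(@theta_tangent M1 A4) -?A4t // => i.
  rewrite gX ?rowK; last by rewrite ww0E; have := ltn_ord i; lia.
  by rewrite ww0E ltn_ord rw_ord.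
move=> li; rewrite gX ?rowK /=; last by have := ltn_ord i; case: ifP; lia.
rewrite (_ : (i < k - l)%N = false); last by lia.
by rewrite ifN ?ltn_add2r ?ltn_ord ?addnK ?rw_ord //; lia.
Qed.


Lemma mmap_horner n (y : 'I_n -> {poly F}) (q : {mpoly F[n]}) c :
  (mmap polyC y q).[c] = q.@[fun i => (y i).[c]].
Proof.
elim/mpoly_alg_ind: q => [a|i|p q IHp IHq|p q IHp IHq].
- by rewrite mmapC mevalC hornerC.
- by rewrite mmapX mmap1U mevalXU.
- by rewrite mmapD hornerD IHp IHq mevalD.
by rewrite rmorphM /= hornerM IHp IHq mevalM.
Qed.

Hypothesis charF0 : [pchar F] =i pred0.

(* For [M + c A] tends to [M], the secant line through the two corresponding
   points tends to the tangent line: (wedge (M + c A) - wedge M) / c extends to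
   c = 0 by [tangent_of_hom M A]. *)
Lemma Theta_sub_closure : Theta F k N l `<=` closure (Sigma F k N l).
Proof.
rewrite Theta_orbit => x [g gu]; rewrite -theta_homA => xt.
set M := rowsub _ g in xt; set A := homA g in xt.
apply: in_closure => f [e fe] fS; apply: (vanishes_homog xt); first by exists e.
have wi : injective (ww klN 0) by exact: ww_inj.
have fM : row_free M by rewrite /row_free rank_rowsub_unit.
(* A common right inverse of all [M + c *: A], which are therefore row free for every c. *)
have [R MR AR] : exists2 R : 'M[F]_(N, k), M *m R = 1%:M & A *m R = 0.
  have E (i : 'I_N) : row i g *m invmx g = row i 1%:M by rewrite -row_mul mulmxV.
  exists (invmx g *m colsub (ww klN 0) 1%:M); apply/row_matrixP => i; rewrite row_mul.
    rewrite row_rowsub mulmxA E; apply/rowP => j; rewrite !mxE (bigD1 (ww klN 0 i)) //= !mxE eqxx mul1r.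
    rewrite (inj_eq wi) big1 ?addr0 // => a ai; by rewrite !mxE eq_sym (negbTE ai) mul0r.
  rewrite rowK; case: ifP => li; last by rewrite mul0mx linear0.
  rewrite mulmxA E linear0; apply/rowP => j; rewrite !mxE (bigD1 (ww klN l i)) //= !mxE eqxx mul1r.
  rewrite (negbTE (ww_neq _ _ li lk)) add0r big1 // => a ai.
  by rewrite !mxE eq_sym (negbTE ai) mul0r.
have ltk : (k.-1 < k)%N by lia.
(* Negating one row turns the difference of wedges into a sum, as [Sigma] asks, with the same row
   space. *)
pose dv : 'rV[F]_k := \row_i (if i == Ordinal ltk then -1 else 1).
have ddv : \det (diag_mx dv) = -1.
  rewrite det_diag (bigD1 (Ordinal ltk)) //= mxE eqxx big1 ?mulr1 // => a az.
  by rewrite mxE (negbTE az).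
pose M2 := diag_mx dv *m M.
have wM2 : wedge M2 = - wedge M by rewrite -scaleN1r -ddv; exact: wedge_mull.
have M2M : (M2 :=: M)%MS.
  by apply: eqmxMfull; rewrite row_full_unit unitmxE ddv unitfE oppr_eq0 oner_neq0.
have fM2 : row_free M2 by rewrite /row_free M2M.
have secant c : c != 0 -> evalv f (wedge (M + c *: A) - wedge M) = 0.
  move=> c0; have fM1 : row_free (M + c *: A).
    by apply/row_freeP; exists R; rewrite mulmxDl -scalemxAl MR AR scaler0 addr0.
  have r12 : \rank (col_mx (M + c *: A) M2) = (k + l)%N.
    rewrite -(rank_homA gu) -!addsmxE; apply: eqmx_rank; rewrite -/M -/A.
    rewrite !addsmx_sub M2M addsmxSl andbT /= addmx_sub ?addsmxSl ?scalemx_sub ?addsmxSr //=.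
    rewrite -M2M addsmxSr /=.
    have EA : A = c^-1 *: ((M + c *: A) - M) by rewrite addrC addKr scalerA mulVf ?scale1r.
    rewrite [X in (X <= _)%MS]EA.
    rewrite scalemx_sub // addmx_sub ?addsmxSl // -scaleN1r scalemx_sub // -M2M.
    exact: addsmxSr.
  have s0 : wedge (M + c *: A) - wedge M != 0.
    rewrite -wM2; apply/eqP => /eqP; rewrite addr_eq0 -scaleN1r => /eqP.
    by move/(same_point_rank fM1 fM2); rewrite r12; lia.
  have [y yP] := exists_point s0.
  apply: (fS y); last exact: is_point_mem.
  by apply/(SigmaP y l0); exists (M + c *: A), M2; split=> //; rewrite wM2.
pose Z j : {poly F} := wedgeR (eps M A) 0 j - (wedge M 0 j)%:P.
have ZE c j : (Z j).[c] = (wedge (M + c *: A) - wedge M) 0 j.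
  have H : wedge (M + c *: A) 0 j = (wedgeR (eps M A) 0 j).[c].
    have /matrixP /(_ 0 j) := wedge_map (horner_eval c) (eps M A).
    by rewrite horner_eps [RHS]mxE.
  rewrite [RHS]mxE H [X in _ = _ + X]mxE /Z hornerD hornerN hornerC.
  by [].
(* Y is the difference quotient: at c != 0 it is a secant vector divided by c, at 0 the tangent
   vector. *)
have /fin_all_exists [Y YE] j : exists Yj, Z j = Yj * 'X.
  have : root (Z j) 0 by rewrite /root ZE scale0r addr0 subrr mxE.
  by case/factor_theorem => Yj; rewrite subr0; exists Yj.
have Y0 j : (Y j).[0] = tangent_of_hom M A 0 j.
  rewrite -wedge_eps_coef1 horner_coef0.
  have := congr1 (fun p : {poly F} => p`_1) (YE j).
  by rewrite coefMX /= => <-; rewrite coefB coefC subr0.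
have : mmap polyC Y f * 'X = 0.
  apply: (poly_fun0 charF0) => c; rewrite hornerM hornerX.
  have [->|c0] := eqVneq c 0; first by rewrite mulr0.
  have := secant c c0; have -> : wedge (M + c *: A) - wedge M = c *: \row_j (Y j).[c].
    by apply/rowP => j; rewrite -ZE YE hornerM hornerX !mxE mulrC.
  rewrite (evalv_homog _ _ fe) => /eqP; rewrite mulf_eq0 expf_eq0 (negbTE c0) andbF /= => /eqP.
  rewrite mmap_horner => E0; have -> : f.@[fun j => (Y j).[c]] = 0; last by rewrite mul0r.
  by rewrite -E0 /evalv; apply: meval_eq => j; rewrite mxE.
move/eqP; rewrite mulf_eq0 polyX_eq0 orbF => /eqP /(congr1 (fun p => p.[0])).
rewrite mmap_horner horner0 => <-; rewrite /evalv; apply: meval_eq => j.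
by rewrite Y0.
Qed.

End ThetaOrbit.
End Tangent.

(** * Ranks of the two orbit maps *)

Section Derivative.
Variables (F : fieldType) (k N : nat).
Implicit Types (r f : 'I_k -> 'I_N) (T : 'M[F]_N).

Definition upd r (b : 'I_k) (j : 'I_N) (a : 'I_k) : 'I_N := if a == b then j else r a.

Lemma stde_ext r r' : r =1 r' -> stde F r = stde F r'.
Proof.
by move=> e; rewrite /stde; congr wedge; apply/matrixP => a b; rewrite !stdmxE e.
Qed.

Lemma stde_noninj r a b : a != b -> r a = r b -> stde F r = 0.
Proof.
move=> ab e; apply/rowP => j; rewrite !mxE; apply: (determinant_alternate ab) => i.
by rewrite !mxE e.
Qed.

Lemma stde_swap r a b : a != b -> stde F (r \o tperm a b) = - stde F r.
Proof.
move=> ab; apply/rowP => j; rewrite !mxE.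
have -> : colsub (val (enum_val j : kindex k N)) (stdmx F (r \o tperm a b)) =
    row_perm (tperm a b) (colsub (val (enum_val j : kindex k N)) (stdmx F r)).
  by apply/matrixP => x y; rewrite !mxE.
by rewrite row_permE det_mulmx det_perm odd_tperm ab expr1 mulN1r.
Qed.

Definition dpl r f T : F := plucker f (dLam (stde F r) 1%:M T).

Lemma dplE r f T : dpl r f T =
  \sum_i \det (\matrix_(a, b) if a == i then T (r i) (f b) else (r a == f b)%:R : F).
Proof.
rewrite /dpl dLam_wedge plucker_sum; apply: eq_bigr => i _.
rewrite [LHS]plucker_wedge; congr (\det _); apply/matrixP => a b; rewrite !mxE.
case: eqP => [->|_]; last by rewrite !mxE.
by rewrite stdmx_mul !mxE.
Qed.

Lemma dpl_ext r f f' T : f =1 f' -> dpl r f T = dpl r f' T.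
Proof.
move=> e; rewrite !dplE; apply: eq_bigr => i _; congr (\det _).
by apply/matrixP => a b; rewrite !mxE e.
Qed.

Lemma dpl_swap r f a b T : a != b -> dpl r (f \o tperm a b) T = - dpl r f T.
Proof.
move=> ab; rewrite !dplE -sumrN; apply: eq_bigr => i _.
set B := \matrix_(_, _) _; set C := \matrix_(_, _) _.
have -> : B = col_perm (tperm a b) C by apply/matrixP => x y; rewrite !mxE.
by rewrite col_permE det_mulmx det_perm odd_permV odd_tperm ab expr1 mulrN1.
Qed.

(** A first-order variation replaces a single factor, so it cannot remedy two factors of r missing
    from f. *)
Lemma dpl_zero2 r f T a1 a2 : a1 != a2 -> (forall b, f b != r a1) -> (forall b, f b != r a2) ->
  dpl r f T = 0.
Proof.
move=> a12 h1 h2; rewrite dplE big1 // => i _.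
have [e|ne] := eqVneq i a1; last first.
  by apply: (det_row0 (i := a1)) => b; rewrite mxE eq_sym (negbTE ne) eq_sym (negbTE (h1 b)).
apply: (det_row0 (i := a2)) => b.
by rewrite mxE e eq_sym (negbTE a12) eq_sym (negbTE (h2 b)).
Qed.

Lemma dpl_zero1 r f T a : (forall b, f b != r a) -> (forall b, T (r a) (f b) = 0) ->
  dpl r f T = 0.
Proof.
move=> h hT; rewrite dplE big1 // => i _.
apply: (det_row0 (i := a)) => b; rewrite mxE; case: eqP => [<-//|_].
by rewrite eq_sym (negbTE (h b)).
Qed.

(** The coordinate of a single substitution isolates one entry of T; injectivity on supported
    matrices is built from such coordinates. *)
Lemma dpl_upd r T b0 j : injective r -> (forall b, r b != j) ->
  dpl r (upd r b0 j) T = T (r b0) j.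
Proof.
move=> ri nj; rewrite dplE (bigD1 b0) //= [X in _ + X]big1 ?addr0 => [|i ib].
  rewrite (@det_unit_rows _ _ _ b0) => [|a b ab]; first by rewrite mxE /upd !eqxx.
  rewrite mxE (negbTE ab) /upd; have [->|bb] := eqVneq b b0.
    by rewrite (negbTE (nj a)) (negbTE ab).
  by rewrite (inj_eq ri).
apply: (det_row0 (i := b0)) => b; rewrite mxE eq_sym (negbTE ib) /upd.
have [_|bb] := eqVneq b b0; first by rewrite (negbTE (nj b0)).
by rewrite (inj_eq ri) eq_sym (negbTE bb).
Qed.

Lemma dpl_self r T : injective r -> dpl r r T = \sum_i T (r i) (r i).
Proof.
move=> ri; rewrite dplE; apply: eq_bigr => i _.
rewrite (@det_unit_rows _ _ _ i) => [|a b ai]; first by rewrite mxE eqxx.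
by rewrite mxE (negbTE ai) (inj_eq ri).
Qed.

Lemma dLam0 (x : 'rV[F]_#|{: kindex k N}|) : dLam x 1%:M 0 = 0.
Proof. by rewrite -jac_orbit linear0 mul0mx. Qed.

Lemma dLamTD (x : 'rV[F]_#|{: kindex k N}|) T T' :
  dLam x 1%:M (T + T') = dLam x 1%:M T + dLam x 1%:M T'.
Proof. by rewrite -!jac_orbit linearD mulmxDl. Qed.

Lemma dLamTN (x : 'rV[F]_#|{: kindex k N}|) T : dLam x 1%:M (- T) = - dLam x 1%:M T.
Proof. by rewrite -!jac_orbit linearN mulNmx. Qed.

Lemma dLamT_sum (I : finType) (P : pred I) (T : I -> 'M[F]_N) (x : 'rV[F]_#|{: kindex k N}|) :
  dLam x 1%:M (\sum_(i | P i) T i) = \sum_(i | P i) dLam x 1%:M (T i).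
Proof. by apply: (big_morph (dLam x 1%:M)) => [T1 T2|]; [exact: dLamTD|exact: dLam0]. Qed.

Lemma dLam_delta0 r i j : (forall a, r a != i) -> dLam (stde F r) 1%:M (delta_mx i j) = 0.
Proof.
move=> h; rewrite dLam_wedge (_ : _ *m _ = 0).
  rewrite /tangent_of_hom big1 // => a _; apply: (@wedge_row0 _ _ _ _ a).
  by rewrite rowK eqxx linear0.
by rewrite stdmx_mul; apply/matrixP => a b; rewrite !mxE (negbTE (h a)).
Qed.

Lemma dLam_delta r b j : injective r ->
  dLam (stde F r) 1%:M (delta_mx (r b) j) = stde F (upd r b j).
Proof.
move=> ri; rewrite dLam_wedge stdmx_mul /tangent_of_hom (bigD1 b) //= big1 ?addr0 => [|a ab].
  congr wedge; apply/row_matrixP => a; rewrite rowK; apply/rowP => x.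
  rewrite !mxE /upd; case: eqP => [->|ab]; rewrite !mxE //.
  by rewrite eqxx eq_sym.
apply: (@wedge_row0 _ _ _ _ a); rewrite rowK eqxx; apply/rowP => x.
by rewrite !mxE (inj_eq ri) (negbTE ab).
Qed.

Lemma rect_card a b c d : (a <= b <= N)%N -> (c <= d <= N)%N ->
  (\sum_(i < N) \sum_(j < N) ((a <= i < b) && (c <= j < d)) = (b - a) * (d - c))%N.
Proof.
have int x y : (x <= y <= N)%N -> (\sum_(i < N) (x <= i < y) = y - x)%N.
  move=> /andP[xy yN]; rewrite -[in RHS](minn_idPr yN).
  elim: {yN}N => [|n IH]; first by rewrite big_ord0 min0n.
  by rewrite big_ord_recr /= IH; case: (boolP (x <= n < y)%N); lia.
move=> h1 h2; rewrite -(int _ _ h1) -(int _ _ h2) big_distrl /=; apply: eq_bigr => i _.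
by rewrite big_distrr /=; apply: eq_bigr => j _; rewrite mulnb.
Qed.

Lemma card_pairs (I : pred ('I_N * 'I_N)) : #|I| = (\sum_(i < N) \sum_(j < N) I (i, j))%N.
Proof.
rewrite -sum1_card big_mkcond pair_bigA /=; apply: eq_bigr => -[i j] _ /=.
by rewrite unfold_in; case: (I (i, j)).
Qed.

End Derivative.

Lemma ord_eqE n (i j : 'I_n) : (i == j) = (i == j :> nat).
Proof. by []. Qed.

Section Slots.
Variables k l : nat.
Hypothesis lk : (l <= k)%N.

Lemma pick_slot n : (2 <= l)%N -> exists2 s : 'I_k, (k - l <= s)%N & (s : nat) != n.
Proof.
move=> l2; have h1 : (k - 1 < k)%N by lia.
have h2 : (k - 2 < k)%N by lia.
have [e|ne] := eqVneq n (k - 1)%N; first by exists (Ordinal h2) => /=; lia.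
by exists (Ordinal h1); rewrite /= 1?eq_sym //; lia.
Qed.

(** The endpoints differ in the last l slots. With l >= 3, two of these remain after excluding one,
    which is what [dpl_zero2] requires; l = 2 leaves only one. *)
Lemma pick_slots2 n : (3 <= l)%N -> exists s1 s2 : 'I_k,
  [/\ (k - l <= s1)%N, (k - l <= s2)%N, s1 != s2, (s1 : nat) != n & (s2 : nat) != n].
Proof.
move=> l3; have h1 : (k - 1 < k)%N by lia.
have h2 : (k - 2 < k)%N by lia.
have h3 : (k - 3 < k)%N by lia.
have [e|ne] := eqVneq n (k - 1)%N.
  by exists (Ordinal h2), (Ordinal h3); rewrite -val_eqE /=; split; lia.
have [e|ne'] := eqVneq n (k - 2)%N.
  by exists (Ordinal h1), (Ordinal h3); rewrite -val_eqE /=; split; lia.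
by exists (Ordinal h1), (Ordinal h2); rewrite -val_eqE /=; split; lia.
Qed.

Lemma pick_slots2_of n m : (3 <= l)%N -> exists2 s : 'I_k, (k - l <= s)%N & ((s : nat) != n) && ((s : nat) != m).
Proof.
move=> l3; have [s1 [s2 [h1 h2 h12 n1 n2]]] := pick_slots2 n l3.
have [e|ne] := eqVneq (s1 : nat) m; last by exists s1; rewrite ?n1 ?ne.
by exists s2; rewrite // n2 /= -e eq_sym -val_eqE /= in h12 *.
Qed.

End Slots.

Ltac decide_nat := repeat match goal with
  | |- context [leq ?a ?b] =>
      first [have -> : leq a b = true by lia | have -> : leq a b = false by lia]
  | |- context [@eq_op _ ?a ?b] =>
      first [have -> : (a == b) = true by lia | have -> : (a == b) = false by lia]
  end.

(** The index set is a disjoint union of rectangles, the two diagonal positions counting as squares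
    of side one; stated as a sum of indicators, ready for counting. *)
Lemma sigI_rect k l i j N : (2 <= l <= k)%N -> (k + l <= N)%N -> (i < N)%N -> (j < N)%N ->
  ([|| (i < k - l) && (k - l <= j), (k - l <= i < k) && (k <= j),
      (k <= i < k + l) && (k + l <= j), (l != 2) && ((k <= i < k + l) && (k - l <= j < k)) |
      (i == j) && ((i == k - 1) || (i == k + l - 1))]%N : nat) =
   (((0 <= i < k - l) && (k - l <= j < N)) + ((k - l <= i < k) && (k <= j < N)) +
    ((k <= i < k + l) && (k + l <= j < N)) +
    (l != 2) * ((k <= i < k + l) && (k - l <= j < k)) +
    ((k - 1 <= i < k) && (k - 1 <= j < k)) +
    ((k + l - 1 <= i < k + l) && (k + l - 1 <= j < k + l)))%N.
Proof.
move=> lk klN iN jN; move: (l != 2) => b; rewrite jN.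
have [i1|i1] := ltnP i (k - l)%N; first by decide_nat; case: b; rewrite /= ?(andbF, andbT, orbF, addn0, add0n, muln0, mul0n, mul1n) /=.
have [i2|i2] := ltnP i k.
  have [j1|j1] := ltnP j k; last by decide_nat; case: b; rewrite /= ?(andbF, andbT, orbF, addn0, add0n, muln0, mul0n, mul1n) /=.
  have [e|ne] := eqVneq i j; last by have [?|?] := eqVneq i (k - 1)%N; decide_nat; case: b; rewrite /= ?(andbF, andbT, orbF, addn0, add0n, muln0, mul0n, mul1n) /=.
  by have [?|?] := eqVneq i (k - 1)%N; decide_nat; case: b; rewrite /= ?(andbF, andbT, orbF, addn0, add0n, muln0, mul0n, mul1n) /=.
have [i3|i3] := ltnP i (k + l)%N; last by decide_nat; case: b; rewrite /= ?(andbF, andbT, orbF, addn0, add0n, muln0, mul0n, mul1n) /=.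
have [j1|j1] := ltnP j k; first by have [?|?] := ltnP j (k - l)%N; decide_nat; case: b; rewrite /= ?(andbF, andbT, orbF, addn0, add0n, muln0, mul0n, mul1n) /=.
have [j2|j2] := ltnP j (k + l)%N; last by decide_nat; case: b; rewrite /= ?(andbF, andbT, orbF, addn0, add0n, muln0, mul0n, mul1n) /=.
have [e|ne] := eqVneq i j.
  by have [?|?] := eqVneq i (k + l - 1)%N; decide_nat; case: b; rewrite /= ?(andbF, andbT, orbF, addn0, add0n, muln0, mul0n, mul1n) /=.
by have [?|?] := eqVneq i (k + l - 1)%N; decide_nat; case: b; rewrite /= ?(andbF, andbT, orbF, addn0, add0n, muln0, mul0n, mul1n) /=.
Qed.

(** * The secant orbit: rank of the derivative at its base vector *)

Section SigmaRank.
Variables (F : fieldType) (k N l : nat).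
Hypothesis klN : (k + l <= N)%N.
Hypothesis l2 : (2 <= l)%N.
Hypothesis lk : (l <= k)%N.
Local Notation u := (ww klN 0).
Local Notation v := (ww klN l).
Implicit Types (T : 'M[F]_N) (i j : 'I_N) (a b s : 'I_k).

(* For l = 2 the substitutions q -> p in the second summand coincide up to sign
   with substitutions p -> q in the first one, whence the condition l != 2; the
   two diagonal positions account for the two summands themselves. *)
Definition sigI (ij : 'I_N * 'I_N) : bool :=
  let i : nat := ij.1 in let j : nat := ij.2 in
  [|| (i < k - l) && (k - l <= j), (k - l <= i < k) && (k <= j),
      (k <= i < k + l) && (k + l <= j), (l != 2) && ((k <= i < k + l) && (k - l <= j < k)) |
      (i == j) && ((i == k - 1) || (i == k + l - 1))]%N.

Lemma sigIE i j : sigI (i, j) =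
  [|| (i < k - l) && (k - l <= j), (k - l <= i < k) && (k <= j),
      (k <= i < k + l) && (k + l <= j), (l != 2) && ((k <= i < k + l) && (k - l <= j < k)) |
      (i == j :> nat) && ((i == k - 1 :> nat) || (i == k + l - 1 :> nat))]%N.
Proof. by []. Qed.

Lemma u_neq b j : (b : nat) != j -> u b != j.
Proof. by rewrite ord_eqE /= subn0 ltn_ord. Qed.

Lemma u_neqge b j : (k <= j)%N -> u b != j.
Proof. by move=> h; clear l2 lk; apply: u_neq; have := ltn_ord b; lia. Qed.

Lemma vE b : v b = (if b < k - l then b : nat else b + l)%N :> nat.
Proof. by []. Qed.

Lemma vge s : (k - l <= s)%N -> v s = (s + l)%N :> nat.
Proof. by move=> h; rewrite vE ltnNge h. Qed.

Lemma vlt s : (s < k - l)%N -> v s = s :> nat.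
Proof. by move=> h; rewrite vE h. Qed.

Lemma upd_neq (r : 'I_k -> 'I_N) b0 j x : j != x -> (forall b, b != b0 -> r b != x) ->
  forall b, upd r b0 j b != x.
Proof. by move=> jx h b; rewrite /upd; have [_|bb] := eqVneq b b0; [|exact: h]. Qed.

(** Generally two factors of v are missing from [upd u a j], so the second summand does not
    interfere with reading entries from the first. *)
Lemma dpl_v_zero a j T : supported sigI T -> (k <= j)%N -> dpl v (upd u a j) T = 0.
Proof.
move=> sT kj.
have miss s : (k - l <= s)%N -> (s + l)%N != j -> forall b, upd u a j b != v s.
  move=> ks sj; apply: upd_neq => [|b _]; first by rewrite ord_eqE vge // eq_sym.
  by apply: u_neqge; rewrite vge //; lia.
have [al|al] := ltnP a (k - l).
  have [s ks sj] := pick_slot lk (j - l)%N l2.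
  apply: (@dpl_zero2 _ _ _ _ _ _ a s).
  - by rewrite ord_eqE /=; lia.
  - apply: upd_neq => [|b ba]; first by rewrite ord_eqE vlt //; have := ltn_ord a; lia.
    by apply: u_neq; rewrite vlt.
  by apply: miss => //; lia.
have [l3|le2] := ltnP 2 l.
  have [s1 [s2 [k1 k2 s12 n1 n2]]] := pick_slots2 lk (j - l)%N l3.
  by apply: (@dpl_zero2 _ _ _ _ _ _ s1 s2) => //; apply: miss => //; lia.
have e2 : l = 2%N by lia.
have [jl|jl] := leqP (k + l) j.
  have h1 : (k - 1 < k)%N by lia.
  have h2 : (k - 2 < k)%N by lia.
  apply: (@dpl_zero2 _ _ _ _ _ _ (Ordinal h1) (Ordinal h2)).
  - by rewrite ord_eqE /=; lia.
  - by apply: miss => /=; lia.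
  by apply: miss => /=; lia.
(* For l = 2 and j an index of q, a single factor of v is missing; the entries that could supply it
   run from q to p, to the common part or to another index of q, all outside [sigI]. *)
have [s ks sj] := pick_slot lk (j - l)%N l2.
apply: (@dpl_zero1 _ _ _ _ _ _ s) => [|b]; first by apply: miss => //; lia.
apply: sT; rewrite sigIE vge // /upd; case: eqP => _; first by have := ltn_ord s; lia.
by rewrite ww0E; have := ltn_ord s; have := ltn_ord b; lia.
Qed.

Lemma dpl_u_zero b0 j T :
  [|| (b0 < k - l)%N && (k - l <= j < k)%N, (k - l <= b0)%N && (k + l <= j)%N |
      (l != 2) && (k - l <= b0)%N && (k - l <= j < k)%N] ->
  dpl u (upd v b0 j) T = 0.
Proof.
have miss s : (k - l <= s)%N -> (s : nat) != j -> forall b, upd v b0 j b != u s.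
  move=> ks sj; apply: upd_neq => [|b _]; first by rewrite ord_eqE ww0E eq_sym.
  by rewrite ord_eqE ww0E vE; have := ltn_ord s; case: ifP; lia.
case/or3P.
- move=> /andP[bl jl]; have [s ks sj] := pick_slot lk j l2.
  apply: (@dpl_zero2 _ _ _ _ _ _ b0 s).
  + by rewrite ord_eqE /=; lia.
  + apply: upd_neq => [|b ba]; first by rewrite ord_eqE ww0E; lia.
    by rewrite ord_eqE ww0E vE; move: ba; rewrite ord_eqE /=; case: ifP; lia.
  by apply: miss.
- move=> /andP[bl jl]; have h1 : (k - 1 < k)%N by lia.
  have h2 : (k - 2 < k)%N by lia.
  apply: (@dpl_zero2 _ _ _ _ _ _ (Ordinal h1) (Ordinal h2)).
  + by rewrite ord_eqE /=; lia.
  + by apply: miss => /=; lia.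
  by apply: miss => /=; lia.
move=> /andP[/andP[ne bl] jl]; have l3 : (3 <= l)%N by lia.
have [s1 [s2 [k1 k2 s12 n1 n2]]] := pick_slots2 lk j l3.
by apply: (@dpl_zero2 _ _ _ _ _ _ s1 s2) => //; apply: miss.
Qed.

Lemma dpl_uv_zero T : dpl u v T = 0 /\ dpl v u T = 0.
Proof.
have h1 : (k - 1 < k)%N by lia.
have h2 : (k - 2 < k)%N by lia.
split; apply: (@dpl_zero2 _ _ _ _ _ _ (Ordinal h1) (Ordinal h2)) => [|b|b].
- by rewrite ord_eqE /=; lia.
- by rewrite ord_eqE ww0E vE /=; case: ifP; lia.
- by rewrite ord_eqE ww0E vE /=; case: ifP; lia.
- by rewrite ord_eqE /=; lia.
- by apply: u_neqge; rewrite vge /=; lia.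
by apply: u_neqge; rewrite vge /=; lia.
Qed.

Lemma sigma_inj T : supported sigI T -> dLam (sigma_pt F klN) 1%:M T = 0 -> T = 0.
Proof.
move=> sT e0.
have S f : dpl u f T + dpl v f T = 0 by rewrite /dpl -pluckerD -dLamD [dLam _ _ _]e0 plucker0.
have TA a j : (k <= j)%N -> T (u a) j = 0.
  move=> kj; have := S (upd u a j); rewrite dpl_v_zero // addr0 dpl_upd //; first exact: ww_inj.
  by move=> b; exact: u_neqge.
have TB b0 j : [|| (b0 < k - l)%N && (k - l <= j < k)%N, (k - l <= b0)%N && (k + l <= j)%N |
      (l != 2) && (k - l <= b0)%N && (k - l <= j < k)%N] -> T (v b0) j = 0.
  move=> h; have := S (upd v b0 j); rewrite dpl_u_zero // add0r dpl_upd //; first exact: ww_inj.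
  by move=> b; rewrite ord_eqE vE; have := ltn_ord b; case: ifP; move: h; lia.
have h1 : (k - 1 < k)%N by lia.
(* The coordinate u of the derivative is a trace, of which the support leaves one term; likewise for
   v. *)
have TU : T (u (Ordinal h1)) (u (Ordinal h1)) = 0.
  have := S u; rewrite (dpl_uv_zero T).2 addr0 dpl_self; last exact: ww_inj.
  rewrite (bigD1 (Ordinal h1)) //= big1 ?addr0 // => a; rewrite ord_eqE /= => ne.
  by apply: sT; rewrite sigIE !ww0E; have := ltn_ord a; lia.
have TV : T (v (Ordinal h1)) (v (Ordinal h1)) = 0.
  have := S v; rewrite (dpl_uv_zero T).1 add0r dpl_self; last exact: ww_inj.
  rewrite (bigD1 (Ordinal h1)) //= big1 ?addr0 // => a; rewrite ord_eqE /= => ne.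
  by apply: sT; rewrite sigIE !vE; have := ltn_ord a; case: ifP; lia.
apply/matrixP => i j; rewrite mxE; have [Iij|/sT //] := boolP (sigI (i, j)).
have iu (ik : (i < k)%N) : i = u (Ordinal ik) by apply: val_inj; rewrite /= subn0 ik.
have ivl (ik : (i < k - l)%N) : exists2 b : 'I_k, (b < k - l)%N & i = v b.
  have ik' : (i < k)%N by lia.
  by exists (Ordinal ik') => //; apply: val_inj; rewrite /= ik.
have ivq (ik : (k <= i < k + l)%N) : exists2 b : 'I_k, (k - l <= b)%N & i = v b.
  have ik' : (i - l < k)%N by lia.
  exists (Ordinal ik') => /=; first by lia.
  by apply: val_inj; rewrite /= ifN; lia.
move: Iij; rewrite sigIE => /or4P [/andP[i1 j1]|/andP[/andP[i1 i2] j1]|/andP[i1 j1]|].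
- have [jk|kj] := ltnP j k; last first.
    have ik : (i < k)%N by lia.
    by rewrite (iu ik) TA.
  by have [b bl ->] := ivl i1; apply: TB; rewrite bl j1 jk.
- by rewrite (iu i2) TA.
- by have [b bl ->] := ivq i1; apply: TB; rewrite bl j1 !orbT.
case/orP => [/andP[ne /andP[i1 j1]]|/andP[/eqP /val_inj <- /orP [/eqP ei|/eqP ei]]].
- by have [b bl ->] := ivq i1; apply: TB; rewrite ne bl j1 !orbT.
- by have -> : i = u (Ordinal h1) by apply: val_inj; rewrite /= ei ifT; lia.
by have -> : i = v (Ordinal h1) by apply: val_inj; rewrite /= ei ifN; lia.
Qed.

Local Notation L T := (dLam (sigma_pt F klN) 1%:M T).

Lemma sigma_L T : L T = dLam (stde F u) 1%:M T + dLam (stde F v) 1%:M T.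
Proof. exact: dLamD. Qed.

Lemma sigma_Lu_p a j : (k - l <= a)%N -> L (delta_mx (u a) j) = stde F (upd u a j).
Proof.
move=> ka; rewrite sigma_L dLam_delta ?dLam_delta0 ?addr0 // => [b|]; last exact: ww_inj.
by rewrite ord_eqE ww0E vE; have := ltn_ord a; case: ifP; lia.
Qed.

Lemma sigma_Lv_q a j : (k - l <= a)%N -> L (delta_mx (v a) j) = stde F (upd v a j).
Proof.
move=> ka; rewrite sigma_L dLam_delta0 ?dLam_delta ?add0r //; first exact: ww_inj.
by move=> b; apply: u_neqge; rewrite vge //; lia.
Qed.

Lemma upd_same (r : 'I_k -> 'I_N) a : upd r a (r a) =1 r.
Proof. by move=> b; rewrite /upd; case: eqP => [->|]. Qed.

Lemma supported_delta i j : sigI (i, j) -> supported sigI (delta_mx i j : 'M[F]_N).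
Proof.
move=> Iij x y nI; rewrite mxE; case: (boolP (_ && _)) => // /andP[/eqP e1 /eqP e2].
by rewrite e1 e2 Iij in nI.
Qed.

Lemma slot_u i : (i < k)%N -> exists a : 'I_k, i = u a.
Proof. by move=> ik; exists (Ordinal ik); apply: val_inj; rewrite /= subn0 ik. Qed.

Lemma slot_c i : (i < k - l)%N -> exists2 a : 'I_k, i = u a & i = v a.
Proof.
clear l2.
move=> ic; have ik : (i < k)%N by lia.
by exists (Ordinal ik); apply: val_inj; rewrite /= ?subn0 ?ik ?ic.
Qed.

Lemma slot_q i : (k <= i < k + l)%N -> exists2 b : 'I_k, (k - l <= b)%N & i = v b.
Proof.
clear l2.
move=> iq; have ik : (i - l < k)%N by lia.
exists (Ordinal ik) => /=; first by lia.
by apply: val_inj; rewrite /= ifN; lia.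
Qed.

Lemma sigI_uv a b : (k - l <= a)%N -> (k - l <= b)%N -> sigI (u a, v b).
Proof.
move=> ka kb; rewrite sigIE ww0E vge //; apply/or4P/Or42; rewrite ka ltn_ord /=; lia.
Qed.

Lemma sigma_span i j : ~~ sigI (i, j) ->
  exists2 T : 'M[F]_N, supported sigI T & L (delta_mx i j) = L T.
Proof.
have h1 : (k - 1 < k)%N by lia.
pose z : 'I_k := Ordinal h1; have kz : (k - l <= z)%N by rewrite /=; lia.
pose p := u z; pose q := v z.
have supP : supported sigI (delta_mx p p : 'M[F]_N).
  by apply: supported_delta; rewrite sigIE /p ww0E /=; lia.
have supQ : supported sigI (delta_mx q q : 'M[F]_N).
  by apply: supported_delta; rewrite sigIE /q vge //=; lia.
have LP : L (delta_mx p p) = stde F u by rewrite sigma_Lu_p //; apply: stde_ext; exact: upd_same.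
have LQ : L (delta_mx q q) = stde F v by rewrite sigma_Lv_q //; apply: stde_ext; exact: upd_same.
have zero : L (delta_mx i j) = 0 -> exists2 T : 'M[F]_N, supported sigI T & L (delta_mx i j) = L T.
  by move=> ->; exists 0; [move=> x y _; rewrite mxE|rewrite dLam0].
rewrite sigIE => nI.
have [ic|ic] := ltnP i (k - l).
  have jc : (j < k - l)%N by move: nI; lia.
  have [a iu iv] := slot_c ic; have [b ju jv] := slot_c jc.
  have LE : L (delta_mx i j) = stde F (upd u a j) + stde F (upd v a j).
    by rewrite sigma_L {1}iu {1}iv !dLam_delta //; exact: ww_inj.
  have [e|ne] := eqVneq i j.
    exists (delta_mx p p + delta_mx q q).
      by move=> x y nxy; rewrite mxE supP ?supQ ?addr0.
    rewrite dLamTD LP LQ LE -e {1}iu iv; congr (_ + _); apply: stde_ext; exact: upd_same.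
  have nab : a != b by apply: contraNneq ne => e; rewrite iu ju e.
  have st0 (r : 'I_k -> 'I_N) : stde F (upd r a (r b)) = 0.
    by apply: (stde_noninj F nab); rewrite /upd eqxx eq_sym (negbTE nab).
  by apply: zero; rewrite LE {1}ju jv !st0 addr0.
have [ip|ip] := ltnP i k.
  have jk : (j < k)%N by move: nI; lia.
  have [a iu] := slot_u ip; have [b ju] := slot_u jk.
  have ka : (k - l <= a)%N by rewrite iu ww0E in ic.
  have LE : L (delta_mx i j) = stde F (upd u a j) by rewrite iu sigma_Lu_p.
  have [e|ne] := eqVneq i j.
    exists (delta_mx p p); first exact: supP.
    by rewrite LE LP -e iu; apply: stde_ext; exact: upd_same.
  have nab : a != b by apply: contraNneq ne => e; rewrite iu ju e.
  by apply: zero; rewrite LE ju; apply: (stde_noninj F nab); rewrite /upd eqxx eq_sym (negbTE nab).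
have [iq|iq] := ltnP i (k + l); last first.
  apply: zero; rewrite sigma_L !dLam_delta0 ?addr0 // => a; rewrite ord_eqE.
    by rewrite vE; have := ltn_ord a; case: ifP; lia.
  by rewrite ww0E; have := ltn_ord a; lia.
have [|s ks iv] := @slot_q i; first by rewrite ip iq.
have LE : L (delta_mx i j) = stde F (upd v s j) by rewrite iv sigma_Lv_q.
have jkl : (j < k + l)%N by move: nI; lia.
have [e|ne] := eqVneq i j.
  exists (delta_mx q q); first exact: supQ.
  by rewrite LE LQ -e iv; apply: stde_ext; exact: upd_same.
have zv b : j = v b -> exists2 T : 'M[F]_N, supported sigI T & L (delta_mx i j) = L T.
  move=> jv; apply: zero; rewrite LE jv; have nsb : s != b by apply: contraNneq ne => e; rewrite iv jv e.
  by apply: (stde_noninj F nsb); rewrite /upd eqxx eq_sym (negbTE nsb).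
have [jq|jq] := leqP k j.
  have [|b _ jv] := @slot_q j; [by rewrite jq jkl|exact: zv jv].
have [jc|jc] := ltnP j (k - l); first by have [b _ jv] := slot_c jc; exact: zv jv.
(* The exceptional case. Replacing v_s by u_t leaves v_w and u_t, with w the other slot; the same
   vector comes from the first summand by putting v_w in place of the factor other than u_t, with a
   sign when t = w. *)
have e2 : l = 2%N by move: nI; lia.
have [t ju] := slot_u jq; have kt : (k - l <= t)%N by rewrite ju ww0E in jc.
have [w kw ws] := pick_slot lk s l2.
have wv (b : 'I_k) : (k - l <= b)%N -> b != s -> b = w.
  move=> kb; rewrite ord_eqE => bs; apply: val_inj; have := ltn_ord b; have := ltn_ord w.
  by have := ltn_ord s; rewrite /=; lia.
have uv (b : 'I_k) : b != s -> b != w -> u b = v b.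
  move=> bs bw; apply: val_inj; rewrite /= subn0 ltn_ord ifT //.
  by rewrite ltnNge; apply: contra bw => kb; apply/eqP; exact: wv.
have sw : s != w by rewrite ord_eqE eq_sym.
have [e|ne'] := eqVneq t s.
  exists (delta_mx (u w) (v w)).
    by apply: supported_delta; exact: sigI_uv.
  rewrite LE sigma_Lu_p //; apply: stde_ext => b; rewrite /upd.
  have [->|bs] := eqVneq b s; first by rewrite (negbTE sw) ju e.
  by have [->|bw] := eqVneq b w => //; rewrite uv.
have ew : t = w by apply: wv.
exists (- delta_mx (u s) (v w)).
  by move=> x y nxy; rewrite mxE (@supported_delta (u s) (v w)) ?oppr0 //; exact: sigI_uv.
rewrite LE dLamTN sigma_Lu_p // -(stde_swap _ _ sw); apply: stde_ext => b; rewrite /= /upd.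
have [->|bs] := eqVneq b s.
  by rewrite tpermL eq_sym (negbTE sw) ju ew.
have [->|bw] := eqVneq b w; first by rewrite tpermR eqxx.
have tb : tperm s w b = b by rewrite tpermD // eq_sym.
by rewrite tb (negbTE bs) uv.
Qed.

Lemma card_sigI : #|sigI| =
  ((k - l) * (N - (k - l)) + l * (N - k) + l * (N - (k + l)) + (l != 2) * (l * l) + 2)%N.
Proof.
have ll : (2 <= l <= k)%N by rewrite l2 lk.
have E i j := @sigI_rect k l i j N ll klN (ltn_ord i) (ltn_ord j).
rewrite card_pairs.
under eq_bigr => i _ do under eq_bigr => j _ do rewrite sigIE E.
under eq_bigr => i _ do rewrite !big_split /= -big_distrr /=.
have R := @rect_card N 0 (k - l)%N (k - l)%N N; rewrite /= in R.
rewrite !big_split /= -big_distrr /= R ?rect_card; try lia.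
have -> : (k - (k - l) = l)%N by lia.
have -> : (k + l - k = l)%N by lia.
have -> : (k - (k - 1) = 1)%N by lia.
have -> : (k + l - (k + l - 1) = 1)%N by lia.
by rewrite subn0 -addnA.
Qed.

End SigmaRank.

Lemma theI_rect k l i j N : (2 <= l <= k)%N -> (k + l <= N)%N -> (i < N)%N -> (j < N)%N ->
  ([|| (i < k - l) && (k - l <= j), (k - l <= i < k + l) && (k <= j) |
      (i == k + l - 1) && (j == k - 1)]%N : nat) =
   (((0 <= i < k - l) && (k - l <= j < N)) + ((k - l <= i < k + l) && (k <= j < N)) +
    ((k + l - 1 <= i < k + l) && (k - 1 <= j < k)))%N.
Proof.
move=> lk klN iN jN; rewrite jN.
have [i1|i1] := ltnP i (k - l)%N; first by decide_nat; rewrite /= ?(andbF, andbT, orbF, addn0, add0n).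
have [j1|j1] := ltnP j k; last first.
  by have [?|?] := ltnP i (k + l)%N; decide_nat; rewrite /= ?(andbF, andbT, orbF, addn0, add0n).
have [?|?] := eqVneq i (k + l - 1)%N; have [?|?] := ltnP i (k + l)%N; try lia; have [?|?] := eqVneq j (k - 1)%N; try lia; decide_nat;
  by rewrite /= ?(andbF, andbT, orbF, addn0, add0n).
Qed.

(** * The tangent orbit: rank of the derivative at its base vector *)

Section ThetaRank.
Variables (F : fieldType) (k N l : nat).
Hypothesis charF0 : [pchar F] =i pred0.
Hypothesis klN : (k + l <= N)%N.
Hypothesis l3 : (3 <= l)%N.
Hypothesis lk : (l <= k)%N.
Local Notation u := (ww klN 0).
Local Notation v := (ww klN l).
Local Notation rho := (repl klN).
Implicit Types (T : 'M[F]_N) (i j : 'I_N) (a b s t y : 'I_k).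

(** Among the p and q indices, substitutions within p are combinations of substitutions within q. Of
    those from q to p, only v_a to u_a act nontrivially, all with the same image [stde u]; one of
    them is kept. *)
Definition theI (ij : 'I_N * 'I_N) : bool :=
  let i : nat := ij.1 in let j : nat := ij.2 in
  [|| (i < k - l) && (k - l <= j), (k - l <= i < k + l) && (k <= j) |
      (i == k + l - 1) && (j == k - 1)]%N.

Lemma theIE i j : theI (i, j) =
  [|| (i < k - l) && (k - l <= j), (k - l <= i < k + l) && (k <= j) |
      (i == k + l - 1 :> nat) && (j == k - 1 :> nat)]%N.
Proof. by []. Qed.

Lemma rho_at s : rho s s = v s.
Proof. by rewrite /repl eqxx. Qed.

Lemma rho_ne s b : b != s -> rho s b = u b.
Proof. by rewrite /repl => /negbTE ->. Qed.

Lemma v_ge s : (k - l <= s)%N -> (k <= v s)%N.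
Proof. by move=> ks; rewrite (vge klN ks); clear l3 lk; lia. Qed.

Lemma u_neq_v s b : (k - l <= s)%N -> u b != v s.
Proof. by move=> ks; apply: u_neqge; exact: v_ge. Qed.

Lemma rho_updu s a j : a != s -> (k - l <= s)%N -> (k <= j)%N -> j != v s ->
  forall T, dpl (rho s) (upd u a j) T = 0.
Proof.
move=> as_ ks kj js T; apply: (@dpl_zero2 _ _ _ _ _ _ a s) => //.
  rewrite rho_ne //; apply: upd_neq => [|b ba]; first by rewrite eq_sym u_neqge.
  by rewrite (inj_eq (@ww_inj _ _ _ _ _)).
rewrite rho_at; apply: upd_neq => // b _; exact: u_neq_v.
Qed.

(** Up to a transposition of slots a and t, the coordinate is that of putting u_t for u_a in
    [rho t]; the transposition gives the sign. *)
Lemma rho_swap t a T : a != t -> (k - l <= t)%N ->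
  dpl (rho t) (upd u a (v t)) T = - T (u a) (u t).
Proof.
move=> at_ kt.
have -> : T (u a) (u t) = dpl (rho t) (upd (rho t) a (u t)) T.
  rewrite dpl_upd ?rho_ne //; first exact: repl_inj.
  move=> b; have [->|bt] := eqVneq b t; first by rewrite rho_at eq_sym u_neq_v.
  by rewrite rho_ne // (inj_eq (@ww_inj _ _ _ _ _)).
rewrite -(dpl_swap _ _ _ at_); apply: dpl_ext => b; rewrite /= /upd.
have [->|ba] := eqVneq b a; first by rewrite tpermL eq_sym (negbTE at_) rho_at.
have [->|bt] := eqVneq b t; first by rewrite tpermR eqxx.
by rewrite tpermD 1?eq_sym // 1?eq_sym // (negbTE ba) rho_ne.
Qed.

Lemma two_neq y a j x : j != x -> v y != x -> (forall b, b != a -> b != y -> u b != x) ->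
  forall b, upd (rho y) a j b != x.
Proof.
move=> jx vx h; apply: upd_neq => // b ba; have [->|by_] := eqVneq b y; first by rewrite rho_at.
by rewrite rho_ne // h.
Qed.

Lemma u_eq b b' : (u b == u b') = (b == b').
Proof. exact: (inj_eq (@ww_inj _ _ _ _ _)). Qed.

Lemma v_eq b b' : (v b == v b') = (b == b').
Proof. exact: (inj_eq (@ww_inj _ _ _ _ _)). Qed.

Lemma theta_inj T : supported theI T -> dLam (theta_pt F klN) 1%:M T = 0 -> T = 0.
Proof.
move=> sT e0.
have S f : \sum_(s < k | (k - l <= s)%N) dpl (rho s) f T = 0.
  by rewrite /dpl -plucker_sum -dLam_sum [dLam _ _ _]e0 plucker0.
have single f s : (k - l <= s)%N ->
    (forall s', (k - l <= s')%N -> s' != s -> dpl (rho s') f T = 0) -> dpl (rho s) f T = 0.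
  by move=> ks h; have := S f; rewrite (bigD1 s) //= big1 ?addr0 // => s' /andP[]; exact: h.
have Tuu a b : (k - l <= a)%N -> T (u a) (u b) = 0.
  by move=> ka; apply: sT; rewrite theIE !ww0E; have := ltn_ord a; have := ltn_ord b; lia.
have Tuu0 a : T (u a) (u a) = 0.
  by apply: sT; rewrite theIE !ww0E; have := ltn_ord a; lia.
have Tcp a t : (a < k - l)%N -> (k - l <= t)%N -> T (u a) (u t) = 0.
  move=> ac kt; have at_ : a != t by apply: contraTneq ac => ->; rewrite -leqNgt.
  apply/eqP; rewrite -oppr_eq0 -rho_swap //; apply/eqP; apply: single => // s ks st.
  apply: rho_updu => //; first by apply: contraTneq ac => ->; rewrite -leqNgt.
    exact: v_ge.
  by rewrite v_eq eq_sym.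
have Tq s j : (k - l <= s)%N -> (k <= j)%N -> T (v s) j = 0.
  move=> ks kj; have [->|js] := eqVneq j (v s).
    have : dpl (rho s) (rho s) T = 0.
      apply: single => // s' ks' ss'.
      rewrite (@dpl_ext _ _ _ _ _ (upd u s (v s))) => [|b]; last by rewrite /upd /repl; case: eqP => [->|].
      by apply: rho_updu; rewrite ?v_ge // 1?v_eq eq_sym.
    rewrite dpl_self; last exact: repl_inj.
    rewrite (bigD1 s) //= rho_at big1 ?addr0 // => b bs.
    by rewrite rho_ne.
  have : dpl (rho s) (upd u s j) T = 0.
    apply: single => // s' ks' ss'; have [->|js'] := eqVneq j (v s').
      by rewrite rho_swap 1?eq_sym // Tuu ?oppr0.
    by apply: rho_updu => //; rewrite eq_sym.
  rewrite (@dpl_ext _ _ _ _ _ (upd (rho s) s j)) => [|b]; last first.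
    by rewrite /upd; have [//|bs] := eqVneq b s; rewrite rho_ne.
  rewrite dpl_upd ?rho_at //; first exact: repl_inj.
  move=> b; have [->|bs] := eqVneq b s; first by rewrite rho_at eq_sym.
  by rewrite rho_ne // u_neqge.
have Tu a j : (k <= j)%N -> j != v a -> T (u a) j = 0.
  (* With y distinct from a and from the slot of j, the list [upd (rho y) a j] lacks two factors of
     every other summand, so only summand y contributes. *)
  move=> kj ja; have [y ky /andP[ya yj]] := pick_slots2_of lk a (j - l)%N l3.
  have {}ya : y != a by rewrite ord_eqE.
  have {}yj : j != v y by rewrite ord_eqE (vge klN ky); lia.
  have := single (upd (rho y) a j) y ky; rewrite dpl_upd ?rho_ne 1?eq_sym //; last first.
  - move=> b; have [->|b_y] := eqVneq b y; first by rewrite rho_at eq_sym.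
    by rewrite rho_ne // u_neqge.
  - exact: repl_inj.
  apply=> s ks sy.
  have miss_y : forall b, upd (rho y) a j b != rho s y.
    rewrite rho_ne 1?eq_sym //; apply: two_neq; first by rewrite eq_sym u_neqge.
      by rewrite eq_sym u_neq_v.
    by move=> b _; rewrite u_eq.
  apply: (@dpl_zero2 _ _ _ _ _ _ y a) => //.
  have [e|as_] := eqVneq a s.
    rewrite -e rho_at; apply: two_neq => //; first by rewrite v_eq.
    by move=> b _ _; apply: u_neq_v; rewrite e.
  rewrite rho_ne //; apply: two_neq; first by rewrite eq_sym u_neqge.
    by rewrite eq_sym u_neq_v.
  by move=> b ba _; rewrite u_eq.
(* The list u with both slots a and y replaced by v is reached from [rho y] and from [rho a]; only
   the sum of the two entries is visible. *)
have Tpair a y : (k - l <= a)%N -> (k - l <= y)%N -> a != y -> T (u a) (v a) + T (u y) (v y) = 0.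
  move=> ka ky ay; have := S (upd (rho y) a (v a)).
  rewrite (bigD1 y) //= (bigD1 a) /=; last by rewrite ka.
  rewrite big1 ?addr0 => [|s /andP[/andP[ks sy] sa]]; last first.
    apply: (@dpl_zero2 _ _ _ _ _ _ a y) => //.
      rewrite rho_ne 1?eq_sym //; apply: two_neq; try by rewrite eq_sym u_neq_v.
      by move=> b ba _; rewrite u_eq.
    rewrite rho_ne 1?eq_sym //; apply: two_neq; try by rewrite eq_sym u_neq_v.
    by move=> b _ b_y; rewrite u_eq.
  rewrite dpl_upd ?rho_ne //; last first.
  - move=> b; have [->|b_y] := eqVneq b y; first by rewrite rho_at v_eq eq_sym.
    by rewrite rho_ne // u_neq_v.
  - exact: repl_inj.
  rewrite (@dpl_ext _ _ _ _ _ (upd (rho a) y (v y))) => [|b]; last first.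
    rewrite /upd /repl; have [->|ba] := eqVneq b a; first by rewrite (negbTE ay).
    by have [->|] := eqVneq b y.
  rewrite dpl_upd ?rho_ne 1?eq_sym //; first exact: repl_inj.
  move=> b; have [->|ba] := eqVneq b a; first by rewrite rho_at v_eq.
  by rewrite rho_ne // u_neq_v.
(* Three entries with vanishing pairwise sums: each is zero because 2 is invertible. This takes
   three slots, hence l >= 3. *)
have Tpq a : (k - l <= a)%N -> T (u a) (v a) = 0.
  move=> ka; have [s1 [s2 [k1 k2 s12 n1 n2]]] := pick_slots2 lk a l3.
  have a1 : a != s1 by rewrite ord_eqE eq_sym.
  have a2 : a != s2 by rewrite ord_eqE eq_sym.
  have e1 := Tpair _ _ ka k1 a1; have e2 := Tpair _ _ ka k2 a2; have e3 := Tpair _ _ k1 k2 s12.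
  have : (T (u a) (v a)) *+ 2 = 0.
    by rewrite -[RHS](subrr 0) -{1}[0](addr0 0) -{1}e1 -{1}e2 -e3; ring.
  by move/eqP; rewrite -mulr_natr mulf_eq0 ((pcharf0P F).1 charF0) orbF => /eqP.
apply/matrixP => i j; rewrite mxE; have [Iij|/sT //] := boolP (theI (i, j)).
move: Iij; rewrite theIE => /or3P [/andP[i1 j1]|/andP[/andP[i1 i2] j1]|/andP[/eqP i1 /eqP j1]].
- have [a iu iv] := slot_c klN lk i1; have [jk|kj] := ltnP j k.
    have [t jt] := slot_u klN jk; rewrite iu jt; apply: Tcp; first by rewrite iu ww0E in i1.
    by rewrite jt ww0E in j1.
  rewrite iu; apply: Tu => //; rewrite -iv; apply: contraTneq kj => ->.
  by rewrite -ltnNge; lia.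
- have [ik|ik] := ltnP i k; last first.
    have [|s ks ->] := @slot_q k N l klN lk i; first by rewrite ik i2.
    exact: Tq.
  have [a iu] := slot_u klN ik; have ka : (k - l <= a)%N by rewrite iu ww0E in i1.
  rewrite iu; have [->|ne] := eqVneq j (v a); [exact: Tpq|exact: Tu].
have zk : (k - 1 < k)%N by lia.
pose z : 'I_k := Ordinal zk; have kz : (k - l <= z)%N by rewrite /=; lia.
have -> : i = v z by apply: ord_inj; rewrite (vge klN kz) /=; lia.
have -> : j = u z by apply: ord_inj; rewrite ww0E.
have := S u; rewrite (eq_bigr (fun s => T (v s) (u s))) => [|s ks]; last first.
  rewrite (@dpl_ext _ _ _ _ _ (upd (rho s) s (u s))) => [|b]; last first.
    by rewrite /upd; have [->//|bs] := eqVneq b s; rewrite rho_ne.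
  rewrite dpl_upd ?rho_at //; first exact: repl_inj.
  move=> b; have [->|bs] := eqVneq b s; first by rewrite rho_at eq_sym u_neq_v.
  by rewrite rho_ne // u_eq.
rewrite (bigD1 z) //= big1 ?addr0 // => s /andP[ks]; rewrite ord_eqE /= => sz.
by apply: sT; rewrite theIE (vge klN ks) ww0E; have := ltn_ord s; lia.
Qed.

Local Notation L T := (dLam (theta_pt F klN) 1%:M T).

Lemma theta_L T : L T = \sum_(s < k | (k - l <= s)%N) dLam (stde F (rho s)) 1%:M T.
Proof. exact: dLam_sum. Qed.

Lemma theta_Lv a j : (k - l <= a)%N -> L (delta_mx (v a) j) = stde F (upd u a j).
Proof.
move=> ka; rewrite theta_L (bigD1 a) //= big1 ?addr0 => [|s /andP[ks sa]].
  rewrite -{1}rho_at dLam_delta; last exact: repl_inj.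
  by apply: stde_ext => b; rewrite /upd; have [//|ba] := eqVneq b a; rewrite rho_ne.
apply: dLam_delta0 => b; have [->|bs] := eqVneq b s; first by rewrite rho_at v_eq.
by rewrite rho_ne // u_neq_v.
Qed.

Lemma theta_Lu a j : L (delta_mx (u a) j) =
  \sum_(s < k | (k - l <= s)%N && (s != a)) stde F (upd (rho s) a j).
Proof.
rewrite theta_L [RHS]big_mkcondr /=; apply: eq_bigr => s ks.
have [e|sa] /= := eqVneq s a.
  apply: dLam_delta0 => b; rewrite -e; have [->|bs] := eqVneq b s.
    by rewrite rho_at eq_sym u_neq_v.
  by rewrite rho_ne // u_eq.
by rewrite -(@rho_ne s a) 1?eq_sym // dLam_delta //; exact: repl_inj.
Qed.

Lemma theta_supp i j : theI (i, j) -> supported theI (delta_mx i j : 'M[F]_N).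
Proof.
move=> Iij x y nI; rewrite mxE; case: (boolP (_ && _)) => // /andP[/eqP e1 /eqP e2].
by rewrite e1 e2 Iij in nI.
Qed.

Lemma theI_vv a b : (k - l <= a)%N -> (k - l <= b)%N -> theI (v a, v b).
Proof.
move=> ka kb; rewrite theIE !vge //; apply/or3P/Or32.
by have := ltn_ord a; lia.
Qed.

Lemma theta_span i j : ~~ theI (i, j) ->
  exists2 T : 'M[F]_N, supported theI T & L (delta_mx i j) = L T.
Proof.
have zero : L (delta_mx i j) = 0 -> exists2 T : 'M[F]_N, supported theI T & L (delta_mx i j) = L T.
  by move=> ->; exists 0; [move=> x y _; rewrite mxE|rewrite dLam0].
have noninj (r : 'I_k -> 'I_N) a b : a != b -> r b = u b -> stde F (upd r a (u b)) = 0.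
  by move=> ab rb; apply: (stde_noninj F ab); rewrite /upd eqxx eq_sym (negbTE ab).
rewrite theIE => nI.
have [ik|ik] := ltnP i k.
  have jk : (j < k)%N by move: nI; lia.
  have [a iu] := slot_u klN ik; have [b ju] := slot_u klN jk.
  have [e|ab] := eqVneq a b.
    (* The unit at (u_a, u_a) fixes every summand [rho s] containing u_a, that is all s != a; each
       of these is also selected by the unit at (v_s, v_s). *)
    exists (\sum_(s < k | (k - l <= s)%N && (s != a)) delta_mx (v s) (v s)).
      move=> x y nxy; rewrite summxE big1 // => s /andP[ks _].
      by apply: theta_supp nxy; exact: theI_vv.
    rewrite iu ju -e theta_Lu dLamT_sum; apply: eq_bigr => s /andP[ks sa].
    rewrite theta_Lv //; apply: stde_ext => c; rewrite /upd.
    have [->|ca] := eqVneq c a; first by rewrite eq_sym (negbTE sa).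
    by rewrite /repl; case: eqP => [->|].
  have [bc|kb] := ltnP b (k - l).
    apply: zero; rewrite iu ju theta_Lu big1 // => s /andP[ks sa].
    by apply: noninj => //; rewrite rho_ne //; apply: contraTneq bc => ->; rewrite -leqNgt.
  have ka : (k - l <= a)%N by move: nI; rewrite iu ju !ww0E; lia.
  exists (- delta_mx (v a) (v b)).
    by move=> x y nxy; rewrite mxE (@theta_supp (v a) (v b)) ?oppr0 //; exact: theI_vv.
  rewrite iu ju theta_Lu dLamTN theta_Lv // (bigD1 b) /=; last by rewrite kb eq_sym.
  rewrite big1 ?addr0 => [|s /andP[/andP[ks sa] sb]]; last first.
    by apply: noninj => //; rewrite rho_ne // eq_sym.
  rewrite -(stde_swap _ _ ab); apply: stde_ext => c; rewrite /= /upd.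
  have [->|ca] := eqVneq c a; first by rewrite tpermL eq_sym (negbTE ab).
  have [->|cb] := eqVneq c b; first by rewrite tpermR eqxx rho_at.
  have -> : tperm a b c = c by rewrite tpermD // eq_sym.
  by rewrite (negbTE ca) rho_ne.
have [iq|iq] := ltnP i (k + l); last first.
  apply: zero; rewrite theta_L big1 // => s ks; apply: dLam_delta0 => b.
  rewrite ord_eqE; have [->|bs] := eqVneq b s.
    by rewrite rho_at (vge klN ks); have := ltn_ord s; lia.
  by rewrite rho_ne // ww0E; have := ltn_ord b; lia.
have jk : (j < k)%N by move: nI; lia.
have [|a ka iv] := @slot_q k N l klN lk i; first by rewrite ik iq.
have [b ju] := slot_u klN jk.
have [e|ab] := eqVneq a b; last by apply: zero; rewrite iv ju theta_Lv // noninj.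
have zk : (k - 1 < k)%N by lia.
pose z : 'I_k := Ordinal zk; have kz : (k - l <= z)%N by rewrite /=; lia.
exists (delta_mx (v z) (u z)).
  by apply: theta_supp; rewrite theIE (vge klN kz) ww0E /=; lia.
rewrite iv ju -e !theta_Lv //; apply: stde_ext => c; by rewrite !upd_same.
Qed.

Lemma card_theI : #|theI| =
  ((k - l) * (N - (k - l)) + (l + l) * (N - k) + 1)%N.
Proof.
have l2 : (2 <= l)%N by lia.
have ll : (2 <= l <= k)%N by rewrite l2 lk.
have E i j := @theI_rect k l i j N ll klN (ltn_ord i) (ltn_ord j).
rewrite card_pairs.
under eq_bigr => i _ do under eq_bigr => j _ do rewrite theIE E.
under eq_bigr => i _ do rewrite !big_split /=.
have R := @rect_card N 0 (k - l)%N (k - l)%N N; rewrite /= in R.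
rewrite !big_split /= R ?rect_card; try lia.
have -> : (k + l - (k - l) = l + l)%N by lia.
have -> : (k - (k - 1) = 1)%N by lia.
have -> : (k + l - (k + l - 1) = 1)%N by lia.
by rewrite subn0.
Qed.

End ThetaRank.

(** * Dimensions of the orbits and the codimension *)

Section Main.
Variables (F : fieldType) (k N l : nat).
Hypothesis charF0 : [pchar F] =i pred0.
Hypothesis rootk : forall c : F, exists z, z ^+ k = c.
Hypothesis klN : (k + l <= N)%N.
Hypothesis lk : (l <= k)%N.

Lemma theta_pt_neq0 : (0 < l)%N -> theta_pt F klN != 0.
Proof.
move=> l0; have zk : (k - 1 < k)%N by lia.
pose z : 'I_k := Ordinal zk; have kz : (k - l <= z)%N by rewrite /=; lia.
apply/eqP => /(congr1 (plucker (repl klN z))); rewrite plucker0 plucker_sum (bigD1 z) //=.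
rewrite plucker_std1; last exact: repl_inj.
rewrite big1 ?addr0 => [/eqP|s /andP[ks sz]]; first by rewrite oner_eq0.
apply: (plucker_std0 F (a := z)) => b; rewrite [repl _ s z]rho_ne 1?eq_sym //.
have [->|bz] := eqVneq b z; first by rewrite rho_at u_neq_v.
by rewrite rho_ne // u_eq eq_sym.
Qed.

Lemma Sigma_dim (B : set (projspace F #|{: kindex k N}|)) : (2 <= l)%N ->
  Sigma F k N l `<=` B -> B `<=` closure (Sigma F k N l) -> has_dim B (#|@sigI k N l|).-1.
Proof.
move=> l2; rewrite (Sigma_orbit F klN) ?(ltnW l2) //; apply: orbit_dim => //; try lia.
- by apply: sigma_pt_neq0 => //; lia.
- by move=> T; apply: sigma_inj.
by move=> i j; apply: sigma_span.
Qed.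

Lemma Theta_dim : (3 <= l)%N -> has_dim (closure (Theta F k N l)) (#|@theI k N l|).-1.
Proof.
move=> l3; have l0 : (0 < l)%N by lia.
rewrite (Theta_orbit F klN) //; apply: (orbit_dim charF0 _ rootk) => //; try lia.
- exact: theta_pt_neq0.
- by move=> T; apply: theta_inj.
- by move=> i j; apply: theta_span.
- exact: subset_closure.
exact: subset_refl.
Qed.

Lemma closure_Theta_codim1 : (3 <= l)%N ->
  codim1_subvariety (closure (Theta F k N l)) (closure (Sigma F k N l)).
Proof.
move=> l3; have l0 : (0 < l)%N by lia.
have k0 : (0 < k)%N by lia.
have l2 : (2 <= l)%N by lia.
split.
- by rewrite (Theta_orbit F klN) //; apply: orbit_variety => //; exact: theta_pt_neq0.
- by rewrite (Sigma_orbit F klN) //; apply: orbit_variety => //; exact: sigma_pt_neq0.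
- rewrite [X in X `<=` _]closureE; apply: smallest_sub; first exact: closed_closure.
  exact: (Theta_sub_closure klN l0 lk charF0).
exists (#|@theI k N l|).-1; first exact: Theta_dim.
have -> : (#|@theI k N l|).-1.+1 = (#|@sigI k N l|).-1.
  rewrite (card_theI klN l3 lk) (card_sigI klN l2 lk).
  have -> : (l != 2)%N by lia.
  rewrite mulnDl mul1n.
  have -> : (l * (N - k) = l * (N - (k + l)) + l * l)%N by rewrite -mulnDr; congr (_ * _)%N; lia.
  by rewrite addn1 addn2 /= !addnA; congr _.+1; lia.
apply: Sigma_dim => //; exact: subset_closure.
Qed.

End Main.

Local Open Scope nat_scope.

Theorem proposition3p3p6 (R : realType) (k N : nat) :
  3 <= k -> 2 * k <= N ->
  (forall l : nat, 2 <= l -> l <= k - 1 ->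
     has_dim (Sigma R[i] k N l)
       (if l == 2 then k * (N - k) + l * (N - l) - 3
        else k * (N - k) + l * (N - l) + 1)) /\
  (forall l : nat, 3 <= l -> l <= k ->
     codim1_subvariety (closure (Theta R[i] k N l)) (closure (Sigma R[i] k N l))).
Proof.
move=> k3 kN; have k0 : 0 < k by lia.
have charC0 : [pchar R[i]]%R =i pred0 := Num.Theory.pchar_num _.
have rootC (c : R[i]) : exists z : R[i], (z ^+ k)%R = c.
  by eexists; exact: (Num.Theory.rootCK k0 c).
split=> l l2 lk; last by apply: closure_Theta_codim1 => //; lia.
have klN : k + l <= N by lia.
have lk' : l <= k by lia.
have -> : (if l == 2 then k * (N - k) + l * (N - l) - 3 else k * (N - k) + l * (N - l) + 1) =
    (#|@sigI k N l|).-1.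
  rewrite (card_sigI klN l2 lk').
  (* Here c is the dimension of the common part and m that of the complement of the span of the two
     k-spaces; in these variables the products are free of truncated subtraction. *)
  have [c kE] : exists c, k = l + c by exists (k - l); lia.
  have [m NE] : exists m, N = l + c + l + m by exists (N - (k + l)); lia.
  have -> : k - l = c by lia.
  have -> : N - c = l + l + m by lia.
  have -> : N - k = l + m by lia.
  have -> : N - (k + l) = m by lia.
  have -> : N - l = l + c + m by lia.
  rewrite kE; case: eqP => [->|_] /=; nia.
by apply: Sigma_dim => //; exact: subset_closure.
Qed.
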